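(* Let $U\subset\mathbb{C}_\tau$ and $\Omega\subset\mathbb{C}^n_z$ be bounded domains and $\varphi\colon U\times\Omega\to\mathbb{R}$ a function that is smooth on $\overline{U\times\Omega}$. Define $\Phi\colon U\to\mathbb{R}$ by $e^{-\Phi(\tau)}=\int_{z\in\Omega}e^{-\varphi(\tau,z)}$. Let $g\colon U\to\mathbb{R}_{\geq0}$ be non-negative and $\omega=\sqrt{-1}\,\mathrm{d}\tau\wedge\mathrm{d}\bar\tau$. Then the following are equivalent: (1) $\sqrt{-1}\partial\overline{\partial}\Phi\geq g\,\omega$ on $U$; (2) for every $a\in U$ and every $\varepsilon>0$ there exists $r_\varepsilon\in(0,\delta(a))$ such that $L_\Phi(a,r)\leq e^{-\max\{\frac{g(a)-\varepsilon}{2},0\}r^2}$ for all $r\in(0,r_\varepsilon)$.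
   Context: $\Delta(a;r)=\{\tau\in\mathbb{C}\mid|\tau-a|<r\}$; $\delta(a)=\sup\{r>0\mid\Delta(a;r)\subset U\}$. For $0<r<\delta(a)$, $L_\Phi(a,r)=\inf\{\int_{\Delta(a;r)}|f|^2e^{-\Phi}/(\pi r^2e^{-\Phi(a)})\mid f\text{ holomorphic on }\Delta(a;r),\ \int_{\Delta(a;r)}|f|^2e^{-\Phi}<\infty,\ f(a)=1\}$. *)

(* Defs.v *)
(* MathComp + MathComp-Analysis, with complex numbers R[i] from
   mathcomp-real-closed.  The complex plane is (R[i])^o, which carries the
   standard (norm) topology of the numFieldType R[i] and is a normed module
   over R[i] itself (so `derivable f t 1` is complex differentiability). *)
From mathcomp Require Import all_boot all_order all_algebra.
From mathcomp Require Import all_classical all_reals all_analysis.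
From mathcomp Require Import complex.
Import Order.TTheory GRing.Theory Num.Theory.
Import numFieldNormedType.Exports.

Set Implicit Arguments.
Unset Strict Implicit.
Unset Printing Implicit Defensive.

Local Open Scope classical_set_scope.
Local Open Scope ring_scope.

Section Defs.
Variable R : realType.
Local Notation C := ((R[i])^o).

Definition cabs (z : C) : R := ComplexField.Normc.normc z.

Definition bounded_domain (T : normedModType C) (D : set T) : Prop :=
  D !=set0 /\ open D /\ connected D /\ bounded_set D.

Definition disc (a : C) (r : R) : set C := [set t | cabs (t - a) < r].

Definition delta (U : set C) (a : C) : R :=
  sup [set r : R | 0 < r /\ disc a r `<=` U].

Definition holomorphic_on (D : set C) (f : C -> C) : Prop :=
  forall t, D t -> derivable f t 1.

(** Lebesgue integral over C = R^2 of a non-negative function, written as an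
    iterated integral in the real and imaginary parts (Tonelli). *)
Definition cint (F : C -> \bar R) : \bar R :=
  (\int[@lebesgue_measure R]_x \int[@lebesgue_measure R]_y F (x +i* y)%C)%E.

Fixpoint cnint (n : nat) : ('rV[C]_n -> \bar R) -> \bar R :=
  match n return ('rV[C]_n -> \bar R) -> \bar R with
  | 0 => fun F => F 0
  | n'.+1 => fun F =>
      cint (fun w => @cnint n' (fun v => F (row_mx (\row_(j < 1) w) v)))
  end.

Definition LPhi (Phi : C -> R) (a : C) (r : R) : R :=
  inf [set x : R | exists f : C -> C,
         [/\ holomorphic_on (disc a r) f,
             f a = 1,
             (cint (fun t => (\1_(disc a r) t * cabs (f t) ^+ 2
                              * expR (- Phi t))%:E) < +oo)%E &
             x = fine (cint (fun t => (\1_(disc a r) t * cabs (f t) ^+ 2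
                              * expR (- Phi t))%:E))
                 / (pi * r ^+ 2 * expR (- Phi a))]].

(** The coefficient of sqrt(-1) d tau /\ d bar tau in sqrt(-1) dd^c-bar Phi,
    i.e. d^2 Phi / (d tau d bar tau) = (Phi_xx + Phi_yy) / 4, tau = x + i y. *)
Definition ddbar_coef (Phi : C -> R) (a : C) : R :=
  ((derive1 (fun x => derive1 (fun x' => Phi (x' +i* complex.Im a)%C) x)
            (complex.Re a)
   + derive1 (fun y => derive1 (fun y' => Phi (complex.Re a +i* y')%C) y)
            (complex.Im a))
  / 4).

Fixpoint Ck (N : nat) (k : nat) (W : set 'rV[R]_N) (f : 'rV[R]_N -> R) : Prop :=
  match k with
  | 0 => forall x, W x -> {for x, continuous f}
  | k'.+1 => (forall x, W x -> differentiable f x) /\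
             forall v : 'rV[R]_N, Ck k' W (fun x => 'D_v f x)
  end.

Definition smooth_on (N : nat) (W : set 'rV[R]_N) (f : 'rV[R]_N -> R) : Prop :=
  forall k, Ck k W f.

Definition cpt (n : nat) (v : 'rV[R]_(1 + n + (1 + n))) : 'rV[C]_(1 + n) :=
  \row_j ((lsubmx v) 0 j +i* (rsubmx v) 0 j)%C.
Definition tau_of (n : nat) (w : 'rV[C]_(1 + n)) : C := w 0 (lshift n ord0).
Definition z_of (n : nat) (w : 'rV[C]_(1 + n)) : 'rV[C]_n := rsubmx w.

Definition smooth_on_closure (n : nat) (U : set C) (Om : set 'rV[C]_n)
    (phi : C -> 'rV[C]_n -> R) : Prop :=
  let UO := [set v : 'rV[R]_(1 + n + (1 + n)) |
              U (tau_of (cpt v)) /\ Om (z_of (cpt v))] in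
  exists W : set 'rV[R]_(1 + n + (1 + n)),
    [/\ open W, closure UO `<=` W &
        exists psi, smooth_on W psi /\
          forall v, UO v -> psi v = phi (tau_of (cpt v)) (z_of (cpt v))].

End Defs.

(* Main.v *)
(** Phi is C^2 by differentiation under the integral sign; write c for the
coefficient of i dd-bar Phi.

For (2) => (1), let P be the holomorphic quadratic polynomial with
Phi <= Phi(a) + 2 Re (P(t - a) - P(0)) + k |t - a|^2 near a, where k > c(a) is
close to c(a).  For f holomorphic with f(a) = 1, the function
F = f exp(P(0) - P(t - a)) takes the value 1 at a, and |F|^2 >= 2 Re F - 1, so the
mean value property gives L(a, r) >= 1 - k r^2 / 2.  If c(a) < g(a), this
contradicts (2) for small r.

For (1) => (2), competitors f = exp(H(t - a) - H(0)) with H a polynomial bound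
L(a, r) by the mean of exp(v - v(a)), where v = 2 Re H - Phi.  If g(a) > eps, the
second order Taylor polynomial as H gives the bound.  If g(a) <= eps, the sharp
inequality L(a, r) <= 1 is needed: H is chosen with |v| <= eta on the circle.
As v is superharmonic, the Green formulas against r^2 - |t - a|^2 and against a
regularized logarithm show that the mean of v^2 is dominated by the mean value
defect of v, which is first order; hence the mean of exp(v - v(a)) is at most
1 + O(eta).

Exponentials of polynomials are replaced by the powers (1 + w / N)^N.  Since
holomorphy is bare complex differentiability, the mean value property rests on
Goursat's bisection argument, applied (with a = 0) to the field
(F - 1) (conj t) m^2 / (|t|^2 + d), m = max(rho^2 - |t|^2, 0), as d -> 0. *)

Require Import Defs.
From mathcomp Require Import all_boot all_order all_algebra.
From mathcomp Require Import all_classical all_reals all_analysis.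
From mathcomp Require Import complex.
From mathcomp Require Import measurable_realfun ring lra.
Import Order.TTheory GRing.Theory Num.Theory.
Import numFieldNormedType.Exports.

Set Implicit Arguments.
Unset Strict Implicit.
Unset Printing Implicit Defensive.

Local Open Scope classical_set_scope.
Local Open Scope ring_scope.

(** The delicate case is the one where [g] gives no positive rate. The second condition then asks
    for [L(a, r) <= 1] exactly, while a Taylor polynomial only yields [1 + o(r^2)] with a remainder
    of unknown sign. The radius is therefore fixed before the competitor, and the competitor makes
    the weight nearly constant on the whole circle, with an error that tends to 0 at this fixed
    radius. With [M] a bound of the Laplacian, the quadratic term of the exponential is of size
    [M r^2] times the mean value defect, and the linear term contributes minus the defect itself;
    [3 M r^2 + 8 eta <= 1] lets the second absorb the first.

    Two features of the definitions shape the rest. Integrals over complex variables are iterated,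
    so each partial integral has to be shown measurable; integrands are kept lower semicontinuous
    for this. And a competitor in [LPhi] is controlled only inside the open disc, without any
    boundary regularity, so the lower bound pairs it with cutoffs supported in smaller discs, whose
    radii tend to [r] at the end. *)

Section RealDerivatives.
Variable R : realType.
Implicit Types (f g : R -> R) (x a b : R).

Lemma is_derive_continuous f x a : is_derive x 1 f a -> {for x, continuous f}.
Proof. by move=> [/derivable1_diffP/differentiable_continuous]. Qed.

Lemma derD f g x a b : is_derive x 1 f a -> is_derive x 1 g b ->
  is_derive x 1 (fun y => f y + g y) (a + b).
Proof. by move=> df dg; exact: is_deriveD. Qed.

Lemma derN f x a : is_derive x 1 f a -> is_derive x 1 (fun y => - f y) (- a).
Proof. by move=> df; exact: is_deriveN. Qed.

Lemma derM f g x a b : is_derive x 1 f a -> is_derive x 1 g b ->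
  is_derive x 1 (fun y => f y * g y) (a * g x + f x * b).
Proof.
move=> df dg; apply: (is_derive_eq (is_deriveM df dg)).
by rewrite /GRing.scale /= addrC; congr (_ + _); exact: mulrC.
Qed.

Lemma der_comp (h : R -> R) f x a b : is_derive (f x) 1 h a -> is_derive x 1 f b ->
  is_derive x 1 (fun y => h (f y)) (a * b).
Proof.
move=> dh df; apply: (is_derive_eq (@is_derive1_comp _ h f x a b dh df)).
by [].
Qed.

Lemma der_id x : is_derive x 1 (fun y : R => y) 1.
Proof. exact: is_derive_id. Qed.

Lemma der_cst (c : R) x : is_derive x 1 (fun=> c) 0.
Proof. exact: is_derive_cst. Qed.

Lemma derX f n x a : is_derive x 1 f a ->
  is_derive x 1 (fun y => f y ^+ n) (n%:R * f x ^+ n.-1 * a).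
Proof.
move=> df; case: n => [|n].
  by apply: (is_derive_eq (der_cst 1 x)); rewrite mul0r mul0r.
elim: n => [|n IH].
  by apply: (is_derive_eq df); rewrite expr0 !mul1r.
under eq_fun do rewrite exprS.
apply: (is_derive_eq (derM df IH)) => /=.
by rewrite -[n.+2%:R]natr1 [f x ^+ n.+1]exprS; ring.
Qed.

Lemma derV f x a : f x != 0 -> is_derive x 1 f a ->
  is_derive x 1 (fun y => (f y)^-1) (- a / f x ^+ 2).
Proof.
move=> f0 df; apply: (is_derive_eq (is_deriveV f0 df)).
by rewrite scaleNr mulNr; congr (- _); exact: mulrC.
Qed.

End RealDerivatives.

Lemma mvt (R : realType) (f df : R -> R) (a b : R) : a <= b ->
  (forall x : R, a <= x <= b -> is_derive x 1 f (df x)) ->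
  exists2 u : R, a <= u <= b & f b - f a = df u * (b - a).
Proof.
move=> ab d.
have c : {within `[a, b], continuous f}.
  apply: continuous_in_subspaceT => t /set_mem /= tI.
  by apply: is_derive_continuous; apply: d; rewrite in_itv in tI.
have d' (x : R) : x \in `]a, b[ -> is_derive x 1 f (df x).
  by move=> /subset_itv_oo_cc; rewrite in_itv => /d.
have [u uI e] := MVT_segment ab d' c.
by exists u => //; rewrite in_itv in uI.
Qed.

(** Division-free form of the derivative, for functions that no rule covers: fibre integrals, the
    squared positive part, functions known only near a point. *)
Lemma is_derive_epsP (R : realType) (f : R -> R) (x d : R) :
  is_derive x 1 f d <->
  forall e, 0 < e -> exists2 t, 0 < t &
    forall h, `|h| < t -> `|f (x + h) - f x - d * h| <= e * `|h|.
Proof.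
split=> [[dd dE] e e0|H].
  have : (fun h : R => h^-1 *: ((f \o shift x) (h *: 1) - f x)) @ 0^' --> d.
    by rewrite -dE; exact: dd.
  move=> /cvgrPdist_le/(_ _ e0).
  rewrite near_withinE => -[t /= t0 tP]; exists t => // h ht.
  have [->|h0] := eqVneq h 0; first by rewrite addr0 subrr mulr0 subrr normr0 mulr0.
  have := tP h; rewrite /ball_/= sub0r normrN => /(_ ht h0).
  rewrite /GRing.scale/= mulr1 [h + x]addrC => dh.
  rewrite -ler_pdivrMr ?normr_gt0// -normfV -normrM -normrN.
  by apply: le_trans dh; rewrite le_eqVlt; apply/orP; left; apply/eqP;
    congr `|_|; field.
have dF : (fun h : R => h^-1 *: ((f \o shift x) (h *: 1) - f x)) @ 0^' --> d.
  apply/cvgrPdist_le => e e0; have [t t0 tP] := H e e0.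
  rewrite near_withinE; exists t => //= h; rewrite /ball_/= sub0r normrN => ht h0.
  have := tP h ht; rewrite -ler_pdivrMr ?normr_gt0// -normfV -normrM => dh.
  rewrite /GRing.scale/= mulr1 [h + x]addrC distrC.
  by apply: le_trans dh; rewrite le_eqVlt; apply/orP; left; apply/eqP;
    congr `|_|; field.
by split; [apply/cvg_ex; exists d|exact: cvg_lim dF].
Qed.

(** Second-order patterns select the rule and the derivative is built in an existential variable;
    [der] then leaves the side conditions and the identity with the stated value. *)
Ltac der_step := lazymatch goal with
  | |- is_derive _ _ (fun _ => ?c) _ => apply: der_cst
  | |- is_derive _ _ (fun y => y) _ => apply: der_id
  | |- is_derive _ _ (fun y => @GRing.add _ (@?f y) (@?g y)) _ => eapply (derD (f := f) (g := g))
  | |- is_derive _ _ (fun y => @GRing.opp _ (@?f y)) _ => eapply (derN (f := f))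
  | |- is_derive _ _ (fun y => @GRing.mul _ (@?f y) (@?g y)) _ => eapply (derM (f := f) (g := g))
  | |- is_derive _ _ (fun y => @GRing.exp _ (@?f y) ?n) _ => eapply (derX (f := f) n)
  | |- is_derive _ _ (fun y => @GRing.inv _ (@?f y)) _ => eapply (derV (f := f))
  | |- is_derive _ _ (fun y => expR (@?f y)) _ =>
      eapply (der_comp (h := @expR _) (f := f)); [exact: is_derive_expR|]
  | |- is_derive _ _ (fun y => sin (@?f y)) _ =>
      eapply (der_comp (h := @sin _) (f := f)); [exact: is_derive_sin|]
  | |- is_derive _ _ (fun y => cos (@?f y)) _ =>
      eapply (der_comp (h := @cos _) (f := f)); [exact: is_derive_cos|]
  | |- is_derive _ _ (fun y => ln (@?f y)) _ =>
      eapply (der_comp (h := @ln _) (f := f)); [apply: is_derive1_ln|]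
  | _ => first [eassumption | typeclasses eauto]
  end.
Ltac der := eapply is_derive_eq; [repeat der_step | rewrite /=].

(** * Integration over plane discs *)

Section PlaneIntegral.
Variable R : realType.
Implicit Types (c p : R * R) (r : R) (F G : R * R -> R) (D : set (R * R)).

Local Notation mu := (@lebesgue_measure R).
Local Notation mu2 := (mu \x mu)%E.
Local Notation T2 := (measurableTypeR R * measurableTypeR R)%type.
Local Notation meas2 D := (measurable (D : set T2)).

(** Second countability: an open set is the union of the countably many boxes with rational centre
    and radius [1/(n+1)] that it contains. *)
Lemma open_measurable2 (A : set (R * R)) : open A -> meas2 A.
Proof.
move=> oA.
pose box (q : rat * rat * nat) : set (R * R) :=
  (ball (ratr q.1.1 : R) (q.2.+1%:R^-1)) `*` (ball (ratr q.1.2 : R) (q.2.+1%:R^-1)).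
have -> : A = \bigcup_(q in [set q | box q `<=` A]) box q.
  apply/seteqP; split; last by move=> p [q qA] /qA.
  move=> p Ap; have /nbhs_ballP[e /= e0 eA] := open_nbhs_nbhs (conj oA Ap).
  have [n /= ne] : exists n : nat, n.+1%:R^-1 < e / 2.
    have e20 : 0 < e / 2 by rewrite divr_gt0.
    by have [n _ nP] := near_infty_natSinv_lt (PosNum e20); exists n; exact: nP (leqnn _).
  have n0 : 0 < n.+1%:R^-1 :> R by rewrite invr_gt0.
  have ratin (x : R) : exists q : rat, `|ratr q - x| < n.+1%:R^-1.
    have : x - n.+1%:R^-1 < x + n.+1%:R^-1 by move: n0; set d := _^-1; lra.
    move=> /rat_in_itvoo[q]; rewrite in_itv/= => /andP[q1 q2].
    by exists q; rewrite ltr_norml; move: q1 q2; set d := _^-1; set w := ratr q; lra.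
  have [q1 q1P] := ratin p.1.
  have [q2 q2P] := ratin p.2.
  exists (q1, q2, n); last by split => /=; rewrite /ball/=.
  move=> z [/=]; rewrite /ball/= => z1 z2; apply: eA; split; rewrite /ball/=.
    rewrite (_ : _ - _ = (p.1 - ratr q1) + (ratr q1 - z.1)); last by ring.
    rewrite (le_lt_trans (ler_normD _ _))//; rewrite distrC in q1P; move: q1P z1 ne; set d := _^-1; set u := `|_|; set v := `|_|; lra.
  rewrite (_ : _ - _ = (p.2 - ratr q2) + (ratr q2 - z.2)); last by ring.
  rewrite (le_lt_trans (ler_normD _ _))//; rewrite distrC in q2P; move: q2P z2 ne; set d := _^-1; set u := `|_|; set v := `|_|; lra.
rewrite bigcup_mkcond; apply: countable_bigcupT_measurable => [|q]; first exact: countableP.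
case: ifPn => // _.
by apply: measurableX; rewrite ball_itv; exact: measurable_itv.
Qed.

(** Continuity is assumed in the whole plane at each point of [D]; hence on [D] the preimage of an
    open interval agrees with its interior. *)
Lemma measurable_fun2 (D : set (R * R)) F : meas2 D ->
  (forall p, D p -> {for p, continuous F}) -> measurable_fun (D : set T2) F.
Proof.
move=> mD cF; apply: (measurability _ (measurable_realfun.RGenOpens.measurableE R)).
move=> _ [_ [a [b ->] <-]].
have -> : D `&` F @^-1` `]a, b[ = D `&` (F @^-1` `]a, b[)^°.
  apply/seteqP; split => p [Dp Fp]; split => //; last exact: interior_subset Fp.
  apply: (cF _ Dp).
  by apply: open_nbhs_nbhs; split => //; exact: interval_open.
by apply: measurableI => //; apply: open_measurable2; exact: open_interior.
Qed.

(** Compact square around the disc. Data are required to be continuous on it, so that integrands are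
    bounded on the disc and every chord, endpoints included, stays in the domain. *)
Definition sqr2 c r : set (R * R) :=
  `[c.1 - r, c.1 + r]%classic `*` `[c.2 - r, c.2 + r]%classic.
Definition dist2 c p : R := (p.1 - c.1) ^+ 2 + (p.2 - c.2) ^+ 2.
Definition disc2 c r : set (R * R) := [set p | dist2 c p < r ^+ 2].

Lemma compact_sqr2 c r : compact (sqr2 c r).
Proof. by apply: compact_setX; exact: segment_compact. Qed.

Lemma disc2_sub c r : 0 < r -> disc2 c r `<=` sqr2 c r.
Proof.
move=> r0 p; rewrite /disc2 /dist2 /= => pr.
have h (x y : R) : x ^+ 2 + y ^+ 2 < r ^+ 2 -> `|x| <= r.
  move=> xy; rewrite -[leRHS]gtr0_norm// -ler_sqr ?nnegrE// !real_normK ?num_real//.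
  by have := sqr_ge0 y; lra.
split => /=; rewrite in_itv/=.
  by move: (h _ _ pr); rewrite ler_norml; lra.
by move: pr; rewrite addrC => /h; rewrite ler_norml; lra.
Qed.

Lemma dist2_continuous c p : {for p, continuous (dist2 c)}.
Proof.
have h1 : continuous_at p (fun q : R * R => q.1 - c.1).
  by apply: cvgB; [exact: cvg_fst|exact: cvg_cst].
have h2 : continuous_at p (fun q : R * R => q.2 - c.2).
  by apply: cvgB; [exact: cvg_snd|exact: cvg_cst].
by apply: cvgD; apply: cvgM.
Qed.

Lemma open_disc2 c r : open (disc2 c r).
Proof.
rewrite (_ : disc2 c r = dist2 c @^-1` [set x | x < r ^+ 2])//.
apply: open_comp; last exact: open_lt.
by move=> p _; apply: dist2_continuous.
Qed.

Lemma measurable_disc2 c r : meas2 (disc2 c r).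
Proof. by apply: open_measurable2; apply: open_disc2. Qed.

Lemma measurable_sqr2 c r : meas2 (sqr2 c r).
Proof. by apply: measurableX. Qed.

Lemma sqr2_fin c r : (mu2 (sqr2 c r) < +oo)%E.
Proof.
rewrite /sqr2 product_measure1E//.
have fin (a b : R) : (mu `[a, b] < +oo)%E.
  by rewrite lebesgue_measure_itv; case: ifP => // _; rewrite -EFinB ltry.
by apply: lte_mul_pinfty; rewrite ?ge0_fin_numE ?fin//; exact: measure_ge0.
Qed.

Lemma integrable2 c r D F : meas2 D -> D `<=` sqr2 c r ->
  (forall p, sqr2 c r p -> {for p, continuous F}) ->
  mu2.-integrable D (EFin \o F).
Proof.
move=> mD Dc cF; apply: measurable_bounded_integrable => //.
- by apply: le_lt_trans (@sqr2_fin c r); apply: le_measure; rewrite ?inE//; exact: measurable_sqr2.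
- by apply: measurable_fun2 => // p /Dc; exact: cF.
- have cW : {within sqr2 c r, continuous F}.
    apply: continuous_in_subspaceT => p /set_mem; exact: cF.
  have /compact_bounded[M [Mr MP]] := continuous_compact cW (@compact_sqr2 c r).
  by exists M; split=> // N /MP NP p /Dc Dp; apply: NP; exists p.
Qed.

Lemma abs_lt_sqr (x r : R) : 0 < r -> x ^+ 2 < r ^+ 2 -> `|x| < r.
Proof.
by move=> r0 xr; rewrite -ltr_sqr ?nnegrE ?normr_ge0 ?(ltW r0)// real_normK ?num_real.
Qed.

(** The slice is an open chord of half-length [h = sqrt(r^2 - a^2)]; by the fundamental theorem the
    integral is a difference of two values of [w] on the circle. *)
Lemma slice_bound (a b r k : R) (w dw : R -> R) : 0 < r -> a ^+ 2 < r ^+ 2 ->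
  (forall y, y \in `[b - r, b + r] -> is_derive y 1 w (dw y)) ->
  (forall y, y \in `[b - r, b + r] -> {for y, continuous dw}) ->
  (forall y, a ^+ 2 + (y - b) ^+ 2 = r ^+ 2 -> `|w y| <= k) ->
  (`| \int[mu]_(y in [set y | (a ^+ 2 + (y - b) ^+ 2 < r ^+ 2)%R]) (dw y)%:E |
    <= (2 * k)%:E)%E.
Proof.
move=> r0 ar dW cdW Wk.
pose h := Num.sqrt (r ^+ 2 - a ^+ 2).
have h0 : 0 < h by rewrite sqrtr_gt0 subr_gt0.
have h2 : h ^+ 2 = r ^+ 2 - a ^+ 2 by rewrite sqr_sqrtr// subr_ge0 ltW.
clearbody h.
have hr : h <= r.
  rewrite -ler_sqr ?nnegrE ?(ltW h0) ?(ltW r0)// h2; have := sqr_ge0 a; lra.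
have -> : [set y | a ^+ 2 + (y - b) ^+ 2 < r ^+ 2] = `]b - h, b + h[%classic.
  apply/seteqP; split => y /=; rewrite in_itv/=.
    move=> yr; have : `|y - b| < h by apply: abs_lt_sqr => //; lra.
    by rewrite ltr_norml; lra.
  move=> yh; have : `|y - b| < h by rewrite ltr_norml; lra.
  rewrite -ltr_sqr ?nnegrE ?normr_ge0 ?(ltW h0)// h2 real_normK ?num_real//; lra.
have sub y : y \in `[b - h, b + h] -> y \in `[b - r, b + r].
  by rewrite !in_itv/=; lra.
rewrite -(@integral_itv_bndoo _ _ _ _ true false); last first.
  apply/measurable_EFinP; apply: open_continuous_measurable_fun.
    exact: interval_open.
  by move=> y /set_mem/= yy; apply/cdW/sub/subset_itv_oo_cc.
rewrite (@continuous_FTC2 _ _ w); first last.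
- by move=> y yy; rewrite derive1E; apply: derive_val; apply/dW/sub/subset_itv_oo_cc.
- have dw' y : y \in `[b - h, b + h] -> derivable w y 1.
    by move=> /sub/dW[].
  have cw y : y \in `[b - h, b + h] -> {for y, continuous w}.
    by move=> /sub/dW; exact: is_derive_continuous.
  split.
  + by move=> y yy; apply/dw'/subset_itv_oo_cc.
  + by apply: cvg_at_right_filter; apply: cw; rewrite in_itv/=; lra.
  + by apply: cvg_at_left_filter; apply: cw; rewrite in_itv/=; lra.
- by apply: continuous_in_subspaceT => y /set_mem /= /sub; exact: cdW.
- lra.
rewrite -EFinB abse_EFin lee_fin.
have Wp : `|w (b + h)| <= k by apply: Wk; lra.
have Wm : `|w (b - h)| <= k by apply: Wk; lra.
by rewrite (le_trans (ler_normB _ _))//; lra.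
Qed.

Definition pint D F : R := \int[mu2]_(p in D) F p.

Lemma slice_integral_bound (G : R -> \bar R) (c r k : R) : 0 <= k -> 0 < r ->
  measurable_fun (setT : set (measurableTypeR R)) G ->
  (forall x, (x - c) ^+ 2 < r ^+ 2 -> (`|G x| <= (2 * k)%:E)%E) ->
  (forall x, r ^+ 2 <= (x - c) ^+ 2 -> G x = 0%E) ->
  (`|\int[mu]_x G x| <= (4 * r * k)%:E)%E.
Proof.
move=> k0 r0 mG Gk G0.
apply: le_trans (le_abse_integral _ _ _) _ => //.
have -> : (4 * r * k)%:E = (\int[mu]_(x in `[(c - r)%R, (c + r)%R]) (cst (2 * k)%:E x))%E.
  rewrite integral_cst//= lebesgue_measure_itv/= lte_fin ifT; last by lra.
  by rewrite -EFinD -EFinM; congr EFin; ring.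
rewrite [leRHS]integral_mkcond; apply: ge0_le_integral => //.
- exact: measurableT_comp.
- by apply/(measurable_restrictT _ _).1 => //; exact: measurable_cst.
- move=> x _; rewrite patchE; case: ifPn => [_|/negP xr].
    have [/Gk//|/G0->] := ltP ((x - c) ^+ 2) (r ^+ 2).
    by rewrite abse0 lee_fin /=; lra.
  rewrite G0 ?abse0// leNgt; apply/negP => xlt; apply: xr; rewrite inE/= in_itv/=.
  by move: (abs_lt_sqr r0 xlt); rewrite ltr_norml; lra.
Qed.

Lemma pint_fubini D F : meas2 D -> mu2.-integrable D (EFin \o F) ->
  [/\ measurable_fun (setT : set (measurableTypeR R))
        (fun x => \int[mu]_(y in [set y | D (x, y)]) (F (x, y))%:E)%E,
      measurable_fun (setT : set (measurableTypeR R))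
        (fun y => \int[mu]_(x in [set x | D (x, y)]) (F (x, y))%:E)%E,
      (pint D F)%:E = (\int[mu]_x \int[mu]_(y in [set y | D (x, y)]) (F (x, y))%:E)%E &
      (pint D F)%:E = (\int[mu]_y \int[mu]_(x in [set x | D (x, y)]) (F (x, y))%:E)%E].
Proof.
move=> mD iF.
have iF' := (integrable_mkcond _ mD).1 iF.
have E1 : (fun x => \int[mu]_(y in [set y | D (x, y)]) (F (x, y))%:E)%E =
    fubini_F mu ((EFin \o F) \_ D).
  apply/funext => x; rewrite /fubini_F [LHS]integral_mkcond; congr (integral _ _ _).
have E2 : (fun y => \int[mu]_(x in [set x | D (x, y)]) (F (x, y))%:E)%E =
    fubini_G mu ((EFin \o F) \_ D).
  apply/funext => x; rewrite /fubini_G [LHS]integral_mkcond; congr (integral _ _ _).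
have E : (pint D F)%:E = (\int[mu2]_p ((EFin \o F) \_ D) p)%E.
  rewrite /pint /Rintegral fineK; last exact: integrable_fin_num.
  by rewrite -integral_mkcond.
rewrite E1 E2; split.
- exact: measurable_fubini_F iF'.
- exact: measurable_fubini_G iF'.
- by rewrite E; exact: esym (integral12_prod_meas1 iF').
- by rewrite E; exact: esym (integral21_prod_meas1 iF').
Qed.

Lemma continuous_slice_y F (x y : R) : {for (x, y), continuous F} ->
  {for y, continuous (fun y => F (x, y))}.
Proof.
move=> cF; apply: (@continuous_comp _ _ _ (fun y : R => (x, y)) F) => //.
exact: (cvg_pair (cvg_cst x) (@cvg_id _ (nbhs y))).
Qed.

Lemma continuous_slice_x F (x y : R) : {for (x, y), continuous F} ->
  {for x, continuous (fun x => F (x, y))}.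
Proof.
move=> cF; apply: (@continuous_comp _ _ _ (fun x : R => (x, y)) F) => //.
exact: (cvg_pair (@cvg_id _ (nbhs x)) (cvg_cst y)).
Qed.

(** Divergence theorem on a disc with the boundary integral replaced by a bound: every chord
    contributes at most [2 k], and the chords range over an interval of length [2 r]. In the
    applications the boundary values are zero or small, so no line integral has to be defined. *)
Lemma disc_div_y c r k (W Wy : R * R -> R) : 0 < r ->
  (forall p, sqr2 c r p -> is_derive p.2 1 (fun y => W (p.1, y)) (Wy p)) ->
  (forall p, sqr2 c r p -> {for p, continuous Wy}) ->
  (forall p, dist2 c p = r ^+ 2 -> `|W p| <= k) ->
  `|pint (disc2 c r) Wy| <= 4 * r * k.
Proof.
move=> r0 dW cW Wk.
have k0 : 0 <= k.
  apply: le_trans (Wk (c.1 + r, c.2) _) => //.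
  by rewrite /dist2 /=; ring.
have mD := @measurable_disc2 c r.
have iW := integrable2 mD (disc2_sub r0) cW.
have [m1 _ E1 _] := pint_fubini mD iW.
rewrite -lee_fin -abse_EFin E1; apply: (slice_integral_bound (c := c.1)) => // x xr.
- have xc : x \in `[c.1 - r, c.1 + r].
    by move: (abs_lt_sqr r0 xr); rewrite ltr_norml in_itv/=; lra.
  apply: (slice_bound (w := fun y => W (x, y)) r0 xr) => [y yr|y yr|y e].
  + exact: (dW (x, y)).
  + by apply: continuous_slice_y; exact: cW.
  + exact: Wk.
- rewrite (_ : [set y | _] = set0) ?integral_set0//.
  apply/seteqP; split => // y; rewrite /disc2 /dist2 /=.
  by have := sqr_ge0 (y - c.2); lra.
Qed.

Lemma disc_div_x c r k (W Wx : R * R -> R) : 0 < r ->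
  (forall p, sqr2 c r p -> is_derive p.1 1 (fun x => W (x, p.2)) (Wx p)) ->
  (forall p, sqr2 c r p -> {for p, continuous Wx}) ->
  (forall p, dist2 c p = r ^+ 2 -> `|W p| <= k) ->
  `|pint (disc2 c r) Wx| <= 4 * r * k.
Proof.
move=> r0 dW cW Wk.
have k0 : 0 <= k.
  apply: le_trans (Wk (c.1 + r, c.2) _) => //.
  by rewrite /dist2 /=; ring.
have mD := @measurable_disc2 c r.
have iW := integrable2 mD (disc2_sub r0) cW.
have [_ m2 _ E2] := pint_fubini mD iW.
rewrite -lee_fin -abse_EFin E2; apply: (slice_integral_bound (c := c.2)) => // y yr.
- have yc : y \in `[c.2 - r, c.2 + r].
    by move: (abs_lt_sqr r0 yr); rewrite ltr_norml in_itv/=; lra.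
  have -> : [set x | disc2 c r (x, y)] = [set x | (y - c.2) ^+ 2 + (x - c.1) ^+ 2 < r ^+ 2].
    by apply/funext => x; rewrite /disc2 /dist2 /= addrC.
  apply: (slice_bound (w := fun x => W (x, y)) r0 yr) => [x xr|x xr|x e].
  + exact: (dW (x, y)).
  + by apply: continuous_slice_x; exact: cW.
  + by apply: Wk; rewrite /dist2 /= addrC.
- rewrite (_ : [set x | _] = set0) ?integral_set0//.
  apply/seteqP; split => // x; rewrite /disc2 /dist2 /=.
  by have := sqr_ge0 (x - c.1); lra.
Qed.

(** The substitution [x = c + r sin t] turns the integrand into [2 r^2 cos^2 t], with primitive
    [r^2 (t + sin t cos t)]. *)
Lemma integral_half_disc (c r : R) : 0 < r ->
  (\int[mu]_(x in `[(c - r)%R, (c + r)%R])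
     (2 * Num.sqrt (r ^+ 2 - (x - c) ^+ 2))%:E)%E = (pi * r ^+ 2)%:E.
Proof.
move=> r0.
pose F (t : R) := c + r * sin t.
have dF (t : R) : is_derive t 1 F (r * cos t) by rewrite /F; der; ring.
have F'E : derive1 F = fun t => r * cos t.
  by apply/funext => t; rewrite derive1E; apply: derive_val.
have cF' : continuous (derive1 F).
  move=> t; rewrite F'E; apply: cvgM; first exact: cvg_cst.
  exact: continuous_cos.
have cF : continuous F by move=> t; exact: is_derive_continuous (dF t).
have pi0 := pi_gt0 R.
have Fl : F (- (pi / 2)) = c - r by rewrite /F sinN sin_pihalf; ring.
have Fr : F (pi / 2) = c + r by rewrite /F sin_pihalf; ring.
have lepi : - (pi / 2) <= pi / 2 :> R by lra.
have ltpi : - (pi / 2) < pi / 2 :> R by lra.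
rewrite -Fl -Fr.
rewrite (@integration_by_substitution_increasing _ F
    (fun x => 2 * Num.sqrt (r ^+ 2 - (x - c) ^+ 2))) //; first last.
- apply: continuous_subspaceT => x.
  apply: cvgM; first exact: cvg_cst.
  apply: (@continuous_comp _ _ _ (fun x => r ^+ 2 - (x - c) ^+ 2)).
    apply: cvgB; first exact: cvg_cst.
    by apply: cvgM; apply: cvgB; (exact: cvg_id || exact: cvg_cst).
  exact: sqrt_continuous.
- split.
  + by move=> x _; case: (dF x).
  + by apply: cvg_at_right_filter; exact: cF.
  + by apply: cvg_at_left_filter; exact: cF.
- by apply/cvg_ex; eexists; apply: cvg_at_left_filter; exact: cF'.
- by apply/cvg_ex; eexists; apply: cvg_at_right_filter; exact: cF'.
- by move=> x y xI yI xy; rewrite /F ltrD2l ltr_pM2l// ltr_sin.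
transitivity (\int[mu]_(t in `[(- (pi / 2))%R, (pi / 2)%R])
    (2 * r ^+ 2 * cos t ^+ 2)%:E)%E.
  apply: eq_integral => t /set_mem/= tI; congr EFin.
  transitivity ((2 * Num.sqrt (r ^+ 2 - (F t - c) ^+ 2)) * derive1 F t) => //.
  rewrite F'E /F (_ : r ^+ 2 - _ = (r * cos t) ^+ 2).
    rewrite sqrtr_sqr ger0_norm; first by ring.
    by rewrite mulr_ge0 ?(ltW r0)// cos_ge0_pihalf.
  have := cos2Dsin2 t; move: (cos t) (sin t) => u v uv.
  by rewrite exprMn (_ : u ^+ 2 = 1 - v ^+ 2); [ring|lra].
rewrite (@continuous_FTC2 _ _ (fun t => r ^+ 2 * (t + sin t * cos t)))//.
- rewrite sinN cosN sin_pihalf cos_pihalf -EFinB; congr EFin; lra.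
- apply: continuous_subspaceT => x.
  by apply: cvgM; [exact: cvg_cst|apply: cvgM; exact: continuous_cos].
- have cP t : {for t, continuous (fun t : R => r ^+ 2 * (t + sin t * cos t))}.
    apply: cvgM; first exact: cvg_cst.
    apply: cvgD; first exact: cvg_id.
    by apply: cvgM; [exact: continuous_sin|exact: continuous_cos].
  split.
  + by move=> t _; apply: ex_derive; der.
  + by apply: cvg_at_right_filter; exact: cP.
  + by apply: cvg_at_left_filter; exact: cP.
- move=> t _; rewrite derive1E; apply: derive_val.
  der; have := cos2Dsin2 t; move: (cos t) (sin t) => u v uv.
  by rewrite (_ : v * (- v * 1) = u ^+ 2 - 1); [ring|lra].
Qed.

Lemma slice_measure (c r a : R) : 0 < r ->
  (\int[mu]_(y in [set y | (a ^+ 2 + (y - c) ^+ 2 < r ^+ 2)%R]) 1%:E)%E =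
  (2 * Num.sqrt (r ^+ 2 - a ^+ 2))%:E.
Proof.
move=> r0; pose h := Num.sqrt (r ^+ 2 - a ^+ 2).
have [ra|ar] := leP (r ^+ 2) (a ^+ 2).
  rewrite (_ : [set y | _] = set0).
    by rewrite integral_set0 ler0_sqrtr ?mulr0// subr_le0.
  by apply/seteqP; split => // y /=; have := sqr_ge0 (y - c); lra.
have h0 : 0 < h by rewrite sqrtr_gt0 subr_gt0.
have h2 : h ^+ 2 = r ^+ 2 - a ^+ 2 by rewrite sqr_sqrtr// subr_ge0 ltW.
rewrite -/h; clearbody h.
have -> : [set y | a ^+ 2 + (y - c) ^+ 2 < r ^+ 2] = `]c - h, c + h[%classic.
  apply/seteqP; split => y /=; rewrite in_itv/=.
    move=> yr; have : `|y - c| < h by apply: abs_lt_sqr => //; lra.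
    by rewrite ltr_norml; lra.
  move=> yh; have : `|y - c| < h by rewrite ltr_norml; lra.
  rewrite -ltr_sqr ?nnegrE ?normr_ge0 ?(ltW h0)// h2 real_normK ?num_real//; lra.
rewrite integral_cst//= lebesgue_measure_itv/= lte_fin ifT; last by lra.
by rewrite mul1e -EFinD; congr EFin; ring.
Qed.

Lemma pint_disc1 c r : 0 < r -> pint (disc2 c r) (cst 1) = pi * r ^+ 2.
Proof.
move=> r0; apply: EFin_inj.
have [_ _ + _] := pint_fubini (@measurable_disc2 c r) (integrable2 (@measurable_disc2 c r)
  (disc2_sub r0) (fun p _ => @cst_continuous _ _ (1 : R) p)).
move=> ->; rewrite -(integral_half_disc c.1 r0) [RHS]integral_mkcond.
congr (integral _ _ _); apply/funext => x; rewrite patchE.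
rewrite [LHS](slice_measure c.2 ((x : R) - c.1) r0); case: ifPn => // xI.
rewrite ler0_sqrtr ?mulr0// subr_le0 leNgt; apply: contra xI => /(abs_lt_sqr r0).
by rewrite ltr_norml => h; rewrite inE/= in_itv/=; lra.
Qed.

End PlaneIntegral.

(** * Pointwise continuity rules and their automation *)

Section Continuity.
Variables (R : realType) (T : topologicalType).
Implicit Types (f g : T -> R) (p : T).

Lemma contD f g p : {for p, continuous f} -> {for p, continuous g} ->
  {for p, continuous (fun q => f q + g q)}.
Proof. by move=> cf cg; exact: cvgD. Qed.

Lemma contN f p : {for p, continuous f} -> {for p, continuous (fun q => - f q)}.
Proof. by move=> cf; exact: cvgN. Qed.

Lemma contM f g p : {for p, continuous f} -> {for p, continuous g} ->
  {for p, continuous (fun q => f q * g q)}.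
Proof. by move=> cf cg; exact: cvgM. Qed.

Lemma contX f n p : {for p, continuous f} -> {for p, continuous (fun q => f q ^+ n)}.
Proof.
move=> cf; elim: n => [|n IH]; first exact: cvg_cst.
change (continuous_at p (fun q => f q ^+ n.+1)).
by under eq_fun do rewrite exprS; exact: contM.
Qed.

Lemma contV f p : f p != 0 -> {for p, continuous f} ->
  {for p, continuous (fun q => (f q)^-1)}.
Proof. by move=> f0 cf; exact: cvgV. Qed.

Lemma cont_cst (c : R) p : {for p, continuous (fun=> c)}.
Proof. exact: cvg_cst. Qed.

Lemma cont_comp (h : R -> R) f p : {for f p, continuous h} -> {for p, continuous f} ->
  {for p, continuous (fun q => h (f q))}.
Proof. by move=> ch cf; exact: (continuous_comp cf ch). Qed.

End Continuity.

Lemma cont_fst (R : realType) (p : R * R) : {for p, continuous (fun q : R * R => q.1)}.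
Proof. exact: cvg_fst. Qed.

Lemma cont_snd (R : realType) (p : R * R) : {for p, continuous (fun q : R * R => q.2)}.
Proof. exact: cvg_snd. Qed.

Ltac cont_hyp := match goal with
  | H : {for ?p, continuous ?f} |- continuous_at ?p ?f => exact H
  | H : {for ?p, continuous ?f} |- continuous_at ?p (fun q => ?f q) => exact H
  end.

Ltac cont_step := first [cont_hyp | lazymatch goal with
  | |- {for ?p, continuous ?f} => change (continuous_at p f)
  | |- continuous_at _ (fun _ => ?c) => apply: cont_cst
  | |- continuous_at _ (fun q => q.1) => apply: cont_fst
  | |- continuous_at _ (fun q => q.2) => apply: cont_snd
  | |- continuous_at _ (fun q => @GRing.add _ (@?f q) (@?g q)) => apply: (contD (f := f) (g := g))
  | |- continuous_at _ (fun q => @GRing.opp _ (@?f q)) => apply: (contN (f := f))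
  | |- continuous_at _ (fun q => @GRing.mul _ (@?f q) (@?g q)) => apply: (contM (f := f) (g := g))
  | |- continuous_at _ (fun q => @GRing.exp _ (@?f q) ?n) => apply: (@contX _ _ f n)
  | |- continuous_at _ (fun q => @GRing.inv _ (@?f q)) => apply: (contV (f := f))
  | |- continuous_at _ (fun q => expR (@?f q)) =>
      apply: (cont_comp (h := @expR _) (f := f)); [exact: continuous_expR|]
  | |- continuous_at _ (fun q => ln (@?f q)) =>
      apply: (cont_comp (h := @ln _) (f := f)); [apply: continuous_ln|]
  | |- continuous_at _ (fun q => dist2 _ q) => apply: dist2_continuous
  | |- continuous_at _ _ => assumption
  end].
Ltac cont := repeat cont_step.

(** * Linearity and monotonicity of integrals over a disc *)

Section PlaneIntegralAlgebra.
Variable R : realType.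
Implicit Types (c p : R * R) (r : R) (F G : R * R -> R).

Definition cont_on c r F := forall p, sqr2 c r p -> {for p, continuous F}.

Variables (c : R * R) (r : R).
Hypothesis r0 : 0 < r.

Lemma integrable_disc2 F : cont_on c r F ->
  ((@lebesgue_measure R) \x (@lebesgue_measure R))%E.-integrable (disc2 c r) (EFin \o F).
Proof. by move=> cF; apply: (integrable2 (@measurable_disc2 _ c r) (disc2_sub r0) cF). Qed.

Lemma pintD F G : cont_on c r F -> cont_on c r G ->
  pint (disc2 c r) (fun p => F p + G p) = pint (disc2 c r) F + pint (disc2 c r) G.
Proof.
by move=> cF cG; apply: RintegralD; [exact: measurable_disc2|exact: integrable_disc2..].
Qed.

Lemma pintB F G : cont_on c r F -> cont_on c r G ->
  pint (disc2 c r) (fun p => F p - G p) = pint (disc2 c r) F - pint (disc2 c r) G.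
Proof.
by move=> cF cG; apply: RintegralB; [exact: measurable_disc2|exact: integrable_disc2..].
Qed.

Lemma pintZ F (a : R) : cont_on c r F ->
  pint (disc2 c r) (fun p => a * F p) = a * pint (disc2 c r) F.
Proof.
by move=> cF; apply: RintegralZl; [exact: measurable_disc2|exact: integrable_disc2..].
Qed.

Lemma le_pint F G : cont_on c r F -> cont_on c r G ->
  (forall p, disc2 c r p -> F p <= G p) -> pint (disc2 c r) F <= pint (disc2 c r) G.
Proof.
by move=> cF cG FG; apply: le_Rintegral => //;
  [exact: measurable_disc2|exact: integrable_disc2..].
Qed.

Lemma pint_cst (a : R) : pint (disc2 c r) (fun=> a) = a * (pi * r ^+ 2).
Proof.
rewrite -(pint_disc1 c r0) -pintZ; last by move=> p _; exact: cont_cst.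
by congr pint; apply/funext => p; rewrite mulr1.
Qed.

Lemma norm_pint_le F G : cont_on c r F -> cont_on c r G ->
  (forall p, disc2 c r p -> `|F p| <= G p) -> `|pint (disc2 c r) F| <= pint (disc2 c r) G.
Proof.
move=> cF cG FG; have cN : cont_on c r (fun p => - F p) by move=> p /cF ?; exact: contN.
have EN : pint (disc2 c r) (fun p => - F p) = - pint (disc2 c r) F.
  by rewrite -mulN1r -pintZ//; congr pint; apply/funext => p; rewrite mulN1r.
rewrite ler_norml lerNl -EN; apply/andP; split; apply: le_pint => // p /FG.
  by rewrite ler_norml; lra.
by rewrite ler_norml; lra.
Qed.

End PlaneIntegralAlgebra.

(** * Green's formula *)

Section Green.
Variable R : realType.
Implicit Types (c p : R * R) (r : R) (F G : R * R -> R).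

(** A function bundled with candidates for its first and pure second derivatives; [is_jet] certifies
    them. The mixed derivative is left out: products, radial functions and Laplacians are computed
    without it. *)
Record jet := Jet { j0 : R * R -> R; jx : R * R -> R; jy : R * R -> R;
                    jxx : R * R -> R; jyy : R * R -> R }.

Definition lap (J : jet) p := jxx J p + jyy J p.

Definition is_jet (S : set (R * R)) (J : jet) := forall p, S p ->
  [/\ {for p, continuous (j0 J)}, {for p, continuous (jx J)},
      {for p, continuous (jy J)}, {for p, continuous (jxx J)} &
      {for p, continuous (jyy J)}] /\
  [/\ is_derive p.1 1 (fun x => j0 J (x, p.2)) (jx J p),
      is_derive p.2 1 (fun y => j0 J (p.1, y)) (jy J p),
      is_derive p.1 1 (fun x => jx J (x, p.2)) (jxx J p) &
      is_derive p.2 1 (fun y => jy J (p.1, y)) (jyy J p)].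

Definition jet_mul (J K : jet) := Jet
  (fun p => j0 J p * j0 K p)
  (fun p => jx J p * j0 K p + j0 J p * jx K p)
  (fun p => jy J p * j0 K p + j0 J p * jy K p)
  (fun p => jxx J p * j0 K p + 2 * (jx J p * jx K p) + j0 J p * jxx K p)
  (fun p => jyy J p * j0 K p + 2 * (jy J p * jy K p) + j0 J p * jyy K p).

Definition jet_opp (J : jet) := Jet (fun p => - j0 J p)
  (fun p => - jx J p) (fun p => - jy J p) (fun p => - jxx J p) (fun p => - jyy J p).

Definition jet_add (J K : jet) := Jet
  (fun p => j0 J p + j0 K p) (fun p => jx J p + jx K p) (fun p => jy J p + jy K p)
  (fun p => jxx J p + jxx K p) (fun p => jyy J p + jyy K p).

(** [g1] and [g2] are meant as the derivatives of [g] in the squared distance, a variable that is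
    smooth at the centre as well. *)
Definition jet_radial c (g g1 g2 : R -> R) := Jet
  (fun p => g (dist2 c p))
  (fun p => g1 (dist2 c p) * (2 * (p.1 - c.1)))
  (fun p => g1 (dist2 c p) * (2 * (p.2 - c.2)))
  (fun p => g2 (dist2 c p) * (2 * (p.1 - c.1)) ^+ 2 + g1 (dist2 c p) * 2)
  (fun p => g2 (dist2 c p) * (2 * (p.2 - c.2)) ^+ 2 + g1 (dist2 c p) * 2).

Variable S : set (R * R).

Lemma is_jet_mul J K : is_jet S J -> is_jet S K -> is_jet S (jet_mul J K).
Proof.
move=> hJ hK p Sp; have [[? ? ? ? ?] [? ? ? ?]] := hJ p Sp.
have [[? ? ? ? ?] [? ? ? ?]] := hK p Sp.
split; split => /=; try by cont.
all: by der; rewrite -?surjective_pairing; ring.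
Qed.

Lemma is_jet_opp J : is_jet S J -> is_jet S (jet_opp J).
Proof.
move=> hJ p Sp; have [[? ? ? ? ?] [? ? ? ?]] := hJ p Sp.
by split; split => /=; try (by cont); der.
Qed.

Lemma is_jet_add J K : is_jet S J -> is_jet S K -> is_jet S (jet_add J K).
Proof.
move=> hJ hK p Sp; have [[? ? ? ? ?] [? ? ? ?]] := hJ p Sp.
have [[? ? ? ? ?] [? ? ? ?]] := hK p Sp.
by split; split => /=; try (by cont); der.
Qed.

Lemma is_jet_radial c (g g1 g2 : R -> R) :
  (forall s : R, 0 <= s -> is_derive s 1 g (g1 s)) ->
  (forall s : R, 0 <= s -> is_derive s 1 g1 (g2 s)) ->
  (forall s : R, 0 <= s -> {for s, continuous g2}) ->
  is_jet S (jet_radial c g g1 g2).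
Proof.
move=> dg dg1 cg2 p _.
have s0 : 0 <= dist2 c p by rewrite /dist2 addr_ge0 ?sqr_ge0.
have cd := @dist2_continuous _ c p.
have hg := dg _ s0; have hg1 := dg1 _ s0.
have c0 : {for p, continuous (fun p => g (dist2 c p))}.
  exact: cont_comp (is_derive_continuous hg) cd.
have c1 : {for p, continuous (fun p => g1 (dist2 c p))}.
  exact: cont_comp (is_derive_continuous hg1) cd.
have c2 : {for p, continuous (fun p => g2 (dist2 c p))}.
  exact: cont_comp (cg2 _ s0) cd.
case: p => x0 y0 in s0 cd hg hg1 c0 c1 c2 *.
have d1 : is_derive x0 1 (fun x : R => dist2 c (x, y0)) (2 * (x0 - c.1)).
  by rewrite /dist2 /=; der; ring.
have d2 : is_derive y0 1 (fun y : R => dist2 c (x0, y)) (2 * (y0 - c.2)).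
  by rewrite /dist2 /=; der; ring.
have e1 := der_comp (f := fun x => dist2 c (x, y0)) hg d1.
have e2 := der_comp (f := fun y => dist2 c (x0, y)) hg d2.
have e3 := der_comp (f := fun x => dist2 c (x, y0)) hg1 d1.
have e4 := der_comp (f := fun y => dist2 c (x0, y)) hg1 d2.
by split; split => /=; try (by cont); der; ring.
Qed.

End Green.

Section GreenFormula.
Variable R : realType.
Variables (c : R * R) (r : R).
Hypothesis r0 : 0 < r.
Local Notation K := (sqr2 c r).
Local Notation D := (disc2 c r).

(** [F lap G - G lap F] is the divergence of the field [F grad G - G grad F]; [8 r k] is the sum of
    the two coordinate estimates. *)
Lemma green (F G : jet R) (k : R) : is_jet K F -> is_jet K G ->
  (forall p, dist2 c p = r ^+ 2 ->
     `|j0 F p * jx G p - j0 G p * jx F p| <= k /\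
     `|j0 F p * jy G p - j0 G p * jy F p| <= k) ->
  `|pint D (fun p => j0 F p * lap G p) - pint D (fun p => j0 G p * lap F p)|
   <= 8 * r * k.
Proof.
move=> hF hG hk.
have dx := @disc_div_x _ c r k (fun p => j0 F p * jx G p - j0 G p * jx F p)
  (fun p => j0 F p * jxx G p - j0 G p * jxx F p) r0 _ _ (fun p e => (hk p e).1).
have dy := @disc_div_y _ c r k (fun p => j0 F p * jy G p - j0 G p * jy F p)
  (fun p => j0 F p * jyy G p - j0 G p * jyy F p) r0 _ _ (fun p e => (hk p e).2).
have cx p : K p -> {for p, continuous (fun p => j0 F p * jxx G p - j0 G p * jxx F p)}.
  by move=> Kp; have [[? ? ? ? ?] _] := hF p Kp; have [[? ? ? ? ?] _] := hG p Kp; cont.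
have cy p : K p -> {for p, continuous (fun p => j0 F p * jyy G p - j0 G p * jyy F p)}.
  by move=> Kp; have [[? ? ? ? ?] _] := hF p Kp; have [[? ? ? ? ?] _] := hG p Kp; cont.
have {}dx := dx _ cx; have {}dy := dy _ cy.
rewrite -pintB//; last 2 first.
- by move=> p Kp; have [[? ? ? ? ?] _] := hF p Kp; have [[? ? ? ? ?] _] := hG p Kp;
    rewrite /lap; cont.
- by move=> p Kp; have [[? ? ? ? ?] _] := hF p Kp; have [[? ? ? ? ?] _] := hG p Kp;
    rewrite /lap; cont.
rewrite (_ : (fun p => _) = (fun p => (j0 F p * jxx G p - j0 G p * jxx F p) +
    (j0 F p * jyy G p - j0 G p * jyy F p))); last first.
  by apply/funext => p; rewrite /lap; ring.
rewrite pintD//.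
apply: le_trans (ler_normD _ _) _.
rewrite (_ : 8 * r * k = 4 * r * k + 4 * r * k); last by ring.
apply: lerD; [apply: dx|apply: dy] => p Kp.
- have [_ [? ? ? ?]] := hF p Kp; have [_ [? ? ? ?]] := hG p Kp.
  by der; rewrite -?surjective_pairing; ring.
- have [_ [? ? ? ?]] := hF p Kp; have [_ [? ? ? ?]] := hG p Kp.
  by der; rewrite -?surjective_pairing; ring.
Qed.

End GreenFormula.

(** Right side minus left side vanishes at 1, and its derivative [- (1 - t)^2 / t] is not
    positive. *)
Lemma ln_le_quadratic (R : realType) (x : R) : 0 < x <= 1 ->
  ln x <= - (1 - x) - (1 - x) ^+ 2 / 2.
Proof.
move=> /andP[x0 x1].
pose h (t : R) := ln t + (1 - t) + (1 - t) ^+ 2 / 2.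
have dh (t : R) : x <= t <= 1 -> is_derive t 1 h (t^-1 - 1 - (1 - t)).
  move=> /andP[xt _]; have t0 := lt_le_trans x0 xt.
  by rewrite /h; der => //; field; rewrite gt_eqF.
have [u /andP[xu u1] e] := mvt x1 dh.
have u0 := lt_le_trans x0 xu.
have : 0 <= h 1 - h x.
  rewrite e; apply: mulr_ge0; last by rewrite subr_ge0.
  rewrite (_ : _ - _ - _ = (1 - u) ^+ 2 / u); last by field; rewrite gt_eqF.
  by rewrite divr_ge0 ?sqr_ge0 ?ltW.
by rewrite /h ln1; lra.
Qed.

Section LocalBounds.
Variable R : realType.
Implicit Types (c p : R * R) (r : R) (F : R * R -> R).

Lemma bounded_sqr2 c r F : cont_on c r F ->
  exists2 B, 0 < B & forall p, sqr2 c r p -> `|F p| <= B.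
Proof.
move=> cF.
have cW : {within sqr2 c r, continuous F}.
  by apply: continuous_in_subspaceT => p /set_mem; exact: cF.
have /compact_bounded[M [Mr MP]] := continuous_compact cW (@compact_sqr2 _ c r).
exists (`|M| + 1) => [|p Kp]; first by rewrite ltr_wpDl.
apply: (MP (`|M| + 1)); last by exists p.
by rewrite ltr_pwDr// ler_norm.
Qed.

Lemma nbhs_disc2 c (P : set (R * R)) : (\forall p \near c, P p) ->
  exists2 t, 0 < t & forall p, dist2 c p < t ^+ 2 -> P p.
Proof.
move=> /nbhs_ballP[t /= t0 tP]; exists t => // p; rewrite /dist2 => pt.
have h1 := sqr_ge0 (p.1 - c.1); have h2 := sqr_ge0 (p.2 - c.2).
apply: tP; split; rewrite /ball/= distrC; apply: abs_lt_sqr => //; lra.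
Qed.

Lemma near_disc2 c F (e : R) : {for c, continuous F} -> 0 < e ->
  exists2 t, 0 < t & forall p, dist2 c p < t ^+ 2 -> `|F p - F c| < e.
Proof.
move=> cF e0; apply: nbhs_disc2.
by have /cvgrPdist_lt/(_ _ e0) := cF; apply: filterS => p; rewrite distrC.
Qed.

End LocalBounds.

(** * An approximate identity and its potential *)

Section ApproximateIdentity.
Variable R : realType.
Variables (c : R * R) (r : R).
Hypothesis r0 : 0 < r.
Local Notation K := (sqr2 c r).
Local Notation D := (disc2 c r).

Lemma dist2_ge0 p : 0 <= dist2 c p.
Proof. by rewrite /dist2 addr_ge0 ?sqr_ge0. Qed.

(** A quarter of the Laplacian of [ln (|p - c|^2 + d)]: an approximate identity whose mass on a disc
    tends to [pi], not to 1, as [d -> 0]. *)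
Definition bump (d : R) p := d / (dist2 c p + d) ^+ 2.

Lemma cont_bump (d : R) p : 0 < d -> {for p, continuous (bump d)}.
Proof.
by move=> d0; rewrite /bump; cont; rewrite expf_neq0// gt_eqF// ltr_wpDl// dist2_ge0.
Qed.

Lemma bump_ge0 (d : R) p : 0 < d -> 0 <= bump d p.
Proof. by move=> d0; rewrite /bump divr_ge0 ?sqr_ge0 ?(ltW d0). Qed.

(* A primitive of the bump up to the constant that makes it flat to second
   order on the circle; as [d -> 0] it tends to the kernel of the mean value
   defect [F(c) - mean F]. *)
Definition bump_prim (d s : R) :=
  - ln ((s + d) / (r ^+ 2 + d)) - (r ^+ 2 - s) / (r ^+ 2 + d).
Definition bump_prim1 (d s : R) := - (s + d)^-1 + (r ^+ 2 + d)^-1.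
Definition bump_prim2 (d s : R) := (s + d) ^- 2.

Definition bump_jet (d : R) := jet_radial c (bump_prim d) (bump_prim1 d) (bump_prim2 d).

Lemma is_jet_bump (d : R) S : 0 < d -> is_jet S (bump_jet d).
Proof.
move=> d0; have r20 : 0 < r ^+ 2 by rewrite exprn_gt0.
apply: is_jet_radial => s s0.
- have sd : 0 < s + d by lra.
  rewrite /bump_prim /bump_prim1; der; first by rewrite divr_gt0//; lra.
  by field; rewrite ?gt_eqF//; lra.
- by rewrite /bump_prim1 /bump_prim2; der; [rewrite gt_eqF//; lra|field; rewrite gt_eqF//; lra].
- rewrite /bump_prim2; cont; first by rewrite expf_neq0// gt_eqF//; lra.
  exact: cvg_id.
Qed.

Lemma lap_bump (d : R) p : 0 < d ->
  lap (bump_jet d) p = 4 / (r ^+ 2 + d) - 4 * bump d p.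
Proof.
move=> d0; have s0 := dist2_ge0 p; have r20 : 0 < r ^+ 2 by rewrite exprn_gt0.
transitivity (4 * (bump_prim1 d (dist2 c p) + dist2 c p * bump_prim2 d (dist2 c p))).
  rewrite /lap /=; move: (bump_prim1 _ _) (bump_prim2 _ _) => u v.
  by rewrite /dist2; ring.
rewrite /bump_prim1 /bump_prim2 /bump; move: (dist2 c p) s0 => s s0.
by field; rewrite !gt_eqF//; lra.
Qed.

(** With [x = (s + d) / (r^2 + d)], where [s = dist2 c p], the potential is [- ln x - (1 - x)], and
    [ln_le_quadratic] leaves [(1 - x)^2 / 2]. This trades the logarithmic kernel for the polynomial
    weight [(r^2 - s)^2]. *)
Lemma bump_jet_ge (d : R) p : 0 < d -> dist2 c p <= r ^+ 2 ->
  ((r ^+ 2 - dist2 c p) / (r ^+ 2 + d)) ^+ 2 / 2 <= j0 (bump_jet d) p.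
Proof.
move=> d0; have := dist2_ge0 p; rewrite /= /bump_prim.
move: (dist2 c p) => s s0 sr.
have q0 : 0 < r ^+ 2 + d by lra.
have : 0 < (s + d) / (r ^+ 2 + d) <= 1.
  by rewrite divr_gt0 ?ler_pdivrMr//=; lra.
move=> /ln_le_quadratic.
rewrite (_ : 1 - (s + d) / _ = (r ^+ 2 - s) / (r ^+ 2 + d)); last by field; rewrite gt_eqF.
lra.
Qed.

(** Value and gradient both vanish on the circle, so Green's formula against this potential has no
    boundary term, whatever the other function is. *)
Lemma bump_boundary (d : R) p : 0 < d -> dist2 c p = r ^+ 2 ->
  [/\ j0 (bump_jet d) p = 0, jx (bump_jet d) p = 0 & jy (bump_jet d) p = 0].
Proof.
move=> d0 e; have q0 : 0 < r ^+ 2 + d by rewrite ltr_wpDl ?sqr_ge0.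
rewrite /= e /bump_prim /bump_prim1 subrr mul0r divff ?ln1 ?gt_eqF// addNr.
by split; rewrite ?mul0r//; ring.
Qed.

Lemma green_bump (d : R) F : 0 < d -> is_jet K F ->
  4 / (r ^+ 2 + d) * pint D (j0 F) - 4 * pint D (fun p => bump d p * j0 F p) =
  pint D (fun p => j0 (bump_jet d) p * lap F p).
Proof.
move=> d0 hF.
have cF : cont_on c r (j0 F) by move=> p /hF[[]].
have cB : cont_on c r (bump d) by move=> p _; exact: cont_bump.
have := @green _ c r r0 F (bump_jet d) 0 hF (@is_jet_bump d K d0).
rewrite mulr0 normr_le0 subr_eq0 => /(_ _)/eqP <-; last first.
  move=> p /(bump_boundary d0)[-> -> ->]; split; rewrite !(mulr0, mul0r, subr0) normr0//.
rewrite -!pintZ//; last by move=> p Kp; have := cF _ Kp; have := cB _ Kp => ? ?; cont.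
rewrite -pintB//; last 2 first.
- by move=> p Kp; have := cF _ Kp => ?; cont.
- by move=> p Kp; have := cF _ Kp; have := cB _ Kp => ? ?; cont.
by congr pint; apply/funext => p; rewrite lap_bump//; ring.
Qed.

(** [green_bump] for the constant function 1. *)
Lemma pint_bump (d : R) : 0 < d -> pint D (bump d) = pi * r ^+ 2 / (r ^+ 2 + d).
Proof.
move=> d0; have q0 : 0 < r ^+ 2 + d by rewrite ltr_wpDl ?sqr_ge0.
have hF : is_jet K (Jet (fun=> 1) (fun=> 0) (fun=> 0) (fun=> 0) (fun=> 0)).
  by move=> p _; split; split => /=; try (by cont); der.
have := green_bump d0 hF; rewrite /= /lap /=.
rewrite (_ : (fun p => _ * (0 + 0)) = fun=> 0); last first.
  by apply/funext => p; rewrite addr0 mulr0.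
rewrite !pint_cst// mul0r (_ : (fun p => _ * 1) = bump d); last first.
  by apply/funext => p; rewrite mulr1.
move=> /eqP; rewrite subr_eq0 => /eqP e.
by apply: (mulfI (_ : 4 != 0)) => //; rewrite -e; field; rewrite gt_eqF.
Qed.

(** Near the centre [|F p - F c|] is at most [eta / 8], and elsewhere a multiple of [dist2 c p]
    dominates it. The parameter [d = k^2] is a square so that both [bump * dist2] and its integral
    are of order [k]. *)
Lemma bump_concentrates F (eta : R) : cont_on c r F -> 0 < eta ->
  exists2 k0, 0 < k0 & forall k, 0 < k <= k0 ->
    `|pint D (fun p => bump (k ^+ 2) p * (F p - F c))| <= eta.
Proof.
move=> cF eta0.
have Kc : K c by split; rewrite /= in_itv/= lerDl gerBl (ltW r0).
have e10 : 0 < eta / 8 by lra.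
have [t t0 tP] := near_disc2 (cF _ Kc) e10.
have [B B0 BP] := bounded_sqr2 cF.
have t20 : 0 < t ^+ 2 by rewrite exprn_gt0.
have FP p : K p -> `|F p - F c| <= eta / 8 + 2 * B / t ^+ 2 * dist2 c p.
  move=> Kp; have s0 := dist2_ge0 p.
  have [pt|tp] := ltP (dist2 c p) (t ^+ 2).
    apply: le_trans (ltW (tP _ pt)) _; rewrite lerDl.
    by rewrite mulr_ge0// divr_ge0// ?ltW// mulr_gt0.
  apply: le_trans (ler_normB _ _) _.
  have h1 := BP _ Kp; have h2 := BP _ Kc.
  have : 2 * B <= 2 * B / t ^+ 2 * dist2 c p.
    by rewrite mulrAC ler_pdivlMr// ler_pM2l// mulr_gt0.
  lra.
pose C := 2 * B / t ^+ 2.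
have C0 : 0 < C by rewrite divr_gt0// mulr_gt0.
rewrite -/C in FP.
have p0 := pi_gt0 R; have p4 : pi <= 4 :> R.
  by have /andP[_] := pihalf_02 R; lra.
have r20 : 0 < r ^+ 2 by rewrite exprn_gt0.
(* [W] collects the two errors of order [k]; half of [eta] is reserved for them, and [pi <= 4] keeps
   [eta / 8 * pi] within the other half. *)
pose W := C * (pi * r ^+ 2 + pi).
have W0 : 0 < W by rewrite mulr_gt0// addr_gt0// mulr_gt0.
exists (eta / (2 * W)); first by rewrite divr_gt0// mulr_gt0.
move=> k /andP[k0 kW].
have d0 : 0 < k ^+ 2 by rewrite exprn_gt0.
have cB : cont_on c r (bump (k ^+ 2)) by move=> p _; exact: cont_bump.
have Bpi : pint D (bump (k ^+ 2)) <= pi.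
  rewrite pint_bump// ler_pdivrMr; last by lra.
  by rewrite ler_pM2l//; lra.
apply: (@le_trans _ _ (pint D (fun p => (eta / 8 + C * k) * bump (k ^+ 2) p + C * k))).
  apply: norm_pint_le => //.
  - by move=> p Kp; have := cF _ Kp; have := cB _ Kp => ? ?; cont.
  - by move=> p Kp; have := cB _ Kp => ?; cont.
  move=> p /(disc2_sub r0) Kp; have b0 := bump_ge0 p d0.
  rewrite normrM (ger0_norm b0).
  apply: le_trans (ler_wpM2l b0 (FP _ Kp)) _.
  have s0 := dist2_ge0 p.
  suff : bump (k ^+ 2) p * dist2 c p <= k * bump (k ^+ 2) p + k.
    move=> h; have := ler_wpM2l (ltW C0) h; lra.
  rewrite /bump; move: (dist2 c p) s0 => s s0.
  have q0 : 0 < s + k ^+ 2 by lra.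
  have q20 : 0 < (s + k ^+ 2) ^+ 2 by rewrite exprn_gt0.
  (* Where [s <= k] the first term of the bound suffices, where [s >= k] the second; the completed
     square covers both cases at once. *)
  rewrite -subr_ge0 (_ : _ - _ =
    k * ((s + k ^+ 2 - k / 2) ^+ 2 + 3 / 4 * k ^+ 2 + k ^+ 3) / (s + k ^+ 2) ^+ 2); last first.
    field; rewrite gt_eqF//.
  rewrite divr_ge0 ?(ltW q20)// mulr_ge0 ?(ltW k0)//.
  by rewrite !addr_ge0 ?sqr_ge0 ?mulr_ge0 ?exprn_ge0 ?(ltW k0).
rewrite pintD//; last 2 first.
- by move=> p Kp; have := cB _ Kp => ?; cont.
- by move=> p Kp; cont.
rewrite pintZ// pint_cst//.
have h1 : (eta / 8 + C * k) * pint D (bump (k ^+ 2)) <= (eta / 8 + C * k) * pi.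
  by rewrite ler_wpM2l// addr_ge0// ?ltW// mulr_gt0.
have W20 : 0 < 2 * W by rewrite mulr_gt0.
have h2 : k * (2 * W) <= eta by rewrite -ler_pdivlMr.
have h3 := ler_wpM2l (ltW eta0) p4.
by rewrite /W in h2; lra.
Qed.

End ApproximateIdentity.

(** * The sharp mean value bound *)

Section MaximumPrinciple.
Variable R : realType.

(** At the maximum [f1 x = 0]; if [d] were positive, [f1 u >= d / 2 * (u - x)] just to the right of
    [x], and [f] would increase there. *)
Lemma second_derivative_at_max (f f1 : R -> R) (x d e : R) : 0 < e ->
  (forall y, `|y - x| < e -> is_derive y 1 f (f1 y)) ->
  is_derive x 1 f1 d ->
  (forall y, `|y - x| < e -> f y <= f x) -> d <= 0.
Proof.
move=> e0 df df1 fx.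
have xx : `|x - x| < e by rewrite subrr normr0.
have f1x : f1 x = 0.
  have [_ /esym ->] := df _ xx.
  rewrite -(@derive_val _ _ _ _ _ _ _ (@derive1_at_max R f (x - e) (x + e) x _ _ _ _)) //.
  - lra.
  - by move=> t; rewrite in_itv/= => tI; case: (df t); rewrite // ltr_norml; lra.
  - by rewrite in_itv/=; lra.
  - by move=> t; rewrite in_itv/= => tI; apply: fx; rewrite ltr_norml; lra.
rewrite leNgt; apply/negP => d0.
have d20 : 0 < d / 2 by lra.
have [t t0 tP] := (is_derive_epsP _ _ _).1 df1 _ d20.
pose h := Num.min t e / 2.
have h0 : 0 < h by rewrite divr_gt0// lt_min t0.
have ht : h < t by rewrite /h; have := ge_min t t e; rewrite lexx /=; have := lt_min 0 t e; lra.
have he : h < e by rewrite /h; have := ge_min e t e; rewrite lexx orbT /=; have := lt_min 0 t e; lra.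
clearbody h.
have f1p u : x <= u <= x + h -> d / 2 * (u - x) <= f1 u.
  move=> /andP[xu uh]; have := tP (u - x); rewrite f1x subr0 (_ : x + (u - x) = u); last by ring.
  have -> : `|u - x| = u - x by rewrite ger0_norm// subr_ge0.
  by move=> /(_ _); rewrite ler_norml => H; have := H _; lra.
have df' u : x <= u <= x + h -> is_derive u 1 f (f1 u).
  by move=> xuh; apply: df; rewrite ger0_norm; lra.
(* The mean value point of the first half may be [x] itself, where the lower bound is 0; strict
   growth comes from the second half. *)
have [||u uI eu] := @mvt R f f1 x (x + h / 2); first lra.
  by move=> u uI; apply: df'; lra.
have [||v vI ev] := @mvt R f f1 (x + h / 2) (x + h); first lra.
  by move=> v vI; apply: df'; lra.
have := f1p u; have := f1p v.
have := fx (x + h).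
rewrite (_ : `|x + h - x| = h); last by rewrite ger0_norm; lra.
move=> /(_ he) fxh fv fu.
have {fv} fv : 0 < f1 v.
  by apply: lt_le_trans (fv _); [rewrite mulr_gt0//|]; lra.
have {fu} fu : 0 <= f1 u.
  by apply: le_trans (fu _); [rewrite mulr_ge0//|]; lra.
have : 0 < f1 v * (x + h - (x + h / 2)) by rewrite mulr_gt0//; lra.
have : 0 <= f1 u * (x + h / 2 - x) by rewrite mulr_ge0//; lra.
by rewrite -eu -ev; lra.
Qed.

(** [J + (M/4 + k) dist2] has Laplacian at least [4 k > 0] inside, so it has no interior maximum;
    the comparison function [M/4 * (r^2 - dist2)] has Laplacian [- M]. *)
Lemma max_principle (c : R * R) (r : R) (J : jet R) (M m : R) : 0 < r ->
  is_jet (sqr2 c r) J ->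
  (forall p, disc2 c r p -> - M <= lap J p) ->
  (forall p, dist2 c p = r ^+ 2 -> j0 J p <= m) ->
  forall p, disc2 c r p -> j0 J p <= m + M / 4 * (r ^+ 2 - dist2 c p).
Proof.
move=> r0 hJ lJ Jm p0 Dp0; rewrite leNgt; apply/negP => gap.
have r20 : 0 < r ^+ 2 by rewrite exprn_gt0.
pose g := j0 J p0 - (m + M / 4 * (r ^+ 2 - dist2 c p0)).
have g0 : 0 < g by rewrite subr_gt0.
(* The perturbation [k * dist2] costs at most half of the assumed violation [g], so the maximum
   still cannot lie on the circle. *)
pose k := g / (2 * r ^+ 2).
have k0 : 0 < k by rewrite divr_gt0// mulr_gt0.
have kr : k * r ^+ 2 = g / 2 by rewrite /k; field; rewrite gt_eqF.
have gE : g = j0 J p0 - (m + M / 4 * (r ^+ 2 - dist2 c p0)) by [].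
clearbody k g.
pose E p := j0 J p + (M / 4 + k) * dist2 c p.
pose B := [set p | dist2 c p <= r ^+ 2].
have BK : B `<=` sqr2 c r.
  move=> p; rewrite /B /dist2 /= => pr.
  have h (x y : R) : x ^+ 2 + y ^+ 2 <= r ^+ 2 -> `|x| <= r.
    move=> xy; rewrite -[leRHS]gtr0_norm// -ler_sqr ?nnegrE// !real_normK ?num_real//.
    by have := sqr_ge0 y; lra.
  split => /=; rewrite in_itv/=.
    by move: (h _ _ pr); rewrite ler_norml; lra.
  by move: pr; rewrite addrC => /h; rewrite ler_norml; lra.
have cB : compact B.
  apply: subclosed_compact BK; last exact: compact_sqr2.
  have -> : B = dist2 c @^-1` [set x | x <= r ^+ 2] by [].
  apply: closed_comp; last exact: closed_le.
  by move=> p _; exact: dist2_continuous.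
have cE : {within B, continuous E}.
  apply: continuous_in_subspaceT => p /set_mem /BK /hJ[[? _ _ _ _] _].
  by rewrite /E; cont.
have Bp0 : B p0 by exact: ltW.
have [q Bq qmax] := compact_EVT_max (ex_intro _ p0 Bp0) cB cE.
have Eq : E p0 <= E q by apply: qmax; rewrite inE.
have s0 := dist2_ge0 c p0.
have ks0 : 0 <= k * dist2 c p0 by rewrite mulr_ge0// ltW.
have Dq : disc2 c r q.
  rewrite /disc2 /= lt_neqAle; apply/andP; split; last exact: set_mem.
  apply/negP => /eqP e; have := Jm _ e.
  by move: Eq; rewrite /E e; lra.
have [t t0 tP] := nbhs_disc2 (open_nbhs_nbhs (conj (@open_disc2 _ c r) Dq)).
have DB p : disc2 c r p -> B p by move=> /ltW.
have DK p : disc2 c r p -> sqr2 c r p by move/DB/BK.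
have [_ [_ _ dxx dyy]] := hJ q (DK _ Dq).
have near1 x : `|x - q.1| < t -> disc2 c r (x, q.2).
  move=> xt; apply: tP; rewrite /dist2 /= subrr expr0n addr0.
  by rewrite -real_normK ?num_real// ltr_sqr ?nnegrE// ltW.
have near2 y : `|y - q.2| < t -> disc2 c r (q.1, y).
  move=> yt; apply: tP; rewrite /dist2 /= subrr expr0n add0r.
  by rewrite -real_normK ?num_real// ltr_sqr ?nnegrE// ltW.
have h1 : jxx J q + 2 * (M / 4 + k) <= 0.
  apply: (@second_derivative_at_max (fun x => E (x, q.2))
    (fun x => jx J (x, q.2) + (M / 4 + k) * (2 * (x - c.1))) q.1 _ t t0).
  - move=> x /near1 /DK /hJ[_ [/= ? _ _ _]].
    by rewrite /E /dist2 /=; der; ring.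
  - by der; ring.
  - by move=> x /near1 /DB xB; rewrite -surjective_pairing; apply: qmax; rewrite inE.
have h2 : jyy J q + 2 * (M / 4 + k) <= 0.
  apply: (@second_derivative_at_max (fun y => E (q.1, y))
    (fun y => jy J (q.1, y) + (M / 4 + k) * (2 * (y - c.2))) q.2 _ t t0).
  - move=> x /near2 /DK /hJ[_ [/= _ ? _ _]].
    by rewrite /E /dist2 /=; der; ring.
  - by der; ring.
  - by move=> x /near2 /DB xB; rewrite -surjective_pairing; apply: qmax; rewrite inE.
by have := lJ _ Dq; rewrite /lap; lra.
Qed.

End MaximumPrinciple.

(** Multiply by [1 - x > 0]: on the left [e^x (1 - x) <= e^x e^(-x) = 1], on the right
    [1 + x^2 (1 - 2 x) >= 1]. *)
Lemma expR_le_quadratic (R : realType) (x : R) : x <= 1 / 2 ->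
  expR x <= 1 + x + 2 * x ^+ 2.
Proof.
move=> x2; have h1 : 0 < 1 - x by lra.
rewrite -(ler_pM2r h1); apply: (@le_trans _ _ 1).
  rewrite -[leRHS](expRxMexpNx_1 x) ler_pM2l ?expR_gt0//.
  exact: expR_ge1Dx.
rewrite -subr_ge0 (_ : _ - 1 = x ^+ 2 * (1 - 2 * x)); last by ring.
by rewrite mulr_ge0 ?sqr_ge0//; lra.
Qed.

(** * Exponential means of superharmonic functions with small boundary values *)

Section SharpMeanValue.
Variable R : realType.
Variables (c : R * R) (r M eta : R) (V : jet R).
Local Notation K := (sqr2 c r).
Local Notation D := (disc2 c r).
Hypotheses (r0 : 0 < r) (M0 : 0 <= M) (eta0 : 0 <= eta) (hV : is_jet K V).
Hypothesis lapV : forall p, D p -> 0 <= - lap V p <= M.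
Hypothesis bV : forall p, dist2 c p = r ^+ 2 -> 0 <= j0 V p <= 2 * eta.

Let r20 : 0 < r ^+ 2. Proof. by rewrite exprn_gt0. Qed.

Let V_ge0 p : D p -> 0 <= j0 V p.
Proof.
move=> Dp; have := @max_principle R c r (jet_opp V) 0 0 r0 (is_jet_opp hV) _ _ p Dp.
rewrite /= mul0r mul0r addr0 oppr_le0; apply.
- by move=> q /lapV; rewrite /lap /=; lra.
- by move=> q /bV; lra.
Qed.

Let V_le p : D p -> j0 V p <= M / 4 * (r ^+ 2 - dist2 c p) + 2 * eta.
Proof.
move=> Dp; rewrite addrC.
apply: (@max_principle R c r V M (2 * eta) r0 hV _ _ p Dp).
- by move=> q /lapV; lra.
- by move=> q /bV; lra.
Qed.

Let cV : cont_on c r (j0 V). Proof. by move=> p /hV[[]]. Qed.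
Let cL : cont_on c r (fun p => lap V p).
Proof. by move=> p /hV[[? ? ? ? ?] _]; rewrite /lap; cont. Qed.
Let cD : cont_on c r (dist2 c). Proof. by move=> p _; exact: dist2_continuous. Qed.

(** The quantity that links the two Green formulas: the mean value defect bounds it from above, and
    it bounds the integral of the square. *)
Let I := pint D (fun p => (r ^+ 2 - dist2 c p) ^+ 2 * - lap V p).
Let cI : cont_on c r (fun p => (r ^+ 2 - dist2 c p) ^+ 2 * - lap V p).
Proof. by move=> p Kp; have := cD Kp; have := cL Kp => ? ?; cont. Qed.

Let I_ge0 : 0 <= I.
Proof.
rewrite -[0](mul0r (pi * r ^+ 2)) -(pint_cst c r0); apply: le_pint => //.
  by move=> p _; exact: cont_cst.
by move=> p /lapV/andP[h _]; rewrite mulr_ge0// sqr_ge0.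
Qed.

(** [green_bump] for [V] gives [4/(r^2+d) int V - 4 int bump V = int pot lap V], with [pot] the
    potential of [bump]. Since [- lap V >= 0], [bump_jet_ge] bounds the right side by
    [- I / (2 (r^2+d)^2)]; now let [d = k^2 -> 0], where [int bump V] tends to [pi V(c)]. *)
Lemma mean_value_defect :
  I / (8 * r ^+ 2) <= pi * r ^+ 2 * j0 V c - pint D (j0 V).
Proof.
apply/ler_addgt0Pr => e e0.
pose e1 := e / (2 * (r ^+ 2 + 1)).
have r21 : 0 < r ^+ 2 + 1 by rewrite addr_gt0.
have e10 : 0 < e1 by rewrite divr_gt0// mulr_gt0.
have [k0 k00 kP] := bump_concentrates r0 cV e10.
(* Half of [e] pays for replacing [r^2 + k^2] by [r^2] under [I], the other half, through [e1], for
   the concentration error; [I + 1] avoids a zero denominator. *)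
pose k1 := 4 * r ^+ 4 * e / (I + 1).
have I1 : 0 < I + 1 by rewrite ltr_wpDl.
have r40 : 0 < r ^+ 4 by rewrite exprn_gt0.
have k10 : 0 < k1 by rewrite divr_gt0// !mulr_gt0.
pose k := Num.min k0 (Num.min 1 k1).
have kpos : 0 < k by rewrite !lt_min k00 k10 ltr01.
have kk0 : k <= k0 by rewrite /k ge_min lexx.
have kk1 : k <= 1 by rewrite /k !ge_min lexx !orbT.
have kk2 : k <= k1 by rewrite /k !ge_min lexx !orbT.
clearbody k.
have kint : 0 < k <= k0 by rewrite kpos.
have d0 : 0 < k ^+ 2 by rewrite exprn_gt0.
have dk : k ^+ 2 <= k by rewrite expr2 ger_pMl.
have cB : cont_on c r (bump c (k ^+ 2)) by move=> p _; exact: cont_bump.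
have q0 : 0 < r ^+ 2 + k ^+ 2 by rewrite addr_gt0.
have G := green_bump r0 d0 hV.
have {kP} B := kP k kint.
have E1 : pint D (fun p => bump c (k ^+ 2) p * j0 V p) =
    pint D (fun p => bump c (k ^+ 2) p * (j0 V p - j0 V c)) +
    j0 V c * (pi * r ^+ 2 / (r ^+ 2 + k ^+ 2)).
  rewrite -(pint_bump c r0 d0) -pintZ// -pintD//; first last.
  - by move=> p Kp; have := cB _ Kp => ?; cont.
  - by move=> p Kp; have := cB _ Kp; have := cV Kp => ? ?; cont.
  by congr pint; apply/funext => p; ring.
have cJ : cont_on c r (fun p => j0 (bump_jet c r (k ^+ 2)) p * lap V p).
  move=> p Kp; have := cL Kp => ?.
  by have [[? _ _ _ _] _] := @is_jet_bump R c r r0 (k ^+ 2) K d0 p Kp; cont.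
have E2 : pint D (fun p => j0 (bump_jet c r (k ^+ 2)) p * lap V p) <=
    - (1 / (2 * (r ^+ 2 + k ^+ 2) ^+ 2)) * I.
  rewrite -pintZ//; apply: le_pint => //.
    by move=> p Kp; have := cI Kp => ?; cont.
  move=> p Dp; have /andP[l0 _] := lapV Dp.
  have := bump_jet_ge d0 (ltW Dp); move=> /(ler_wpM2r l0).
  suff -> : ((r ^+ 2 - dist2 c p) / (r ^+ 2 + k ^+ 2)) ^+ 2 / 2 * - lap V p =
    (1 / (2 * (r ^+ 2 + k ^+ 2) ^+ 2)) * ((r ^+ 2 - dist2 c p) ^+ 2 * - lap V p) by lra.
  by field; rewrite gt_eqF.
rewrite -G E1 in E2.
move: E2 B; set w := pint D (fun p => _ * (_ - _)); set v := pint D (j0 V).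
move=> E2 /ler_normlP[_ B].
have E3 := ler_wpM2l (ltW q0) E2.
have E4 : (r ^+ 2 + k ^+ 2) * (4 / (r ^+ 2 + k ^+ 2) * v -
    4 * (w + j0 V c * (pi * r ^+ 2 / (r ^+ 2 + k ^+ 2)))) =
    4 * v - 4 * (r ^+ 2 + k ^+ 2) * w - 4 * (pi * r ^+ 2 * j0 V c).
  by field; rewrite gt_eqF.
have E5 : (r ^+ 2 + k ^+ 2) * (- (1 / (2 * (r ^+ 2 + k ^+ 2) ^+ 2)) * I) =
    - (I / (2 * (r ^+ 2 + k ^+ 2))).
  by field; rewrite gt_eqF.
rewrite E4 E5 in E3.
have E6 : I / (8 * r ^+ 2) <= I / (8 * (r ^+ 2 + k ^+ 2)) + e / 2.
  rewrite -subr_ge0.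
  have -> : I / (8 * (r ^+ 2 + k ^+ 2)) + e / 2 - I / (8 * r ^+ 2) =
     e / 2 - I * k ^+ 2 / (8 * r ^+ 2 * (r ^+ 2 + k ^+ 2)).
    by field; rewrite !gt_eqF.
  rewrite subr_ge0 ler_pdivrMr; last by rewrite !mulr_gt0.
  have h1 : I * k ^+ 2 <= I * k1 by rewrite ler_wpM2l//; lra.
  have h2 : I * k1 <= (I + 1) * k1 by rewrite ler_wpM2r//; lra.
  have h3 : (I + 1) * k1 = 4 * r ^+ 4 * e by rewrite /k1; field; rewrite gt_eqF.
  have h4 : r ^+ 4 * e <= r ^+ 2 * (r ^+ 2 + k ^+ 2) * e.
    rewrite ler_pM2r// (_ : r ^+ 4 = r ^+ 2 * r ^+ 2) ?ler_pM2l//; first lra.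
    by ring.
  lra.
have E7 : (r ^+ 2 + k ^+ 2) * w <= e / 2.
  have h1 : (r ^+ 2 + k ^+ 2) * w <= (r ^+ 2 + k ^+ 2) * e1 by rewrite ler_pM2l.
  have h2 : (r ^+ 2 + k ^+ 2) * e1 <= (r ^+ 2 + 1) * e1 by rewrite ler_pM2r//; lra.
  have h3 : (r ^+ 2 + 1) * e1 = e / 2 by rewrite /e1; field; rewrite gt_eqF.
  lra.
have E8 : I / (8 * (r ^+ 2 + k ^+ 2)) = I / (2 * (r ^+ 2 + k ^+ 2)) / 4.
  by field; rewrite gt_eqF.
lra.
Qed.

Let cDr : cont_on c r (fun p => r ^+ 2 - dist2 c p).
Proof. by move=> p Kp; have := cD Kp => ?; cont. Qed.

(** Green for [V^2] against [P = r^2 - s], with [lap P = -4] and [P = 0] on the circle. There only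
    [V^2 grad P] remains, at most [(2 eta)^2 * 2 r] in each coordinate. *)
Lemma square_mean_bound :
  pint D (fun p => j0 V p ^+ 2) <=
  M / 8 * I + eta * pi * M * r ^+ 4 + 16 * r ^+ 2 * eta ^+ 2.
Proof.
pose P := jet_radial c (fun s => r ^+ 2 - s) (fun=> -1) (fun=> 0).
have hP : is_jet K P.
  apply: is_jet_radial => s _; first by der; ring.
  exact: cont_cst.
have hVV := is_jet_mul hV hV.
have B p : dist2 c p = r ^+ 2 ->
    `|j0 (jet_mul V V) p * jx P p - j0 P p * jx (jet_mul V V) p| <= 8 * r * eta ^+ 2 /\
    `|j0 (jet_mul V V) p * jy P p - j0 P p * jy (jet_mul V V) p| <= 8 * r * eta ^+ 2.
  move=> e; have /andP[v0 v1] := bV e.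
  have h (x y : R) : x ^+ 2 + y ^+ 2 = r ^+ 2 -> `|x| <= r.
    move=> xy; rewrite -[leRHS]gtr0_norm// -ler_sqr ?nnegrE// !real_normK ?num_real//.
    by have := sqr_ge0 y; lra.
  have H (x : R) : `|x| <= r -> `|j0 V p * j0 V p * (-1 * (2 * x))| <= 8 * r * eta ^+ 2.
    move=> xr; rewrite !normrM normrN normr1 mul1r (ger0_norm v0) (@ger0_norm _ 2)//.
    rewrite (_ : 8 * r * eta ^+ 2 = (2 * eta) * (2 * eta) * (2 * r)); last by ring.
    by rewrite ler_pM ?mulr_ge0// ?ler_pM// ?mulr_ge0// ler_pM2l.
  rewrite /= e subrr !mul0r !subr0; split; apply: H.
    by apply: (h _ (p.2 - c.2)).
  by apply: (h _ (p.1 - c.1)); rewrite addrC.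
have := green r0 hVV hP B.
have lapP p : lap P p = -4 by rewrite /lap /=; ring.
have cVV : cont_on c r (fun p => j0 V p ^+ 2) by move=> p Kp; have := cV Kp => ?; cont.
rewrite (_ : (fun p => j0 (jet_mul V V) p * lap P p) = (fun p => -4 * j0 V p ^+ 2)); last first.
  by apply/funext => p; rewrite lapP /=; ring.
rewrite pintZ//; set X := pint D (fun p => j0 V p ^+ 2).
set Y := pint D _ => /ler_normlP[+ _].
have cY : cont_on c r (fun p => j0 P p * lap (jet_mul V V) p).
  move=> p Kp; have [[? _ _ _ _] _] := hP p Kp.
  by have [[_ _ _ ? ?] _] := hVV p Kp; rewrite /lap; cont.
have : - Y <= M / 2 * I + 4 * eta * M * r ^+ 2 * (pi * r ^+ 2).
  have cN : cont_on c r (fun p => -1 * (j0 P p * lap (jet_mul V V) p)).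
    by move=> p Kp; have := cY p Kp => ?; cont.
  have cI2 : cont_on c r (fun p => M / 2 * ((r ^+ 2 - dist2 c p) ^+ 2 * - lap V p)).
    by move=> p Kp; have := cI Kp => ?; cont.
  rewrite -mulN1r -pintZ// -(pint_cst c r0) -pintZ// -pintD//; last first.
    by move=> p _; exact: cont_cst.
  apply: le_pint => //.
    by move=> p Kp; have := cI2 p Kp => ?; cont.
  move=> p Dp; have /andP[l0 l1] := lapV Dp; have v0 := V_ge0 Dp; have v1 := V_le Dp.
  have s0 := dist2_ge0 c p; have sr : dist2 c p < r ^+ 2 := Dp.
  set s := dist2 c p in s0 sr v1 *.
  (* [lap (V^2) = 2 V lap V + 2 |grad V|^2]: the gradient term has the favourable sign and is
     dropped, and [V] is replaced by its bound from the maximum principle. *)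
  have -> : -1 * (j0 P p * lap (jet_mul V V) p) =
     2 * ((r ^+ 2 - s) * (- lap V p) * j0 V p) -
     2 * ((r ^+ 2 - s) * (jx V p ^+ 2 + jy V p ^+ 2)).
    by rewrite /lap /= -/s; ring.
  have rs0 : 0 <= r ^+ 2 - s by lra.
  have h1 : 0 <= (r ^+ 2 - s) * (jx V p ^+ 2 + jy V p ^+ 2).
    by rewrite mulr_ge0// addr_ge0 ?sqr_ge0.
  have w0 : 0 <= (r ^+ 2 - s) * (- lap V p) by rewrite mulr_ge0.
  have h2 := ler_wpM2l w0 v1.
  have h3 : (r ^+ 2 - s) * (- lap V p) <= r ^+ 2 * M.
    by apply: ler_pM => //; lra.
  have h4 := ler_wpM2l eta0 h3.
  lra.
by rewrite (_ : r ^+ 4 = r ^+ 2 * r ^+ 2); [lra|ring].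
Qed.

(** With [A = V(c)] and [m] the mean value defect, [exp x <= 1 + x + 2 x^2] gives [pi r^2 - m + 4 A
    m + 2 int V^2 - 2 A^2 pi r^2]. Here [4 A <= M r^2 + 8 eta], and [2 int V^2] contributes
    [2 M r^2 m] besides terms of order [eta]; by the hypothesis all multiples of [m] together are at
    most 0. *)
Lemma exp_mean_bound : 3 * M * r ^+ 2 + 8 * eta <= 1 ->
  pint D (fun p => expR (j0 V p - j0 V c)) <=
  pi * r ^+ 2 + 2 * (eta * pi * M * r ^+ 4 + 16 * r ^+ 2 * eta ^+ 2).
Proof.
move=> small.
have Dc : D c by rewrite /disc2 /dist2 /= !subrr expr0n addr0.
have V0 := V_ge0 Dc; have V1 := V_le Dc.
have d0 : dist2 c c = 0 by rewrite /dist2 !subrr expr0n addr0.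
rewrite d0 subr0 in V1.
have Mr : 0 <= M * r ^+ 2 by rewrite mulr_ge0// ltW.
pose A := j0 V c; pose X := pint D (j0 V); pose Z := pint D (fun p => j0 V p ^+ 2).
have cVV : cont_on c r (fun p => j0 V p ^+ 2) by move=> p Kp; have := cV Kp => ?; cont.
have cE : cont_on c r (fun p => expR (j0 V p - j0 V c)).
  by move=> p Kp; have := cV Kp => ?; cont.
have cR1 : cont_on c r (fun p => (1 - 4 * A) * j0 V p) by move=> p Kp; have := cV Kp => ?; cont.
have cR2 : cont_on c r (fun p => 2 * j0 V p ^+ 2) by move=> p Kp; have := cV Kp => ?; cont.
have cR3 : cont_on c r (fun p => (1 - A + 2 * A ^+ 2)) by move=> p _; exact: cont_cst.
have cR12 : cont_on c r (fun p => (1 - 4 * A) * j0 V p + 2 * j0 V p ^+ 2).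
  by move=> p Kp; have := cV Kp => ?; cont.
apply: (@le_trans _ _ (pint D (fun p => (1 - 4 * A) * j0 V p + 2 * j0 V p ^+ 2 +
    (1 - A + 2 * A ^+ 2)))).
  apply: le_pint => //.
    by move=> p Kp; have := cV Kp => ?; cont.
  move=> p Dp; have v0 := V_ge0 Dp; have v1 := V_le Dp.
  have s0 := dist2_ge0 c p.
  have Ms : 0 <= M * dist2 c p by rewrite mulr_ge0.
  have : j0 V p - A <= 1 / 2 by rewrite /A; lra.
  by move/expR_le_quadratic; rewrite -/A; lra.
rewrite pintD// pintD// !pintZ// pint_cst// -/X -/Z.
have := mean_value_defect; rewrite -/X -/A => mv.
have := square_mean_bound; rewrite -/Z => sq.
have r40 : 0 < r ^+ 4 by rewrite exprn_gt0.
pose m := pi * r ^+ 2 * A - X.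
have XE : X = pi * r ^+ 2 * A - m by rewrite /m; ring.
have m0 : 0 <= m.
  by apply: le_trans mv; rewrite divr_ge0// mulr_ge0// ltW.
have MI : M / 8 * I <= M * r ^+ 2 * m.
  have := ler_wpM2l Mr mv; rewrite -/m.
  by rewrite (_ : M * r ^+ 2 * (I / (8 * r ^+ 2)) = M / 8 * I) //; field; rewrite gt_eqF.
have mA : 4 * A * m <= 4 * (M / 4 * r ^+ 2 + 2 * eta) * m.
  by rewrite ler_wpM2r// ler_pM2l.
have ms : (3 * M * r ^+ 2 + 8 * eta) * m <= 1 * m by rewrite ler_wpM2r.
rewrite XE; clearbody m.
have -> : (1 - 4 * A) * (pi * r ^+ 2 * A - m) + 2 * Z + (1 - A + 2 * A ^+ 2) * (pi * r ^+ 2)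
  = pi * r ^+ 2 - m + 4 * A * m + 2 * Z - 2 * (A ^+ 2 * (pi * r ^+ 2)) by ring.
have : 0 <= A ^+ 2 * (pi * r ^+ 2).
  by rewrite mulr_ge0 ?sqr_ge0// mulr_ge0 ?pi_ge0 ?(ltW r20).
lra.
Qed.

End SharpMeanValue.

(** * Harmonic polynomials on a circle *)

Section BernsteinOperator.
Variable R : realType.
Implicit Types (u : R) (g h : nat -> R).

(* Expectation of [g] under the binomial law: conditioning on the first trial
   gives the recursion, and no binomial coefficient is needed. *)
Fixpoint bern (N : nat) u g : R :=
  if N is N'.+1 then u * bern N' u (fun i => g i.+1) + (1 - u) * bern N' u g else g 0%N.

Lemma bern_le N u g h : 0 <= u <= 1 ->
  (forall i, (i <= N)%N -> g i <= h i) -> bern N u g <= bern N u h.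
Proof.
move=> u01; elim: N g h => [|N IH] g h gh /=; first exact: gh.
by apply: lerD; apply: ler_wpM2l; [lra|apply: IH => i iN; exact: gh|lra|
  apply: IH => i iN; apply: gh; exact: leqW].
Qed.

Lemma bernD N u g h : bern N u (fun i => g i + h i) = bern N u g + bern N u h.
Proof. by elim: N g h => [|N IH] g h //=; rewrite !IH; ring. Qed.

Lemma bernZ N u (a : R) g : bern N u (fun i => a * g i) = a * bern N u g.
Proof. by elim: N g => [|N IH] g //=; rewrite !IH; ring. Qed.

Lemma bern_cst N u (a : R) : bern N u (fun=> a) = a.
Proof. by elim: N => [|N IH] //=; rewrite !IH; ring. Qed.

(** Variance plus squared bias of the binomial law. The centre [a] is arbitrary because the
    recursion shifts it by one. *)
Lemma bern_sqr N u (a : R) :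
  bern N u (fun i => (i%:R - a) ^+ 2) = N%:R * (u * (1 - u)) + (N%:R * u - a) ^+ 2.
Proof.
elim: N a => [|N IH] a /=; first by ring.
rewrite (_ : (fun i => (i.+1%:R - a) ^+ 2) = (fun i => (i%:R - (a - 1)) ^+ 2)); last first.
  by apply/funext => i; rewrite -natr1; ring.
by rewrite !IH -natr1; ring.
Qed.

End BernsteinOperator.

Section HarmonicPolynomials.
Variable R : realType.
Implicit Types (c p : R * R) (r : R) (H : {poly R[i]}).

Definition zeta c p : R[i] := ((p.1 - c.1)%R +i* (p.2 - c.2)%R)%C.

Definition reval c H p : R := complex.Re H.[zeta c p].
Definition imval c H p : R := complex.Im H.[zeta c p].

Lemma cReM (z w : R[i]) :
  complex.Re (z * w) = complex.Re z * complex.Re w - complex.Im z * complex.Im w.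
Proof. by case: z w => a b [a' b']. Qed.

Lemma cImM (z w : R[i]) :
  complex.Im (z * w) = complex.Re z * complex.Im w + complex.Im z * complex.Re w.
Proof. by case: z w => a b [a' b']. Qed.

Lemma cReD (z w : R[i]) : complex.Re (z + w) = complex.Re z + complex.Re w.
Proof. by case: z w => a b [a' b']. Qed.

Lemma cImD (z w : R[i]) : complex.Im (z + w) = complex.Im z + complex.Im w.
Proof. by case: z w => a b [a' b']. Qed.

Lemma reval_step c H (b : R[i]) p : reval c (H * 'X + b%:P) p =
  reval c H p * (p.1 - c.1) - imval c H p * (p.2 - c.2) + complex.Re b.
Proof. by rewrite /reval /imval hornerMXaddC cReD cReM. Qed.

Lemma imval_step c H (b : R[i]) p : imval c (H * 'X + b%:P) p =
  reval c H p * (p.2 - c.2) + imval c H p * (p.1 - c.1) + complex.Im b.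
Proof. by rewrite /reval /imval hornerMXaddC cImD cImM. Qed.

Lemma reval0 c p : reval c 0 p = 0. Proof. by rewrite /reval horner0. Qed.
Lemma imval0 c p : imval c 0 p = 0. Proof. by rewrite /imval horner0. Qed.

Lemma revalD c H H' p : reval c (H + H') p = reval c H p + reval c H' p.
Proof. by rewrite /reval hornerD cReD. Qed.
Lemma imvalD c H H' p : imval c (H + H') p = imval c H p + imval c H' p.
Proof. by rewrite /imval hornerD cImD. Qed.

Lemma deriv_step H (b : R[i]) : deriv (H * 'X + b%:P) = deriv H * 'X + H.
Proof. by rewrite derivD derivC addr0 derivM derivX mulr1 addrC addrC. Qed.

Lemma reval_mulX c H p : reval c (H * 'X) p =
  reval c H p * (p.1 - c.1) - imval c H p * (p.2 - c.2).
Proof. by have := reval_step c H 0 p; rewrite addr0 /= addr0. Qed.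
Lemma imval_mulX c H p : imval c (H * 'X) p =
  reval c H p * (p.2 - c.2) + imval c H p * (p.1 - c.1).
Proof. by have := imval_step c H 0 p; rewrite addr0 /= addr0. Qed.

(** The Cauchy-Riemann equations for a polynomial, by induction along its Horner form. *)
Lemma reim_deriv c H (x y : R) :
  [/\ is_derive x 1 (fun x => reval c H (x, y)) (reval c (deriv H) (x, y)),
      is_derive x 1 (fun x => imval c H (x, y)) (imval c (deriv H) (x, y)),
      is_derive y 1 (fun y => reval c H (x, y)) (- imval c (deriv H) (x, y)) &
      is_derive y 1 (fun y => imval c H (x, y)) (reval c (deriv H) (x, y))].
Proof.
elim/poly_ind: H => [|H b [d1 d2 d3 d4]].
  rewrite deriv0; under eq_fun do rewrite reval0.
  by split; (under eq_fun do rewrite ?reval0 ?imval0);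
    rewrite ?reval0 ?imval0 ?oppr0; der.
rewrite deriv_step revalD imvalD reval_mulX imval_mulX.
split.
- by under eq_fun do rewrite reval_step; rewrite /=; der; ring.
- by under eq_fun do rewrite imval_step; rewrite /=; der; ring.
- by under eq_fun do rewrite reval_step; rewrite /=; der; ring.
- by under eq_fun do rewrite imval_step; rewrite /=; der; ring.
Qed.

Lemma cont_reim c H p : {for p, continuous (reval c H)} /\ {for p, continuous (imval c H)}.
Proof.
change (continuous_at p (reval c H) /\ continuous_at p (imval c H)).
elim/poly_ind: H => [|H b [c1 c2]].
  have -> : reval c 0 = (fun=> 0) by apply/funext => q; rewrite reval0.
  have -> : imval c 0 = (fun=> 0) by apply/funext => q; rewrite imval0.
  by split; exact: cvg_cst.
have -> := funext (reval_step c H b).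
have -> := funext (imval_step c H b).
by split; cont.
Qed.

(** The derivatives of [Re H] come from [H'] and [H''] by the Cauchy-Riemann equations, which makes
    harmonicity a syntactic cancellation. *)
Definition hjet c H := Jet (reval c H) (reval c (deriv H))
  (fun p => - imval c (deriv H) p) (reval c (deriv (deriv H)))
  (fun p => - reval c (deriv (deriv H)) p).

Lemma is_jet_hjet c H S : is_jet S (hjet c H).
Proof.
move=> [x y] _; split => /=.
  have [c1 _] := cont_reim c H (x, y).
  have [c2 c3] := cont_reim c (deriv H) (x, y).
  have [c4 _] := cont_reim c (deriv (deriv H)) (x, y).
  by split; cont.
have [d1 _ d2 _] := reim_deriv c H x y.
have [d3 _ _ d4] := reim_deriv c (deriv H) x y.
by split => //; der.
Qed.

Lemma lap_hjet c H p : lap (hjet c H) p = 0.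
Proof. by rewrite /lap /= subrr. Qed.

End HarmonicPolynomials.

(** * Uniform approximation on a circle by real parts of polynomials *)

Section CircleApproximation.
Variable R : realType.
Variables (c : R * R) (r : R).
Hypothesis r0 : 0 < r.
Implicit Types (p : R * R) (H : {poly R[i]}) (F G : R * R -> R).

(* Restrictions to the circle of pairs (Re H, Im H), H a polynomial; since
   [conj z = r^2 / z] there, the real parts form an algebra. *)
Definition reim_on_circle (F G : R * R -> R) :=
  exists H, forall p, dist2 c p = r ^+ 2 -> F p = reval c H p /\ G p = imval c H p.

Lemma roc_cst (a b : R) : reim_on_circle (fun=> a) (fun=> b).
Proof. by exists ((a +i* b)%C%:P) => p _; rewrite /reval /imval hornerC. Qed.

Lemma rocD F G F' G' : reim_on_circle F G -> reim_on_circle F' G' ->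
  reim_on_circle (fun p => F p + F' p) (fun p => G p + G' p).
Proof.
move=> [H e1] [H' e2]; exists (H + H') => p e.
have [-> ->] := e1 p e; have [-> ->] := e2 p e.
by rewrite revalD imvalD.
Qed.

Lemma rocM (a b : R) F G : reim_on_circle F G ->
  reim_on_circle (fun p => a * F p - b * G p) (fun p => a * G p + b * F p).
Proof.
move=> [H e1]; exists ((a +i* b)%C%:P * H) => p e; have [-> ->] := e1 p e.
by rewrite /reval /imval hornerCM cReM cImM.
Qed.

Lemma rocX F G : reim_on_circle F G -> reim_on_circle
  (fun p => F p * (p.1 - c.1) - G p * (p.2 - c.2))
  (fun p => F p * (p.2 - c.2) + G p * (p.1 - c.1)).
Proof.
move=> [H e1]; exists (H * 'X) => p e; have [-> ->] := e1 p e.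
by rewrite reval_mulX imval_mulX.
Qed.

Definition harmonic_on_circle F := exists G, reim_on_circle F G.

Lemma hoc_eq F F' : (forall p, dist2 c p = r ^+ 2 -> F p = F' p) ->
  harmonic_on_circle F -> harmonic_on_circle F'.
Proof. by move=> FF [G [H e]]; exists G, H => p pr; rewrite -FF//; exact: e. Qed.

Lemma hocD F F' : harmonic_on_circle F -> harmonic_on_circle F' ->
  harmonic_on_circle (fun p => F p + F' p).
Proof. by move=> [G h] [G' h']; eexists; exact: rocD h h'. Qed.

Lemma hocZ (a : R) F : harmonic_on_circle F -> harmonic_on_circle (fun p => a * F p).
Proof.
move=> [G h]; have := rocM a 0 h; set G' := (fun p => a * G p + _) => h'.
by apply: (hoc_eq _ (ex_intro _ G' h')) => p _; ring.
Qed.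

(** If [F = Re f] with [f = z H + d], the product [Re (conj w * z) * Re f] is half of
    [Re (conj w z f) + Re (w conj z f)]. On the circle [w conj z f = r^2 w H + w conj z d], and the
    last term has the real part of [conj w z conj d]. *)
Lemma hocMxy (a b : R) F : harmonic_on_circle F ->
  harmonic_on_circle (fun p => (a * (p.1 - c.1) + b * (p.2 - c.2)) * F p).
Proof.
move=> [G [H]]; elim/poly_ind: H => [e1|H d _ e1].
  have [G' h] := roc_cst 0 0; exists (fun=> 0), G' => p e; rewrite -(h p e).1 -(h p e).2.
  by have [-> _] := e1 p e; rewrite reval0 mulr0.
have hF : reim_on_circle F G by exists (H * 'X + d%:P).
have hH : reim_on_circle (reval c H) (imval c H) by exists H.
have hd := rocX (roc_cst (complex.Re d) (- complex.Im d)).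
(* Re (conj w * z) with w = a + i b *)
have := rocD (rocM (a / 2) (- b / 2) (rocX hF))
  (rocD (rocM (a * r ^+ 2 / 2) (b * r ^+ 2 / 2) hH) (rocM (a / 2) (- b / 2) hd)).
set G' := (X in reim_on_circle _ X) => h'.
apply: (hoc_eq _ (ex_intro _ G' h')) => p e; have [-> ->] := e1 p e.
by rewrite reval_step imval_step -e /dist2; field.
Qed.

Lemma hoc_bern (N : nat) (l : R * R -> R) (g : nat -> R * R -> R) :
  (forall F, harmonic_on_circle F -> harmonic_on_circle (fun p => l p * F p)) ->
  (forall i, harmonic_on_circle (g i)) ->
  harmonic_on_circle (fun p => bern N (l p) (fun i => g i p)).
Proof.
move=> hl; elim: N g => [|N IH] g hg /=; first exact: hg.
apply: hocD; first by apply: hl; apply: IH => i; exact: hg.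
by apply: (hoc_eq _ (hocD (IH g hg) (hocZ (-1) (hl _ (IH g hg))))) => p _; ring.
Qed.

(** This replaces solving a Dirichlet problem. The Bernstein polynomial of [F] in the two
    coordinates of the square is uniformly close to a Lipschitz [F], and on the circle every
    polynomial in [x] and [y] is the real part of a polynomial in [z]. *)
Lemma circle_approximation (F : R * R -> R) (L eta : R) : 0 <= L -> 0 < eta ->
  (forall p q, sqr2 c r p -> sqr2 c r q ->
     `|F p - F q| <= L * (`|p.1 - q.1| + `|p.2 - q.2|)) ->
  exists H, forall p, dist2 c p = r ^+ 2 -> `|reval c H p - F p| <= eta.
Proof.
move=> L0 eta0 FL.
(* Scale of the splitting [|t| <= k + t^2 / k]: the constant parts of both coordinates cost
   [2 L k <= eta / 2]. *)
pose k := eta / (4 * (L + 1)).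
have L1 : 0 < L + 1 by rewrite ltr_wpDl.
have k0 : 0 < k by rewrite divr_gt0// mulr_gt0.
have kL : 2 * L * k <= eta / 2.
  have -> : eta / 2 = 2 * (L + 1) * k by rewrite /k; field; rewrite gt_eqF.
  by rewrite ler_pM2r// ler_pM2l//; lra.
clearbody k.
have [N N0 NP] : exists2 N : nat, (0 < N)%N & 4 * L * r ^+ 2 / (k * eta) <= N%:R.
  exists (Num.bound (4 * L * r ^+ 2 / (k * eta))).+1 => //.
  apply: le_trans (ltW (archi_boundP _)) _.
    by apply: divr_ge0; [exact: mulr_ge0 (mulr_ge0 _ L0) (sqr_ge0 r)|exact/ltW/mulr_gt0].
  by rewrite ler_nat.
have Npos : 0 < N%:R :> R by rewrite ltr0n.
(* The node spacing is [2 r / N], so [L t^2 / k] is [a] times the squared deviation of the index.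
   Its expectation is at most [a N / 4] per coordinate, which is why [N] makes
   [a N / 2 <= eta / 2]. *)
pose a := 4 * L * r ^+ 2 / (k * N%:R ^+ 2).
have a0 : 0 <= a
  by apply: divr_ge0; [exact: mulr_ge0 (mulr_ge0 _ L0) (sqr_ge0 r)|exact: mulr_ge0 (ltW k0) (sqr_ge0 _)].
have aN : a * N%:R / 2 <= eta / 2.
  have -> : a * N%:R / 2 = (4 * L * r ^+ 2 / (k * eta)) * (eta / (2 * N%:R)).
    by rewrite /a; field; rewrite !gt_eqF.
  have -> : eta / 2 = N%:R * (eta / (2 * N%:R)) by field; rewrite gt_eqF.
  by rewrite ler_wpM2r// divr_ge0 ?(ltW eta0)// mulr_ge0 ?(ltW Npos).
pose u (p : R * R) := (2 * r)^-1 * (p.1 - c.1) + 1 / 2.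
pose w (p : R * R) := (2 * r)^-1 * (p.2 - c.2) + 1 / 2.
pose node (i j : nat) : R * R :=
  (c.1 - r + 2 * r * (i%:R / N%:R), c.2 - r + 2 * r * (j%:R / N%:R)).
have hB : harmonic_on_circle (fun p => bern N (u p) (fun i =>
    bern N (w p) (fun j => F (node i j)))).
  have hu G : harmonic_on_circle G -> harmonic_on_circle (fun p => u p * G p).
    move=> hG; apply: (hoc_eq _ (hocD (hocMxy (2 * r)^-1 0 hG) (hocZ (1 / 2) hG))) => p _.
    by rewrite /u; ring.
  have hw G : harmonic_on_circle G -> harmonic_on_circle (fun p => w p * G p).
    move=> hG; apply: (hoc_eq _ (hocD (hocMxy 0 (2 * r)^-1 hG) (hocZ (1 / 2) hG))) => p _.
    by rewrite /w; ring.
  apply: hoc_bern => // i; apply: (@hoc_bern N w (fun j _ => F (node i j))) => // j.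
  by exists (fun=> 0); exact: roc_cst.
have [G [H HP]] := hB; exists H => p e; have [<- _] := HP p e.
have h1 (x y : R) : x ^+ 2 + y ^+ 2 = r ^+ 2 -> `|x| <= r.
  move=> xy; rewrite -[leRHS]gtr0_norm// -ler_sqr ?nnegrE// !real_normK ?num_real//.
  by have := sqr_ge0 y; lra.
have xr : `|p.1 - c.1| <= r by apply: (h1 _ (p.2 - c.2)).
have yr : `|p.2 - c.2| <= r by apply: (h1 _ (p.1 - c.1)); rewrite addrC.
have Kp : sqr2 c r p.
  by move: xr yr; rewrite !ler_norml => ? ?; split; rewrite /= in_itv/=; lra.
have u01 (x : R) : `|x| <= r -> 0 <= (2 * r)^-1 * x + 1 / 2 <= 1.
  rewrite ler_norml => xr'; have r2 : 0 < 2 * r by rewrite mulr_gt0.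
  have -> : (2 * r)^-1 * x + 1 / 2 = (x + r) / (2 * r) by field; rewrite gt_eqF.
  by rewrite divr_ge0 ?ler_pdivrMr//=; lra.
have up := u01 _ xr; have wp := u01 _ yr; rewrite -/(u p) -/(w p) in up wp.
have Kn i j : (i <= N)%N -> (j <= N)%N -> sqr2 c r (node i j).
  move=> iN jN.
  have h (m : nat) : (m <= N)%N -> 0 <= (m%:R / N%:R : R) <= 1.
    by move=> mN; rewrite divr_ge0 ?(ltW Npos) ?ler0n//= ler_pdivrMr// mul1r ler_nat.
  have hi := h _ iN; have hj := h _ jN; move: hi hj.
  rewrite /node; move: (i%:R / _) (j%:R / _) => s t hs ht.
  have rs : 0 <= r * s <= r by move: hs => /andP[hs1 hs2]; rewrite mulr_ge0 ?ger_pMr// ltW.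
  have rt : 0 <= r * t <= r by move: ht => /andP[ht1 ht2]; rewrite mulr_ge0 ?ger_pMr// ltW.
  by split; rewrite /= in_itv/=; lra.
(* Makes the Lipschitz bound quadratic in the index, so that [bern_sqr] evaluates its expectation
   exactly. *)
have amgm (t : R) : `|t| <= k + t ^+ 2 / k.
  rewrite -(ler_pM2r k0) mulrDl divfK ?gt_eqF//.
  have := sqr_ge0 (`|t| - k); have := sqr_ge0 k; rewrite -(real_normK (num_real t)).
  have := normr_ge0 t; move: `|t| => v; nra.
pose E i j := 2 * L * k + a * (i%:R - N%:R * u p) ^+ 2 + a * (j%:R - N%:R * w p) ^+ 2.
have FE i j : (i <= N)%N -> (j <= N)%N -> `|F (node i j) - F p| <= E i j.
  move=> iN jN; apply: le_trans (FL _ _ (Kn _ _ iN jN) Kp) _.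
  have d1 : (node i j).1 - p.1 = 2 * r / N%:R * (i%:R - N%:R * u p).
    by rewrite /= /u; field; rewrite !gt_eqF.
  have d2 : (node i j).2 - p.2 = 2 * r / N%:R * (j%:R - N%:R * w p).
    by rewrite /= /w; field; rewrite !gt_eqF.
  apply: le_trans (ler_wpM2l L0 (lerD (amgm _) (amgm _))) _.
  rewrite d1 d2 le_eqVlt; apply/orP; left; apply/eqP.
  by rewrite /E /a; field; rewrite !gt_eqF.
have Ebern : bern N (u p) (fun i => bern N (w p) (fun j => E i j)) <= eta.
  have -> : (fun i => bern N (w p) (fun j => E i j)) = (fun i =>
      2 * L * k + a * N%:R * (w p * (1 - w p)) + a * (i%:R - N%:R * u p) ^+ 2).
    apply/funext => i; rewrite /E bernD bern_cst bernZ bern_sqr.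
    by ring.
  rewrite bernD bern_cst bernZ bern_sqr subrr expr0n addr0.
  have q (x : R) : x * (1 - x) <= 1 / 4.
    by rewrite -subr_ge0 (_ : _ - _ = (x - 1 / 2) ^+ 2) ?sqr_ge0//; field.
  have aN0 : 0 <= a * N%:R by rewrite mulr_ge0.
  have := ler_wpM2l aN0 (q (u p)); have := ler_wpM2l aN0 (q (w p)).
  by lra.
have lin (X : nat -> nat -> R) (b d : R) :
  bern N (u p) (fun i => bern N (w p) (fun j => b * X i j + d)) =
  b * bern N (u p) (fun i => bern N (w p) (fun j => X i j)) + d.
  have -> : (fun i => bern N (w p) (fun j => b * X i j + d)) =
      (fun i => b * bern N (w p) (fun j => X i j) + d).
    by apply/funext => i; rewrite bernD bernZ bern_cst.
  by rewrite bernD bernZ bern_cst.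
set B := bern _ _ _; rewrite ler_norml; apply/andP; split.
  have : - B + F p <= eta.
    rewrite -mulN1r -lin; apply: le_trans Ebern; apply: bern_le => // i iN.
    by apply: bern_le => // j jN; have := FE i j iN jN; rewrite ler_norml; lra.
  lra.
have : 1 * B - F p <= eta.
  rewrite -lin; apply: le_trans Ebern; apply: bern_le => // i iN.
  by apply: bern_le => // j jN; have := FE i j iN jN; rewrite ler_norml; lra.
lra.
Qed.

End CircleApproximation.

(** * Semicontinuity and iterated integrals *)

Section LowerSemicontinuity.
Variable R : realType.
Local Open Scope ereal_scope.

Lemma limn_einf_le (u : (\bar R)^nat) a : (forall n, u n <= a) -> limn_einf u <= a.
Proof.
move=> ua; rewrite limn_einf_lim; apply: lime_le; first exact: is_cvg_einfs.
apply: nearW => n; apply: le_trans (ua n); apply: ereal_inf_lbound.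
by exists n => /=.
Qed.

Lemma limn_einf_ge (u : (\bar R)^nat) a : (\forall n \near \oo, a <= u n) ->
  a <= limn_einf u.
Proof.
move=> [N _ Nu]; rewrite limn_einf_lim; apply: lime_ge; first exact: is_cvg_einfs.
exists N => // n /= Nn; apply: le_ereal_inf_tmp => _ [k /= nk <-].
by apply: Nu => /=; exact: leq_trans nk.
Qed.

(* Lower semicontinuity along sequences: by Fatou's lemma it survives integration
   in one variable, which keeps every partial iterated integral measurable. *)
Definition slsc (T : Type) (cv : (nat -> T) -> T -> Prop) (F : T -> \bar R) :=
  forall u l, cv u l -> F l <= limn_einf (F \o u).

Definition rcv (u : nat -> R) (l : R) := u @ \oo --> l.

(** On the line sequential and topological lower semicontinuity agree: a failure at [x] is witnessed
    by points within [1/(n+1)] of [x]. *)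
Lemma slsc_measurable (F : R -> \bar R) : slsc rcv F -> measurable_fun setT F.
Proof.
move=> sF; apply: lower_semicontinuous_measurable => x a aF.
apply: contrapT => H.
have {}H n : exists y, (`|y - x| < n.+1%:R^-1)%R /\ F y <= a%:E.
  apply: contrapT => H1; apply: H; exists (ball x (n.+1%:R^-1)).
    by apply: nbhsx_ballx; rewrite invr_gt0.
  move=> y; rewrite /ball/= distrC => yx; rewrite ltNge; apply/negP => Fy.
  by apply: H1; exists y.
have /choice[u uP] := H.
have ux : rcv u x.
  apply/cvgrPdist_lt => e e0.
  have [n0 _ nP] := near_infty_natSinv_lt (PosNum e0).
  exists n0 => // n /= n0n; rewrite distrC.
  by apply: lt_trans (uP n).1 _; exact: nP.
have := sF _ _ ux; rewrite leNgt => /negP; apply.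
by apply: le_lt_trans aF; apply: limn_einf_le => n; exact: (uP n).2.
Qed.

Lemma measurable_limn_einf (F : nat -> R -> \bar R) :
  (forall k, measurable_fun setT (F k)) ->
  measurable_fun setT (fun x => limn_einf (F ^~ x)).
Proof.
move=> mF; rewrite /limn_einf; apply: measurableT_comp => //.
apply: measurable_fun_limn_esup => k; exact: measurableT_comp.
Qed.

Local Notation mu := (@lebesgue_measure R).

Lemma fatou_slsc (F : nat -> R -> \bar R) (G : R -> \bar R) :
  (forall k, slsc rcv (F k)) -> slsc rcv G ->
  (forall k x, 0 <= F k x) -> (forall x, 0 <= G x) ->
  (forall x, G x <= limn_einf (F ^~ x)) ->
  \int[mu]_x G x <= limn_einf (fun k => \int[mu]_x F k x).
Proof.
move=> sF sG F0 G0 GF.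
have mF k := slsc_measurable (sF k).
apply: le_trans (fatou _ _ _ _) => //.
apply: ge0_le_integral => //; first exact: slsc_measurable.
exact: measurable_limn_einf.
Qed.

End LowerSemicontinuity.

(** * Measurability and linearity of iterated integrals *)

Section IteratedIntegral.
Variable R : realType.
Local Notation C := ((R[i])^o).
Local Notation mu := (@lebesgue_measure R).
Local Open Scope ereal_scope.

(** Convergence of real and imaginary parts separately, so that moving one real variable of an
    iterated integral gives a convergent sequence by construction. *)
Definition ccv (u : nat -> C) (l : C) :=
  rcv (fun k => complex.Re (u k)) (complex.Re l) /\
  rcv (fun k => complex.Im (u k)) (complex.Im l).

Definition vcv n (u : nat -> 'rV[C]_n) (l : 'rV[C]_n) :=
  forall j, ccv (fun k => u k ord0 j) (l ord0 j).

Lemma rcv_cst (x : R) : rcv (fun=> x) x. Proof. exact: cvg_cst. Qed.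

Lemma cint_slice_slsc (F : C -> \bar R) : slsc ccv F -> (forall w, 0 <= F w) ->
  (forall x : R, slsc (@rcv R) (fun y => F (x +i* y)%C)) /\
  slsc (@rcv R) (fun x => \int[mu]_y F (x +i* y)%C).
Proof.
move=> sF F0.
have s1 x : slsc (@rcv R) (fun y => F (x +i* y)%C).
  by move=> u l ul; apply: (sF (fun k => (x +i* u k)%C)); split => //=; exact: rcv_cst.
split=> // u l ul; apply: (fatou_slsc (F := fun k y => F (u k +i* y)%C)) => // y.
by apply: (sF (fun k => (u k +i* y)%C)); split => //=; exact: rcv_cst.
Qed.

Lemma fatou_cint (F : nat -> C -> \bar R) (G : C -> \bar R) :
  (forall k, slsc ccv (F k)) -> slsc ccv G ->
  (forall k x, 0 <= F k x) -> (forall x, 0 <= G x) ->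
  (forall x, G x <= limn_einf (F ^~ x)) ->
  cint G <= limn_einf (fun k => cint (F k)).
Proof.
move=> sF sG F0 G0 GF; rewrite /cint.
have [sG1 sG2] := cint_slice_slsc sG G0.
apply: fatou_slsc => //.
- by move=> k; exact: (cint_slice_slsc (sF k) (F0 k)).2.
- by move=> k x; apply: integral_ge0.
- by move=> x; apply: integral_ge0.
- move=> x; apply: fatou_slsc => // k.
  exact: (cint_slice_slsc (sF k) (F0 k)).1.
Qed.

(** Convertible with the argument that the recursion of [cnint] builds. *)
Definition vcons n (w : C) (v : 'rV[C]_n) : 'rV[C]_n.+1 := row_mx (\row_(j < 1) w) v.

Lemma vcons_head n (w : C) (v : 'rV[C]_n) (m : 'I_1) : vcons w v ord0 (lshift n m) = w.
Proof. exact: etrans (row_mxEl _ _ _ _) (mxE _ _ _ _). Qed.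

Lemma vcons_tail n (w : C) (v : 'rV[C]_n) (m : 'I_n) : vcons w v ord0 (rshift 1 m) = v ord0 m.
Proof. exact: row_mxEr. Qed.

Lemma vcv_cons n (u : nat -> C) (v : nat -> 'rV[C]_n) l l' : ccv u l -> vcv v l' ->
  vcv (fun k => vcons (u k) (v k)) (vcons l l').
Proof.
move=> ul vl j; case: (@split_ordP 1 n j) => m ->.
  by rewrite vcons_head; under [X in ccv X]eq_fun do rewrite vcons_head.
by rewrite vcons_tail; under [X in ccv X]eq_fun do rewrite vcons_tail; exact: vl.
Qed.

Lemma vcv_cst n (v : 'rV[C]_n) : vcv (fun=> v) v.
Proof. by move=> j; split; exact: rcv_cst. Qed.

Lemma ccv_cst (w : C) : ccv (fun=> w) w.
Proof. by split; exact: rcv_cst. Qed.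

Lemma cnint_ge0 n (F : 'rV[C]_n -> \bar R) : (forall v, 0 <= F v) -> 0 <= cnint F.
Proof.
elim: n F => [|n IH] F F0 //=.
by apply: integral_ge0 => x _; apply: integral_ge0 => y _; exact: IH.
Qed.

Lemma slsc_sub n (H : 'rV[C]_n.+1 -> \bar R) w :
  slsc (@vcv _) H -> slsc (@vcv n) (fun v => H (vcons w v)).
Proof.
by move=> sH u l ul; apply: (sH (fun k => vcons w (u k))); apply: vcv_cons => //; exact: ccv_cst.
Qed.

(** The induction supplies its own measurability: semicontinuity of the inner integral in the outer
    variable is the same inequality one dimension lower, applied to the slices along a convergent
    sequence. *)
Lemma fatou_cnint n (F : nat -> 'rV[C]_n -> \bar R) (G : 'rV[C]_n -> \bar R) :
  (forall k, slsc (@vcv n) (F k)) -> slsc (@vcv n) G ->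
  (forall k x, 0 <= F k x) -> (forall x, 0 <= G x) ->
  (forall x, G x <= limn_einf (F ^~ x)) ->
  cnint G <= limn_einf (fun k => cnint (F k)).
Proof.
elim: n F G => [|n IH] F G sF sG F0 G0 GF /=; first exact: GF.
have sl (H : 'rV[C]_n.+1 -> \bar R) : slsc (@vcv _) H -> (forall v, 0 <= H v) ->
    slsc ccv (fun w => cnint (fun v => H (vcons w v))).
  move=> sH H0 u l ul; apply: (IH (fun k v => H (vcons (u k) v))) => //.
  - by move=> k; exact: slsc_sub.
  - exact: slsc_sub.
  - by move=> v; apply: (sH (fun k => vcons (u k) v)); apply: vcv_cons => //; exact: vcv_cst.
apply: (fatou_cint (F := fun k w => cnint (fun v => F k (vcons w v)))) => //.
- by move=> k; exact: sl.
- exact: sl.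
- by move=> k w; exact: cnint_ge0.
- by move=> w; exact: cnint_ge0.
- by move=> w; apply: (IH (fun k v => F k (vcons w v))) => // [k|]; exact: slsc_sub.
Qed.

Lemma cnint_slice_slsc n (H : 'rV[C]_n.+1 -> \bar R) :
  slsc (@vcv _) H -> (forall v, 0 <= H v) ->
  slsc ccv (fun w => cnint (fun v => H (vcons w v))).
Proof.
move=> sH H0 u l ul; apply: (fatou_cnint (F := fun k v => H (vcons (u k) v))) => //.
- by move=> k; exact: slsc_sub.
- exact: slsc_sub.
- by move=> v; apply: (sH (fun k => vcons (u k) v)); apply: vcv_cons => //; exact: vcv_cst.
Qed.

Lemma cintD (F G : C -> \bar R) : slsc ccv F -> slsc ccv G ->
  (forall w, 0 <= F w) -> (forall w, 0 <= G w) ->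
  cint (fun w => F w + G w) = cint F + cint G.
Proof.
move=> sF sG F0 G0; have [f1 f2] := cint_slice_slsc sF F0.
have [g1 g2] := cint_slice_slsc sG G0; rewrite /cint.
under eq_integral do (rewrite ge0_integralD//; [|exact: slsc_measurable..]).
rewrite ge0_integralD//.
- by move=> x _; exact: integral_ge0.
- exact: slsc_measurable.
- by move=> x _; exact: integral_ge0.
- exact: slsc_measurable.
Qed.

Lemma cintZ (a : R) (F : C -> \bar R) : slsc ccv F -> (forall w, 0 <= F w) ->
  (0 <= a)%R -> cint (fun w => a%:E * F w) = a%:E * cint F.
Proof.
move=> sF F0 a0; have [f1 f2] := cint_slice_slsc sF F0; rewrite /cint.
under eq_integral do (rewrite ge0_integralZl//; last exact: slsc_measurable).
rewrite ge0_integralZl//; first exact: slsc_measurable.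
by move=> x _; exact: integral_ge0.
Qed.

Lemma le_cint (F G : C -> \bar R) : slsc ccv F -> slsc ccv G ->
  (forall w, 0 <= F w) -> (forall w, F w <= G w) -> cint F <= cint G.
Proof.
move=> sF sG F0 FG; have G0 w : 0 <= G w by exact: le_trans (FG w).
have [f1 f2] := cint_slice_slsc sF F0.
have [g1 g2] := cint_slice_slsc sG G0; rewrite /cint.
apply: ge0_le_integral => //; try exact: slsc_measurable.
  by move=> x _; exact: integral_ge0.
by move=> x _; apply: ge0_le_integral => //; exact: slsc_measurable.
Qed.

Lemma integral_segment_bound (g : R -> \bar R) (M B : R) : (0 <= M)%R -> (0 <= B)%R ->
  measurable_fun setT g -> (forall x, 0 <= g x) -> (forall x, g x <= B%:E) ->
  (forall x, (M < `|x|)%R -> g x = 0) -> \int[mu]_x g x <= (B * (2 * M))%:E.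
Proof.
move=> M0 B0 mg g0 gB gM.
have -> : (B * (2 * M))%:E = \int[mu]_(x in `[(- M)%R, M]) (cst B%:E x).
  rewrite integral_cst//= lebesgue_measure_itv/= lte_fin.
  case: ifPn => [_|]; first by rewrite -EFinD -EFinM; congr EFin; ring.
  by rewrite -leNgt => h; rewrite (_ : M = 0%R) ?mulr0 ?mule0//; lra.
rewrite [leRHS]integral_mkcond; apply: ge0_le_integral => //.
- by apply/(measurable_restrictT _ _).1 => //; exact: measurable_cst.
- move=> x _; rewrite patchE; case: ifPn => [_|/negP xr]; first exact: gB.
  rewrite gM// ltNge; apply/negP => h; apply: xr; rewrite inE/= in_itv/=.
  by rewrite -ler_norml.
Qed.

Definition inbox n (M : R) (v : 'rV[C]_n) := forall j,
  (`|complex.Re (v ord0 j)| <= M)%R /\ (`|complex.Im (v ord0 j)| <= M)%R.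

Lemma cint_bound (F : C -> \bar R) (M B : R) : (0 <= M)%R -> (0 <= B)%R ->
  slsc ccv F -> (forall w, 0 <= F w) -> (forall w, F w <= B%:E) ->
  (forall w, (M < `|complex.Re w|)%R \/ (M < `|complex.Im w|)%R -> F w = 0) ->
  cint F <= (B * (2 * M) ^+ 2)%:E.
Proof.
move=> M0 B0 sF F0 FB FM; have [f1 f2] := cint_slice_slsc sF F0; rewrite /cint.
rewrite expr2 mulrA; apply: integral_segment_bound => //.
- by rewrite mulr_ge0// mulr_ge0.
- exact: slsc_measurable.
- by move=> x; exact: integral_ge0.
- move=> x; apply: integral_segment_bound => //; first exact: slsc_measurable.
  by move=> y My; apply: FM; right.
- by move=> x Mx; apply: integral0_eq => y _; apply: FM; left.
Qed.

Lemma cnint0 n : cnint (fun _ : 'rV[C]_n => 0 : \bar R) = 0.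
Proof.
elim: n => [|n IH] //=; rewrite /cint.
by apply: integral0_eq => x _; apply: integral0_eq => y _; exact: IH.
Qed.

Lemma cnint_bound n (F : 'rV[C]_n -> \bar R) (M B : R) : (0 <= M)%R -> (0 <= B)%R ->
  slsc (@vcv n) F -> (forall v, 0 <= F v) -> (forall v, F v <= B%:E) ->
  (forall v, ~ inbox M v -> F v = 0) ->
  cnint F <= (B * (2 * M) ^+ (2 * n))%:E.
Proof.
move=> M0; elim: n F B => [|n IH] F B B0 sF F0 FB FM /=.
  by rewrite muln0 expr0 mulr1.
rewrite mulnS exprD mulrCA mulrC.
have tail w v : ~ inbox M v -> ~ inbox M (vcons w v).
  by move=> nv h; apply: nv => j; have := h (rshift 1 j); rewrite vcons_tail.
apply: cint_bound => //.
- by rewrite mulr_ge0// exprn_ge0// mulr_ge0.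
- exact: cnint_slice_slsc.
- by move=> w; exact: cnint_ge0.
- move=> w; apply: IH => // [|v nv]; first exact: slsc_sub.
  by apply: FM; exact: tail.
- move=> w wM; rewrite (_ : (fun v => F _) = (fun=> 0)) ?cnint0//.
  apply/funext => v; apply: (FM (vcons w v)) => h.
  have := h (lshift n (ord0 : 'I_1)); rewrite vcons_head.
  by case: wM; rewrite ltNge => /negP + [].
Qed.

Definition rlsc n (f : 'rV[C]_n -> R) := forall u l, vcv u l ->
  forall e, (0 < e)%R -> \forall k \near \oo, (f l - e < f (u k))%R.

Lemma rlsc_slsc n (f : 'rV[C]_n -> R) : rlsc f -> slsc (@vcv n) (EFin \o f).
Proof.
move=> rf u l ul; apply/lee_addgt0Pr => e e0.
rewrite -leeBlDr//; apply: limn_einf_ge.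
have := rf u l ul e e0; apply: filterS => k /= h.
by rewrite -EFinB lee_fin ltW.
Qed.

Lemma cnintD n (f g : 'rV[C]_n -> R) : rlsc f -> rlsc g ->
  (forall v, 0 <= f v)%R -> (forall v, 0 <= g v)%R ->
  cnint (fun v => (f v + g v)%:E) = cnint (EFin \o f) + cnint (EFin \o g).
Proof.
elim: n f g => [|n IH] f g rf rg f0 g0 //=.
have sub (h : 'rV[C]_n.+1 -> R) w : rlsc h -> rlsc (fun v => h (vcons w v)).
  move=> rh u l ul; apply: (rh (fun k => vcons w (u k))).
  by apply: vcv_cons => //; exact: ccv_cst.
transitivity (cint (fun w => cnint (fun v => (f (vcons w v))%:E) +
    cnint (fun v => (g (vcons w v))%:E))).
  by congr cint; apply/funext => w; apply: (IH (fun v => f (vcons w v))) => //; exact: sub.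
rewrite cintD//.
- by apply: (cnint_slice_slsc (H := EFin \o f)); [exact: rlsc_slsc|move=> v; rewrite lee_fin].
- by apply: (cnint_slice_slsc (H := EFin \o g)); [exact: rlsc_slsc|move=> v; rewrite lee_fin].
- by move=> w; apply: cnint_ge0 => v; rewrite lee_fin.
- by move=> w; apply: cnint_ge0 => v; rewrite lee_fin.
Qed.

Lemma rlsc_sub n (h : 'rV[C]_n.+1 -> R) w : rlsc h -> rlsc (fun v => h (vcons w v)).
Proof.
move=> rh u l ul; apply: (rh (fun k => vcons w (u k))).
by apply: vcv_cons => //; exact: ccv_cst.
Qed.

Lemma cnintZ n (a : R) (f : 'rV[C]_n -> R) : rlsc f -> (forall v, 0 <= f v)%R ->
  (0 <= a)%R -> cnint (fun v => (a * f v)%:E) = a%:E * cnint (EFin \o f).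
Proof.
elim: n f => [|n IH] f rf f0 a0 //=.
transitivity (cint (fun w => a%:E * cnint (fun v => (f (vcons w v))%:E))).
  by congr cint; apply/funext => w; apply: (IH (fun v => f (vcons w v))) => //; exact: rlsc_sub.
rewrite cintZ//.
- by apply: (cnint_slice_slsc (H := EFin \o f)); [exact: rlsc_slsc|move=> v; rewrite lee_fin].
- by move=> w; apply: cnint_ge0 => v; rewrite lee_fin.
Qed.

End IteratedIntegral.

(** * Signed integrals of bounded continuous functions over an open set *)

Section SignedIntegral.
Variable R : realType.
Local Notation C := ((R[i])^o).
Variables (n : nat) (Om : set 'rV[C]_n) (M : R).
Hypothesis openOm : forall u l, vcv u l -> Om l -> \forall k \near \oo, Om (u k).
Hypothesis M0 : 0 <= M.
Hypothesis OmM : forall v, Om v -> inbox M v.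

Definition scont (k : 'rV[C]_n -> R) := forall u l, vcv u l -> Om l ->
  (fun i => k (u i)) @ \oo --> k l.

Definition good (k : 'rV[C]_n -> R) := scont k /\ exists2 B, 0 <= B & forall v, Om v -> `|k v| <= B.

Definition pint_on (k : 'rV[C]_n -> R) : R := fine (cnint (fun v => (\1_Om v * k v)%:E)).

(** Continuity is lost at the boundary of [Om], lower semicontinuity is not: off the open set the
    product takes its least possible value 0. *)
Lemma rlsc_indic (k : 'rV[C]_n -> R) : scont k -> (forall v, Om v -> 0 <= k v) ->
  rlsc (fun v => \1_Om v * k v).
Proof.
move=> sk k0 u l ul e e0.
have f0 v : 0 <= \1_Om v * k v.
  by rewrite indicE; case: (boolP (v \in Om)) => [/set_mem/k0|_]; rewrite ?mul1r ?mul0r.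
have [Ol|nOl] := pselect (Om l); last first.
  apply: nearW => i; rewrite {1}indicE memNset// mul0r sub0r.
  by apply: lt_le_trans (f0 _); rewrite oppr_lt0.
have := openOm ul Ol; have /cvgrPdist_lt/(_ _ e0) := sk _ _ ul Ol.
apply: filterS2 => i /= h Oi; rewrite !indicE !mem_set// !mul1r.
by move: h; rewrite ltr_norml; lra.
Qed.

Lemma indic_mul_ge0 (k : 'rV[C]_n -> R) v : (forall v, Om v -> 0 <= k v) -> 0 <= \1_Om v * k v.
Proof.
by move=> k0; rewrite indicE; case: (boolP (v \in Om)) => [/set_mem/k0|_]; rewrite ?mul1r ?mul0r.
Qed.

Definition vol : R := (2 * M) ^+ (2 * n).

Lemma vol_ge0 : 0 <= vol.
Proof. by rewrite exprn_ge0// mulr_ge0. Qed.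

Lemma cnint_indic_bound (k : 'rV[C]_n -> R) B : scont k -> 0 <= B ->
  (forall v, Om v -> 0 <= k v <= B) ->
  (0 <= cnint (fun v => (\1_Om v * k v)%:E) <= (B * vol)%:E)%E.
Proof.
move=> sk B0 kB; have k0 v : Om v -> 0 <= k v by move=> /kB/andP[].
apply/andP; split; first by apply: cnint_ge0 => v; rewrite lee_fin indic_mul_ge0.
apply: cnint_bound => //.
- exact: (rlsc_slsc (rlsc_indic sk k0)).
- by move=> v; rewrite lee_fin indic_mul_ge0.
- move=> v; rewrite lee_fin indicE; case: (boolP (v \in Om)) => [/set_mem/kB/andP[_]|_].
    by rewrite mul1r.
  by rewrite mul0r.
- by move=> v nv; rewrite indicE memNset ?mul0r// => /OmM.
Qed.

Lemma pint_onE (k : 'rV[C]_n -> R) : good k -> (forall v, Om v -> 0 <= k v) ->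
  (pint_on k)%:E = cnint (fun v => (\1_Om v * k v)%:E).
Proof.
move=> [sk [B B0 kB]] k0; rewrite fineK//.
have /andP[h1 h2] : (0 <= cnint (fun v => (\1_Om v * k v)%:E) <= (B * vol)%:E)%E.
  by apply: cnint_indic_bound => // v Ov; rewrite k0//= (le_trans (ler_norm _))// kB.
by rewrite ge0_fin_numE// (le_lt_trans h2)// ltry.
Qed.

Lemma pint_on_bound (k : 'rV[C]_n -> R) B : scont k -> 0 <= B ->
  (forall v, Om v -> 0 <= k v <= B) -> 0 <= pint_on k <= B * vol.
Proof.
move=> sk B0 kB; have := cnint_indic_bound sk B0 kB; rewrite -pint_onE ?lee_fin//.
  split=> //; exists B => // v /kB/andP[h1 h2]; by rewrite ger0_norm.
by move=> v /kB/andP[].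
Qed.

Lemma goodD k l : good k -> good l -> good (fun v => k v + l v).
Proof.
move=> [sk [B B0 kB]] [sl [B' B0' lB]]; split.
  by move=> u v uv Ov; apply: cvgD; [exact: sk|exact: sl].
exists (B + B'); first by rewrite addr_ge0.
by move=> v Ov; rewrite (le_trans (ler_normD _ _))// lerD ?kB ?lB.
Qed.

Lemma goodZ (a : R) k : good k -> good (fun v => a * k v).
Proof.
move=> [sk [B B0 kB]]; split.
  by move=> u v uv Ov; apply: cvgM; [exact: cvg_cst|exact: sk].
exists (`|a| * B); first by rewrite mulr_ge0.
by move=> v Ov; rewrite normrM ler_wpM2l// kB.
Qed.

Lemma good_cst (a : R) : good (fun=> a).
Proof. by split; [move=> u v _ _; exact: cvg_cst|exists `|a|]. Qed.

Lemma pint_onD k l : good k -> good l -> (forall v, Om v -> 0 <= k v) ->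
  (forall v, Om v -> 0 <= l v) -> pint_on (fun v => k v + l v) = pint_on k + pint_on l.
Proof.
move=> gk gl k0 l0; apply: EFin_inj; rewrite EFinD !pint_onE//.
- rewrite -cnintD; first by congr cnint; apply/funext => v; congr EFin; ring.
  + by apply: rlsc_indic => //; case: gk.
  + by apply: rlsc_indic => //; case: gl.
  + by move=> v; exact: indic_mul_ge0.
  + by move=> v; exact: indic_mul_ge0.
- exact: goodD.
- by move=> v Ov; rewrite addr_ge0 ?k0 ?l0.
Qed.

Lemma pint_onZ (a : R) k : good k -> 0 <= a -> (forall v, Om v -> 0 <= k v) ->
  pint_on (fun v => a * k v) = a * pint_on k.
Proof.
move=> gk a0 k0; apply: EFin_inj; rewrite EFinM !pint_onE//.
- rewrite -cnintZ//; first by congr cnint; apply/funext => v; congr EFin; ring.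
  + by apply: rlsc_indic => //; case: gk.
  + by move=> v; exact: indic_mul_ge0.
- exact: goodZ.
- by move=> v Ov; rewrite mulr_ge0 ?k0.
Qed.

Lemma eq_pint_on k l : (forall v, Om v -> k v = l v) -> pint_on k = pint_on l.
Proof.
move=> kl; congr (fine (cnint _)); apply/funext => v; congr EFin.
by rewrite indicE; case: (boolP (v \in Om)) => [/set_mem/kl ->//|_]; rewrite !mul0r.
Qed.

(* Signed integral over Om: adding a large constant makes integrands nonnegative. *)
Definition sint (k : 'rV[C]_n -> R) : R :=
  pint_on (fun v => `|k v| + k v) - pint_on (fun v => `|k v|).

Lemma good_norm k : good k -> good (fun v => `|k v|).
Proof.
move=> [sk [B B0 kB]]; split.
  by move=> u v uv Ov; apply: cvg_norm; exact: sk.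
by exists B => // v Ov; rewrite normr_id kB.
Qed.

(** The value does not depend on the decomposition into a difference of nonnegative functions;
    linearity thus reduces to additivity of [pint_on]. *)
Lemma sintE p q k : good p -> good q -> good k -> (forall v, Om v -> 0 <= p v) ->
  (forall v, Om v -> 0 <= q v) -> (forall v, Om v -> k v = p v - q v) ->
  sint k = pint_on p - pint_on q.
Proof.
move=> gp gq gk p0 q0 kpq; have gn := good_norm gk.
have kk0 v : Om v -> 0 <= `|k v| + k v.
  by move=> _; have := ler_norm (- k v); rewrite normrN; lra.
apply/eqP; rewrite subr_eq addrAC eq_sym subr_eq eq_sym; apply/eqP.
rewrite -!pint_onD//; last exact: goodD.
by apply: eq_pint_on => v /kpq ->; ring.
Qed.

Lemma sint_ge0 k : good k -> (forall v, Om v -> 0 <= k v) -> sint k = pint_on k.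
Proof.
move=> gk k0; rewrite (@sintE k (fun=> 0))//.
- rewrite (_ : pint_on (fun=> 0) = 0) ?subr0//.
  rewrite /pint_on (_ : (fun v => _) = (fun=> 0%E)) ?cnint0//.
  by apply/funext => v; rewrite mulr0.
- exact: good_cst.
- by move=> v Ov; rewrite subr0.
Qed.

Let pp (k : 'rV[C]_n -> R) := fun v => `|k v| + k v.
Let good_pp k : good k -> good (pp k).
Proof. by move=> gk; apply: goodD => //; exact: good_norm. Qed.
Let pp_ge0 k v : Om v -> 0 <= pp k v.
Proof. by move=> _; have := ler_norm (- k v); rewrite normrN /pp; lra. Qed.

Lemma sintD k l : good k -> good l -> sint (fun v => k v + l v) = sint k + sint l.
Proof.
move=> gk gl; have gkl := goodD gk gl.
rewrite (@sintE (fun v => pp k v + pp l v) (fun v => `|k v| + `|l v|))//.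
- rewrite (pint_onD (good_pp gk) (good_pp gl) (@pp_ge0 k) (@pp_ge0 l)).
  by rewrite (pint_onD (good_norm gk) (good_norm gl))// /sint /pp; ring.
- by apply: goodD; exact: good_pp.
- by apply: goodD; exact: good_norm.
- by move=> v Ov; rewrite addr_ge0// pp_ge0.
- by move=> v _; rewrite /pp; ring.
Qed.

Lemma sintN k : good k -> sint (fun v => - k v) = - sint k.
Proof.
move=> gk; have gk' : good (fun v => - k v).
  have := goodZ (-1) gk.
  by rewrite (_ : (fun v => -1 * k v) = (fun v => - k v))//; apply/funext => v; rewrite mulN1r.
rewrite (@sintE (fun v => `|k v|) (pp k))//.
- by rewrite /sint /pp; ring.
- exact: good_norm.
- exact: good_pp.
- exact: pp_ge0.
- by move=> v _; rewrite /pp; ring.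
Qed.

Lemma sintZ (a : R) k : good k -> sint (fun v => a * k v) = a * sint k.
Proof.
have pos (b : R) l : 0 <= b -> good l -> sint (fun v => b * l v) = b * sint l.
  move=> b0 gl; rewrite (@sintE (fun v => b * pp l v) (fun v => b * `|l v|)).
  - rewrite (pint_onZ (good_pp gl) b0 (@pp_ge0 l)) (pint_onZ (good_norm gl) b0)//.
    by rewrite /sint /pp; ring.
  - by apply: goodZ; exact: good_pp.
  - by apply: goodZ; exact: good_norm.
  - exact: goodZ.
  - by move=> v Ov; rewrite mulr_ge0// pp_ge0.
  - by move=> v Ov; rewrite mulr_ge0.
  - by move=> v _; rewrite /pp; ring.
move=> gk; have [a0|a0] := leP 0 a; first exact: pos.
rewrite (_ : (fun v => a * k v) = (fun v => - (- a * k v))); last first.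
  by apply/funext => v; ring.
rewrite sintN; last exact: goodZ.
by rewrite pos//; [ring|lra].
Qed.

Lemma sint_bound k B : good k -> 0 <= B -> (forall v, Om v -> `|k v| <= B) ->
  `|sint k| <= 2 * B * vol.
Proof.
move=> gk B0 kB; have [sp _] := good_pp gk; have [sn _] := good_norm gk.
have := @pint_on_bound _ (2 * B) sp _ _; rewrite -/(pp k) => h1.
have := @pint_on_bound _ B sn B0 _ => h2.
have {}h1 : 0 <= pint_on (pp k) <= 2 * B * vol.
  apply: h1 => [|v Ov]; first by rewrite mulr_ge0.
  by rewrite pp_ge0//= /pp; have := kB v Ov; have := ler_norm (k v); lra.
have {}h2 : 0 <= pint_on (fun v => `|k v|) <= B * vol.
  by apply: h2 => v Ov; rewrite normr_ge0 kB.
have := mulr_ge0 B0 vol_ge0.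
by rewrite /sint ler_norml -/(pp k); lra.
Qed.

End SignedIntegral.

(** * Smoothness of the fibre integral *)

Section Encoding.
Variable R : realType.
Variable n : nat.
Local Notation C := ((R[i])^o).
Local Notation N := (1 + n + (1 + n))%N.

(** Inverse of [cpt]: all real parts come before all imaginary parts, with the base variable leading
    each block. *)
Definition enc (x y : R) (z : 'rV[C]_n) : 'rV[R]_N :=
  row_mx (row_mx (\row_(j < 1) x) (\row_j complex.Re (z ord0 j)))
         (row_mx (\row_(j < 1) y) (\row_j complex.Im (z ord0 j))).

(** [e1] and [e2] are the directions of the real and the imaginary part of [tau]. *)
Definition e1 : 'rV[R]_N := row_mx (row_mx (\row_(j < 1) 1) 0) 0.
Definition e2 : 'rV[R]_N := row_mx 0 (row_mx (\row_(j < 1) 1) 0).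

Lemma enc_shift x y h k z : enc (x + h) (y + k) z = enc x y z + h *: e1 + k *: e2.
Proof.
rewrite /enc /e1 /e2 !(scale_row_mx, add_row_mx, scaler0, addr0).
by congr row_mx; congr row_mx; apply/rowP => j; rewrite !mxE mulr1.
Qed.

Lemma tau_enc x y z : tau_of (cpt (enc x y z)) = (x +i* y)%C.
Proof. by rewrite /tau_of /cpt /enc mxE row_mxKl row_mxKr !row_mxEl !mxE. Qed.

Lemma z_enc x y z : z_of (cpt (enc x y z)) = z.
Proof.
rewrite /z_of /cpt /enc; apply/rowP => j; rewrite mxE mxE row_mxKl row_mxKr !row_mxEr !mxE.
by case: (z ord0 j).
Qed.

Lemma cpt_surj v : v = enc (complex.Re (tau_of (cpt v))) (complex.Im (tau_of (cpt v))) (z_of (cpt v)).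
Proof.
rewrite /enc -[LHS]hsubmxK; congr row_mx.
  rewrite -[LHS]hsubmxK; congr row_mx; apply/rowP => j; rewrite !mxE /=.
    by rewrite (ord1 j) /tau_of /cpt !mxE /= ?mxE.
  by rewrite ?mxE.
rewrite -[LHS]hsubmxK; congr row_mx; apply/rowP => j; rewrite !mxE /=.
  by rewrite (ord1 j) /tau_of /cpt !mxE /= ?mxE.
by rewrite ?mxE.
Qed.

Lemma rV_cvg m (u : nat -> 'rV[R]_m) (l : 'rV[R]_m) :
  (forall j, (fun k => u k ord0 j) @ \oo --> l ord0 j) -> u @ \oo --> l.
Proof.
move=> ul; apply/cvg_ballP => e e0.
have : \forall k \near \oo, forall j, ball (l ord0 j) e (u k ord0 j).
  apply: filter_forall => j; have /cvg_ballP/(_ _ e0) := ul j; exact.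
by apply: filterS => k H; split => // i j; rewrite (ord1 i).
Qed.

Lemma enc_cvg x y (u : nat -> 'rV[C]_n) l : vcv u l ->
  (fun k => enc x y (u k)) @ \oo --> enc x y l.
Proof.
move=> ul; apply: rV_cvg => j; rewrite /enc.
case: (split_ordP j) => m ->.
  rewrite row_mxEl; under [X in X @ _]eq_fun do rewrite row_mxEl.
  case: (split_ordP m) => i ->.
    rewrite row_mxEl mxE; under [X in X @ _]eq_fun do rewrite row_mxEl mxE.
    exact: cvg_cst.
  rewrite row_mxEr mxE; under [X in X @ _]eq_fun do rewrite row_mxEr mxE.
  exact: (ul i).1.
rewrite row_mxEr; under [X in X @ _]eq_fun do rewrite row_mxEr.
case: (split_ordP m) => i ->.
  rewrite row_mxEl mxE; under [X in X @ _]eq_fun do rewrite row_mxEl mxE.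
  exact: cvg_cst.
rewrite row_mxEr mxE; under [X in X @ _]eq_fun do rewrite row_mxEr mxE.
exact: (ul i).2.
Qed.

End Encoding.

(** * The topology of the complex plane in real terms *)

Section ComplexTopology.
Variable R : realType.
Local Notation C := ((R[i])^o).

Lemma normCE (z : C) : `|z| = ((cabs z)%:C)%C.
Proof. by []. Qed.

Lemma normC_lt (z : C) (e : R) : (`|z| < (e%:C)%C) = (cabs z < e).
Proof. by rewrite normCE ltcR. Qed.

Lemma cabsE (z : C) : cabs z = Num.sqrt (complex.Re z ^+ 2 + complex.Im z ^+ 2).
Proof. by case: z. Qed.

(** Radii of balls over [R[i]] are themselves complex numbers; positivity forces them to be real. *)
Lemma posC_real (e : R[i]) : 0 < e -> exists2 d : R, 0 < d & e = (d%:C)%C.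
Proof.
case: e => a b; rewrite ltcE /= => /andP[/eqP b0 a0]; exists a => //.
by rewrite b0.
Qed.

Lemma cabs_ge0 (z : C) : 0 <= cabs z.
Proof. by rewrite cabsE sqrtr_ge0. Qed.

Lemma sqr_cabs (z : C) : cabs z ^+ 2 = complex.Re z ^+ 2 + complex.Im z ^+ 2.
Proof. by rewrite cabsE sqr_sqrtr// addr_ge0 ?sqr_ge0. Qed.

Lemma cabs_lt (z : C) (e : R) : 0 < e -> `|complex.Re z| < e / 2 -> `|complex.Im z| < e / 2 ->
  cabs z < e.
Proof.
move=> e0 h1 h2; rewrite -ltr_sqr ?nnegrE ?cabs_ge0 ?(ltW e0)// sqr_cabs.
rewrite -(real_normK (num_real (complex.Re z))) -(real_normK (num_real (complex.Im z))).
have := normr_ge0 (complex.Re z); have := normr_ge0 (complex.Im z).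
move: `|complex.Re z| `|complex.Im z| h1 h2 => u v h1 h2 v0 u0.
have : u ^+ 2 <= (e / 2) ^+ 2 by rewrite ler_sqr ?nnegrE; lra.
have : v ^+ 2 <= (e / 2) ^+ 2 by rewrite ler_sqr ?nnegrE; lra.
have : 0 < e ^+ 2 by rewrite exprn_gt0.
by rewrite expr_div_n; lra.
Qed.

Lemma Re_le_cabs (z : C) : `|complex.Re z| <= cabs z.
Proof.
rewrite -ler_sqr ?nnegrE ?cabs_ge0// real_normK ?num_real// sqr_cabs.
by rewrite lerDl sqr_ge0.
Qed.

Lemma Im_le_cabs (z : C) : `|complex.Im z| <= cabs z.
Proof.
rewrite -ler_sqr ?nnegrE ?cabs_ge0// real_normK ?num_real// sqr_cabs.
by rewrite lerDr sqr_ge0.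
Qed.

Lemma ReB (z w : C) : complex.Re (z - w) = complex.Re z - complex.Re w.
Proof. by case: z w => a b [a' b']. Qed.

Lemma ImB (z w : C) : complex.Im (z - w) = complex.Im z - complex.Im w.
Proof. by case: z w => a b [a' b']. Qed.

Lemma ballC (z w : C) (e : R) : ball z (e%:C)%C w = (cabs (z - w) < e) :> Prop.
Proof. by rewrite /ball/= normC_lt. Qed.

Lemma open_seq n (Om : set 'rV[C]_n) : open Om ->
  forall u l, vcv u l -> Om l -> \forall k \near \oo, Om (u k).
Proof.
move=> oOm u l ul Ol.
have /nbhs_ballP[e /= e0 eOm] := open_nbhs_nbhs (conj oOm Ol).
have [d d0 de] := posC_real e0.
have d20 : 0 < d / 2 by rewrite divr_gt0.
have : \forall k \near \oo, forall j, ball (l ord0 j) e (u k ord0 j).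
  apply: filter_forall => j; rewrite de.
  have [/cvgrPdist_lt/(_ _ d20) h1 /cvgrPdist_lt/(_ _ d20) h2] := ul j.
  apply: filterS2 h1 h2 => k h1 h2; rewrite ballC; apply: cabs_lt => //.
    by rewrite ReB.
  by rewrite ImB.
apply: filterS => k H; apply: eOm; split => // i j; rewrite (ord1 i).
exact: H.
Qed.

Lemma open_plane (U : set C) p : open U -> U (p.1 +i* p.2)%C ->
  \forall q \near p, U (q.1 +i* q.2)%C.
Proof.
move=> oU Up; have /nbhs_ballP[e /= e0 eU] := open_nbhs_nbhs (conj oU Up).
have [d d0 de] := posC_real e0; have d20 : 0 < d / 2 by rewrite divr_gt0.
apply/nbhs_ballP; exists (d / 2) => //= q [q1 q2]; apply: eU.
by rewrite de ballC; apply: cabs_lt => //; rewrite ?ReB ?ImB.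
Qed.

Lemma boundedC (U : set C) : bounded_set U ->
  exists2 M : R, 0 <= M & forall z, U z -> cabs z <= M.
Proof.
move=> [B [Br BP]].
have [b bB] : exists b : R, B <= (b%:C)%C.
  by move: Br; rewrite realE => /orP[B0|B0]; [exists (complex.Re B)|exists 0] => //;
    case: B B0 {BP} => x y; rewrite !lecE /= => /andP[/eqP <- ?]; rewrite eqxx /=.
have := BP ((b + `|b| + 1)%:C)%C; have b0 := ler_norm (- b); rewrite normrN in b0.
move=> H; exists (b + `|b| + 1); first by lra.
move=> z Uz; rewrite -lecR -normCE; apply: H => //.
apply: le_lt_trans bB _; rewrite ltcR.
by have := normr_ge0 b; lra.
Qed.

Lemma bounded_rVC n (Om : set 'rV[C]_n) : bounded_set Om ->
  exists2 M : R, 0 <= M & forall v, Om v -> inbox M v.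
Proof.
move=> [B [Br BP]].
have [b bB] : exists b : R, B <= (b%:C)%C.
  by move: Br; rewrite realE => /orP[B0|B0]; [exists (complex.Re B)|exists 0] => //;
    case: B B0 {BP} => x y; rewrite !lecE /= => /andP[/eqP <- ?]; rewrite eqxx /=.
have H := BP ((b + `|b| + 1)%:C)%C; have b0 := ler_norm (- b); rewrite normrN in b0.
exists (b + `|b| + 2); first by lra.
move=> v Ov.
have vb : `|v| <= ((b + `|b| + 1)%:C)%C.
  apply: H => //; apply: le_lt_trans bB _; rewrite ltcR.
  by have := normr_ge0 b; lra.
have : ball (0 : 'rV[C]_n) ((b + `|b| + 2)%:C)%C v.
  rewrite -ball_normE /ball_ /= sub0r normrN.
  by apply: le_lt_trans vb _; rewrite ltcR; lra.
move=> [_ vB] j; have := vB ord0 j; rewrite mxE ballC sub0r => /ltW h.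
have h1 := Re_le_cabs (- v ord0 j); have h2 := Im_le_cabs (- v ord0 j).
have e (z : C) : `|complex.Re (- z)| = `|complex.Re z| /\ `|complex.Im (- z)| = `|complex.Im z|.
  by case: z => x y /=; rewrite !normrN.
rewrite (e _).1 in h1; rewrite (e _).2 in h2.
by split; [exact: le_trans h1 h|exact: le_trans h2 h].
Qed.

End ComplexTopology.

Section DerivativesAlongLines.
Variables (R : realType) (V : normedModType R).
Implicit Types (K : V -> R) (v e : V).

(** Directional derivatives become derivatives of one real variable, where the calculus rules above
    apply. *)
Lemma is_derive_lineP K v e (d : R) :
  is_derive v e K d <-> is_derive (0 : R) 1 (fun t => K (v + t *: e)) d.
Proof.
have E : (fun t : R => t^-1 *: ((K \o shift v) (t *: e) - K v)) =
    (fun t : R => t^-1 *: (((fun t => K (v + t *: e)) \o shift 0) (t *: 1) -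
      (fun t => K (v + t *: e)) 0)).
  apply/funext => t /=; rewrite scale0r !addr0 [t *: 1]mulr1.
  by rewrite [in LHS](addrC (t *: e)).
by split=> -[d1 d2]; split; move: d1 d2; rewrite /derivable /derive E.
Qed.

Lemma is_derive_line K v e (d s h : R) :
  is_derive (v + (s * h) *: e) e K d ->
  is_derive s 1 (fun t => K (v + (t * h) *: e)) (d * h).
Proof.
move=> /is_derive_lineP d0.
have d1 : is_derive ((s - s) * h) 1 (fun t => K (v + (s * h) *: e + t *: e)) d by rewrite subrr mul0r.
have dl : is_derive s 1 (fun t : R => (t - s) * h) h by der; ring.
have := der_comp (f := fun t : R => (t - s) * h) d1 dl.
by under eq_fun do rewrite -addrA -scalerDl -mulrDl [s + _]addrC subrK.
Qed.

Lemma is_derive_mul K L v e (a b : R) : is_derive v e K a -> is_derive v e L b ->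
  is_derive v e (fun x => K x * L x) (a * L v + K v * b).
Proof.
move=> /is_derive_lineP da /is_derive_lineP db; apply/is_derive_lineP.
have := derM da db; rewrite scale0r addr0; exact.
Qed.

Lemma is_derive_expN K v e (a : R) : is_derive v e K a ->
  is_derive v e (fun x => expR (- K x)) (- a * expR (- K v)).
Proof.
move=> /is_derive_lineP da; apply/is_derive_lineP.
have := der_comp (is_derive_expR _) (derN da); rewrite scale0r addr0 mulrC; exact.
Qed.

End DerivativesAlongLines.

(** * Differentiation under the integral sign *)

Section DifferentiationUnderTheIntegral.
Variable R : realType.
Variable n : nat.
Local Notation C := ((R[i])^o).
Local Notation N := (1 + n + (1 + n))%N.
Variables (U : set C) (Om : set 'rV[C]_n) (W : set 'rV[R]_N) (M : R).
Hypotheses (openU : open U) (bU : bounded_set U) (openOm : open Om).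
Hypotheses (M0 : 0 <= M) (OmM : forall v, Om v -> inbox M v) (openW : open W).
Let UO := [set v : 'rV[R]_N | U (tau_of (cpt v)) /\ Om (z_of (cpt v))].
Hypothesis UOW : closure UO `<=` W.

Let UO_enc x y z : U (x +i* y)%C -> Om z -> closure UO (enc x y z).
Proof. by move=> Ut Oz; apply: subset_closure; rewrite /UO /= tau_enc z_enc. Qed.

Let enc_W x y z : U (x +i* y)%C -> Om z -> W (enc x y z).
Proof. by move=> Ut Oz; apply: UOW; exact: UO_enc. Qed.

Let compact_UO : compact (closure UO).
Proof.
apply: bounded_closed_compact; last exact: closed_closure.
have [B B0 UB] := boundedC bU.
have box : closure UO `<=` [set v | `|v| <= Num.max M B].
  have clB : closed [set v : 'rV[R]_N | `|v| <= Num.max M B].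
    rewrite (_ : mkset _ = (fun v : 'rV[R]_N => `|v|) @^-1` [set x | x <= Num.max M B])//.
    by apply: closed_comp => [v _|]; [exact: norm_continuous|exact: closed_le].
  have /closure_id -> := clB.
  apply: closure_subset => v [Ut Oz] /=.
  rewrite [v]cpt_surj.
  rewrite /Num.norm /= mx_normrE; apply/bigmax_leP; split; first by rewrite le_max B0 orbT.
  move=> [i j] _ /=; rewrite (ord1 i) /enc.
  case: (split_ordP j) => m ->; rewrite ?row_mxEl ?row_mxEr;
    case: (split_ordP m) => l ->; rewrite ?row_mxEl ?row_mxEr mxE le_max.
  - by rewrite (le_trans (Re_le_cabs _) (UB _ Ut)) orbT.
  - by rewrite (OmM Oz l).1.
  - by rewrite (le_trans (Im_le_cabs _) (UB _ Ut)) orbT.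
  - by rewrite (OmM Oz l).2.
exists (Num.max M B); split; first exact: num_real.
by move=> x Bx v /box /= vB; rewrite (le_trans vB)// ltW.
Qed.

Definition contW (K : 'rV[R]_N -> R) := forall v, W v -> {for v, continuous K}.

Let bounded_UO K : contW K -> exists2 B, 0 <= B & forall v, closure UO v -> `|K v| <= B.
Proof.
move=> cK; have cW : {within closure UO, continuous K}.
  by apply: continuous_in_subspaceT => p /set_mem /UOW; exact: cK.
have /compact_bounded[B [Br BP]] := continuous_compact cW compact_UO.
exists (`|B| + 1); first by rewrite addr_ge0.
move=> v Kv; apply: (BP (`|B| + 1)); last by exists v.
by rewrite ltr_pwDr// ler_norm.
Qed.

Let sh (q : R * R) (v : 'rV[R]_N) := v + q.1 *: @e1 R n + q.2 *: @e2 R n.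

Let csh (v : 'rV[R]_N) :
  (fun z : 'rV[R]_N * (R * R) => sh z.2 z.1) @ (v, (0 : R, 0 : R)) --> v.
Proof.
rewrite -[X in _ --> X](_ : sh (0, 0) v = v); last by rewrite /sh !scale0r !addr0.
apply: cvgD; first apply: cvgD; first exact: cvg_fst.
  apply: cvgZr_tmp; apply: cvg_comp; [exact: cvg_snd|exact: cvg_fst].
by apply: cvgZr_tmp; apply: cvg_comp; [exact: cvg_snd|exact: cvg_snd].
Qed.

(** Compactness of [closure UO] inside the open set [W] makes both the modulus of continuity and the
    room left in [W] uniform over the fibres. Smoothness up to the boundary enters here. *)
Lemma uniform_UO K (e : R) : contW K -> 0 < e -> exists2 d : R, 0 < d &
  forall v h k, closure UO v -> `|h| < d -> `|k| < d ->
    W (v + h *: @e1 R n + k *: @e2 R n) /\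
    `|K (v + h *: @e1 R n + k *: @e2 R n) - K v| < e.
Proof.
move=> cK e0; have e20 : 0 < e / 2 by rewrite divr_gt0.
have /compact_near_coveringP near_UO := compact_UO.
have := near_UO _ (nbhs ((0, 0) : R * R)) (fun q v => W (sh q v) /\ `|K (sh q v) - K v| < e) _.
case.
  move=> v UOv.
  have Wv := UOW UOv.
  have nW : \forall x \near v, W x by exact: open_nbhs_nbhs.
  have nK : \forall x \near v, `|K v - K x| < e / 2.
    by have /cvgrPdist_lt/(_ _ e20) := cK v Wv.
  have n1 : \forall z \near (v, (0, 0) : R * R), W (sh z.2 z.1) /\ `|K v - K (sh z.2 z.1)| < e / 2.
    by have := csh (filterI nW nK); exact.
  have n2 : \forall z \near (v, (0, 0) : R * R), `|K v - K z.1| < e / 2.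
    by have := cvg_fst (F := nbhs v) (G := nbhs ((0, 0) : R * R)) nK; exact.
  apply: filterS2 n1 n2 => -[x q] [W1 h1] h2 /=; split => //.
  by have := ler_normD (K (sh q x) - K v) (K v - K x);
    rewrite (distrC (K (sh q x))) addrA subrK (distrC (K v)) in h1 *;
    rewrite /= (distrC _ (K x)) in h2 *; lra.
move=> [A B] [/= /nbhs_ballP[a /= a0 aA] /nbhs_ballP[b /= b0 bB]] AB.
exists (Num.min a b); first by rewrite lt_min a0.
move=> v h k UOv; rewrite !lt_min => /andP[h1 _] /andP[_ k1].
apply: (AB (h, k)) => //; split => /=; [apply: aA|apply: bB];
  by rewrite -ball_normE /ball_ /= sub0r normrN.
Qed.

Definition fam (K : 'rV[R]_N -> R) (p : R * R) (z : 'rV[C]_n) : R := K (enc p.1 p.2 z).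

Let opOm := open_seq openOm.

Lemma fam_good K p : contW K -> U (p.1 +i* p.2)%C -> good Om (fam K p).
Proof.
move=> cK Up; split.
  move=> u l ul Ol; exact: cvg_comp (enc_cvg ul) (cK _ (enc_W Up Ol)).
have [B B0 KB] := bounded_UO cK.
by exists B => // v Ov; apply: KB; exact: UO_enc.
Qed.

Let S (K : 'rV[R]_N -> R) (p : R * R) : R := sint Om (fam K p).

Let vl := vol n M.

Let small (e : R) : 0 < e -> exists2 b : R, 0 < b & 2 * b * vl <= e.
Proof.
move=> e0; have v0 : 0 <= vl by exact: vol_ge0.
have v1 : 0 < 2 * (vl + 1) by lra.
exists (e / (2 * (vl + 1))); first by rewrite divr_gt0.
have -> : 2 * (e / (2 * (vl + 1))) * vl = e * vl / (vl + 1) by field; rewrite lt0r_neq0//; lra.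
by rewrite ler_pdivrMr ?ltr_wpDl// mulrDr mulr1 lerDl ltW.
Qed.

Lemma sint_fam_cont K p : contW K -> U (p.1 +i* p.2)%C -> {for p, continuous (fun q => sint Om (fam K q))}.
Proof.
move=> cK Up; apply/cvgrPdist_le => /= e e0.
have [b b0 be] := small e0.
have [d d0 dK] := uniform_UO cK b0.
have nd : \forall q \near p, `|q.1 - p.1| < d /\ `|q.2 - p.2| < d.
  apply/nbhs_ballP; exists d => //= q [q1 q2].
  by split; rewrite distrC.
apply: filterS2 nd (open_plane openU Up) => q [q1 q2] Uq.
have gp := fam_good cK Up; have gq := fam_good cK Uq.
have gN : good Om (fun v => - fam K q v).
  by have := goodZ (-1) gq; under [X in good _ X]eq_fun do rewrite mulN1r.
rewrite /S -(sintN opOm M0 OmM gq) -(sintD opOm M0 OmM gp gN).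
apply: le_trans be; apply: (sint_bound opOm M0 OmM); [exact: goodD|exact: ltW|].
move=> v Ov; apply/ltW.
have [_] := dK (enc p.1 p.2 v) (q.1 - p.1) (q.2 - p.2) (UO_enc Up Ov) q1 q2.
by rewrite -enc_shift !subrKC distrC.
Qed.

(** Both coordinate directions at once. On each fibre the mean value theorem turns the first-order
    error into [h] times an increment of [K1]; [uniform_UO] makes that increment small uniformly in
    [z], so the crude bound of [sint] suffices. *)
Let sint_fam_eps K K1 p (a b : R) : contW K -> contW K1 -> U (p.1 +i* p.2)%C ->
  `|a| <= 1 -> `|b| <= 1 ->
  (forall v, W v -> is_derive v (a *: @e1 R n + b *: @e2 R n) K (K1 v)) ->
  forall e, 0 < e -> exists2 t, 0 < t & forall h, `|h| < t ->
    `|S K (p.1 + h * a, p.2 + h * b) - S K p - S K1 p * h| <= e * `|h|.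
Proof.
move=> cK cK1 Up a1 b1 dK e e0.
have [c c0 ce] := small e0.
have [d d0 dK1] := uniform_UO cK1 c0.
have /nbhs_ballP[t /= t0 tU] := open_plane openU Up.
exists (Num.min d t) => [|h]; first by rewrite lt_min d0.
rewrite lt_min => /andP[hd ht].
have sm (u x : R) : `|u| <= 1 -> `|x| <= 1 -> `|u * h * x| <= `|h|.
  move=> u1 x1; rewrite !normrM mulrAC -[leRHS]mul1r ler_wpM2r//.
  by rewrite -[1]mulr1 ler_pM.
have hx x : `|x| <= 1 -> `|h * x| <= `|h|.
  by move=> x1; have := @sm 1 x; rewrite mul1r normr1 => /(_ (lexx _) x1).
have Uq : U ((p.1 + h * a) +i* (p.2 + h * b))%C.
  apply: (tU (_, _)); split; rewrite -ball_normE /ball_ /= opprD addrA subrr sub0r normrN;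
    by apply: le_lt_trans ht; apply: hx.
have gp := fam_good cK Up; have gq := @fam_good K (p.1 + h * a, p.2 + h * b) cK Uq.
have g1 := fam_good cK1 Up.
have gN := goodZ (-1) gp; have gN1 := goodZ (- h) g1.
have -> : S K (p.1 + h * a, p.2 + h * b) - S K p - S K1 p * h =
  sint Om (fun v => fam K (p.1 + h * a, p.2 + h * b) v + -1 * fam K p v + - h * fam K1 p v).
  rewrite (sintD opOm M0 OmM _ gN1); last exact: goodD.
  rewrite (sintD opOm M0 OmM gq gN) !(sintZ opOm M0 OmM)// /S; ring.
have cch : 2 * (c * `|h|) * vl <= e * `|h|.
  by rewrite mulrA mulrAC ler_wpM2r.
apply: le_trans cch; apply: (sint_bound opOm M0 OmM).
- by apply: goodD => //; exact: goodD.
- by rewrite mulr_ge0// ltW.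
move=> v Ov; rewrite /fam /=.
set x := enc p.1 p.2 v; have UOx := UO_enc Up Ov.
pose f (s : R) := K (x + (s * h) *: (a *: @e1 R n + b *: @e2 R n)).
have xs s : x + (s * h) *: (a *: @e1 R n + b *: @e2 R n) =
  x + (s * h * a) *: @e1 R n + (s * h * b) *: @e2 R n.
  by rewrite scalerDr !scalerA addrA.
have nd s : 0 <= s <= 1 -> `|s * h * a| < d /\ `|s * h * b| < d.
  move=> s01; have s1 : `|s| <= 1 by rewrite ger0_norm; lra.
  by split; apply: le_lt_trans hd; exact: sm.
have df (s : R) : 0 <= s <= 1 -> is_derive s 1 f (K1 (x + (s * h) *: (a *: @e1 R n + b *: @e2 R n)) * h).
  move=> s01; apply: is_derive_line; apply: dK; rewrite xs.
  by have [n1 n2] := nd s s01; exact: (dK1 x _ _ UOx n1 n2).1.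
have [s s01] := mvt ler01 df.
rewrite /f mul0r scale0r addr0 mul1r subr0 mulr1 enc_shift -/x scalerDr !scalerA addrA => fE.
rewrite mulN1r mulNr fE (mulrC h) -mulrBl normrM ler_wpM2r// ltW//.
by rewrite xs; have [n1 n2] := nd s s01; exact: (dK1 x _ _ UOx n1 n2).2.
Qed.

Lemma sint_fam_dx K K1 p : contW K -> contW K1 -> U (p.1 +i* p.2)%C ->
  (forall v, W v -> is_derive v (@e1 R n) K (K1 v)) ->
  is_derive p.1 1 (fun x => sint Om (fam K (x, p.2))) (sint Om (fam K1 p)).
Proof.
move=> cK cK1 Up dK; apply/is_derive_epsP => e e0.
have := sint_fam_eps (a := 1) (b := 0) cK cK1 Up.
rewrite normr1 normr0 => /(_ (lexx _) ler01).
rewrite scale1r scale0r addr0 => /(_ dK _ e0)[t t0 H]; exists t => // h /H.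
by rewrite mulr1 mulr0 addr0 -surjective_pairing.
Qed.

Lemma sint_fam_dy K K1 p : contW K -> contW K1 -> U (p.1 +i* p.2)%C ->
  (forall v, W v -> is_derive v (@e2 R n) K (K1 v)) ->
  is_derive p.2 1 (fun y => sint Om (fam K (p.1, y))) (sint Om (fam K1 p)).
Proof.
move=> cK cK1 Up dK; apply/is_derive_epsP => e e0.
have := sint_fam_eps (a := 0) (b := 1) cK cK1 Up.
rewrite normr1 normr0 => /(_ ler01 (lexx _)).
rewrite scale1r scale0r add0r => /(_ dK _ e0)[t t0 H]; exists t => // h /H.
by rewrite mulr1 mulr0 addr0 -surjective_pairing.
Qed.

End DifferentiationUnderTheIntegral.

(** * Second-order regularity of the potential *)

Section PotentialJet.
Variable R : realType.
Variable n : nat.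
Local Notation C := ((R[i])^o).
Local Notation N := (1 + n + (1 + n))%N.

Lemma smooth_derive (W : set 'rV[R]_N) psi v e : smooth_on W psi -> W v ->
  is_derive v e psi ('D_e psi v).
Proof.
move=> s Wv; have [/(_ v Wv) d _] := s 1%N.
by apply: DeriveDef => //; exact: diff_derivable.
Qed.

Lemma smooth_contW (W : set 'rV[R]_N) psi : smooth_on W psi -> contW W psi.
Proof. by move=> s; exact: (s 0%N). Qed.

Lemma smooth_D (W : set 'rV[R]_N) psi e : smooth_on W psi -> smooth_on W (fun x => 'D_e psi x).
Proof. by move=> s k; exact: (s k.+1).2. Qed.

Lemma contW_mul (W : set 'rV[R]_N) K L : contW W K -> contW W L -> contW W (fun v => K v * L v).
Proof. by move=> cK cL v Wv; exact: cvgM (cK v Wv) (cL v Wv). Qed.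

Lemma contW_sub (W : set 'rV[R]_N) K L : contW W K -> contW W L -> contW W (fun v => K v - L v).
Proof. by move=> cK cL v Wv; exact: cvgB (cK v Wv) (cL v Wv). Qed.

Lemma contW_opp (W : set 'rV[R]_N) K : contW W K -> contW W (fun v => - K v).
Proof. by move=> cK v Wv; exact: cvgN (cK v Wv). Qed.

Lemma contW_expN (W : set 'rV[R]_N) K : contW W K -> contW W (fun v => expR (- K v)).
Proof.
move=> cK v Wv; have h := contW_opp cK Wv; apply: (continuous_comp h); exact: continuous_expR.
Qed.

(** The jet is that of [- ln] of the fibre integral of [exp (- psi)], [psi] the smooth extension of
    [phi]. The mixed derivative [Jyx] is supplied apart from the jet, for the second-order Taylor
    polynomial alone. *)
Theorem potential_jet (U : set C) (Om : set 'rV[C]_n) (phi : C -> 'rV[C]_n -> R) (Phi : C -> R) :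
  bounded_domain U -> bounded_domain Om -> smooth_on_closure U Om phi ->
  (forall t, U t ->
     (expR (- Phi t))%:E = cnint (fun z => (\1_Om z * expR (- phi t z))%:E)) ->
  exists (J : jet R) (Jyx : R * R -> R),
    [/\ is_jet [set p | U (p.1 +i* p.2)%C] J,
        forall p, U (p.1 +i* p.2)%C -> j0 J p = Phi (p.1 +i* p.2)%C &
        forall p, U (p.1 +i* p.2)%C ->
          is_derive p.1 1 (fun x => jy J (x, p.2)) (Jyx p)].
Proof.
move=> [_ [oU [_ bU]]] [_ [oOm [_ bOm]]] [W [oW UOW [psi [spsi psiE]]]] PhiE.
have [M M0 OmM] := bounded_rVC bOm.
pose E v := expR (- psi v).
pose D1 v := 'D_(@e1 R n) psi v; pose D2 v := 'D_(@e2 R n) psi v.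
have sD1 : smooth_on W D1 by exact: smooth_D.
have sD2 : smooth_on W D2 by exact: smooth_D.
pose E1 v := - D1 v * E v; pose E2 v := - D2 v * E v.
pose E11 v := (D1 v * D1 v - 'D_(@e1 R n) D1 v) * E v.
pose E22 v := (D2 v * D2 v - 'D_(@e2 R n) D2 v) * E v.
pose E21 v := (D2 v * D1 v - 'D_(@e1 R n) D2 v) * E v.
have cE : contW W E by apply: contW_expN; exact: smooth_contW.
have cD1 := smooth_contW sD1; have cD2 := smooth_contW sD2.
have cE1 : contW W E1 by apply: contW_mul => //; exact: contW_opp.
have cE2 : contW W E2 by apply: contW_mul => //; exact: contW_opp.
have cD (D : 'rV[R]_N -> R) e : smooth_on W D -> contW W (fun v => 'D_e D v).
  by move=> sD; apply: smooth_contW; exact: smooth_D.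
have cE11 : contW W E11.
  by apply: contW_mul => //; apply: contW_sub; [exact: contW_mul|exact: cD].
have cE22 : contW W E22.
  by apply: contW_mul => //; apply: contW_sub; [exact: contW_mul|exact: cD].
have cE21 : contW W E21.
  by apply: contW_mul => //; apply: contW_sub; [exact: contW_mul|exact: cD].
have dE v e : W v -> is_derive v e E (- 'D_e psi v * E v).
  by move=> Wv; apply: is_derive_expN; exact: smooth_derive Wv.
have dD (D : 'rV[R]_N -> R) v e : smooth_on W D -> W v ->
    is_derive v e (fun v => - D v * E v) ((D v * 'D_e psi v - 'D_e D v) * E v).
  move=> sD Wv.
  have dN : is_derive v e (fun x => - D x) (- 'D_e D v).
    by apply: is_deriveN; exact: smooth_derive Wv.
  apply: (is_derive_eq (is_derive_mul dN (dE v e Wv))); ring.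
pose S K p := sint Om (fam K p).
pose T := (fun p : R * R => U (p.1 +i* p.2)%C).
have SE p : T p -> S E p = expR (- Phi (p.1 +i* p.2)%C).
  move=> Up; have gE := fam_good bU OmM UOW cE Up.
  have E0 v : Om v -> 0 <= fam E p v by move=> _; exact: expR_ge0.
  apply: EFin_inj; rewrite PhiE// /S (sint_ge0 (open_seq oOm) M0 OmM gE E0).
  rewrite (pint_onE (open_seq oOm) M0 OmM gE E0); congr cnint; apply/funext => v.
  rewrite indicE; case: (boolP (v \in Om)) => [/set_mem Ov|]; last by rewrite !mul0r.
  by rewrite /fam /E psiE /= tau_enc z_enc.
have S0 p : T p -> 0 < S E p by move=> Tp; rewrite SE// expR_gt0.
have cS K p : contW W K -> T p -> {for p, continuous (S K)}.
  by move=> cK Tp; exact: (sint_fam_cont oU bU oOm M0 OmM oW UOW cK Tp).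
have dx K K1 p : contW W K -> contW W K1 -> (forall v, W v -> is_derive v (@e1 R n) K (K1 v)) ->
    T p -> is_derive p.1 1 (fun x => S K (x, p.2)) (S K1 p).
  by move=> cK cK1 dK Tp; exact: (sint_fam_dx oU bU oOm M0 OmM oW UOW cK cK1 Tp dK).
have dy K K1 p : contW W K -> contW W K1 -> (forall v, W v -> is_derive v (@e2 R n) K (K1 v)) ->
    T p -> is_derive p.2 1 (fun x => S K (p.1, x)) (S K1 p).
  by move=> cK cK1 dK Tp; exact: (sint_fam_dy oU bU oOm M0 OmM oW UOW cK cK1 Tp dK).
have dq (f g : R -> R) (x f' g' : R) : g x != 0 -> is_derive x 1 f f' -> is_derive x 1 g g' ->
    is_derive x 1 (fun t => - (f t / g t)) (- (f' / g x) + f x * g' / g x ^+ 2).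
  move=> g0 df dg; apply: (is_derive_eq (derN (derM df (derV g0 dg)))).
  by field.
have dl (g : R -> R) (x g' : R) : 0 < g x -> is_derive x 1 g g' ->
    is_derive x 1 (fun t => - ln (g t)) (- (g' / g x)).
  by move=> g0 dg; apply: (is_derive_eq (derN (der_comp (is_derive1_ln g0) dg))); rewrite mulrC.
have cq K p : contW W K -> T p -> {for p, continuous (fun q => S K q / S E q)}.
  move=> cK Tp; apply: cvgM; first exact: cS.
  by apply: cvgV; [exact/lt0r_neq0/S0|exact: cS].
exists (Jet (fun p => - ln (S E p)) (fun p => - (S E1 p / S E p)) (fun p => - (S E2 p / S E p))
  (fun p => - (S E11 p / S E p) + S E1 p * S E1 p / S E p ^+ 2)
  (fun p => - (S E22 p / S E p) + S E2 p * S E2 p / S E p ^+ 2)).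
exists (fun p => - (S E21 p / S E p) + S E2 p * S E1 p / S E p ^+ 2).
(* Written as a product of quotients, the continuity of the second derivatives follows from [cq]. *)
have sqE p K : S K p * S K p / S E p ^+ 2 = (S K p / S E p) * (S K p / S E p).
  by rewrite expr2 invfM mulrACA.
split => /= p Tp; last 2 first.
- by rewrite SE// expRK opprK.
- have E0 : S E (p.1, p.2) != 0 by rewrite -surjective_pairing lt0r_neq0// S0.
  apply: is_derive_eq (dq (fun x => S E2 (x, p.2)) (fun x => S E (x, p.2)) _ _ _ E0
    (dx E2 E21 p cE2 cE21 _ Tp) (dx E E1 p cE cE1 _ Tp)) _.
  all: try by move=> v Wv; first [exact: dE | exact: dD].
  by rewrite -surjective_pairing.
split.
  split => /=.
  - apply: cvgN; apply: (@continuous_comp _ _ _ (S E) (@ln R)); first exact: cS.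
    by apply: continuous_ln; exact: S0.
  - by apply: cvgN; exact: cq.
  - by apply: cvgN; exact: cq.
  - apply: cvgD; first by apply: cvgN; exact: cq.
    by under eq_fun do rewrite sqE; rewrite sqE; apply: cvgM; exact: cq.
  - apply: cvgD; first by apply: cvgN; exact: cq.
    by under eq_fun do rewrite sqE; rewrite sqE; apply: cvgM; exact: cq.
have E0 : S E (p.1, p.2) != 0 by rewrite -surjective_pairing lt0r_neq0// S0.
have E0' : 0 < S E (p.1, p.2) by rewrite -surjective_pairing S0.
have dx' := fun K K1 cK cK1 h => @dx K K1 p cK cK1 h Tp.
have dy' := fun K K1 cK cK1 h => @dy K K1 p cK cK1 h Tp.
split => /=.
- apply: is_derive_eq (dl (fun x => S E (x, p.2)) _ _ E0' (dx' E E1 cE cE1 _)) _.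
  all: try by move=> v Wv; exact: dE.
  by rewrite -surjective_pairing.
- apply: is_derive_eq (dl (fun y => S E (p.1, y)) _ _ E0' (dy' E E2 cE cE2 _)) _.
  all: try by move=> v Wv; exact: dE.
  by rewrite -surjective_pairing.
- apply: is_derive_eq (dq (fun x => S E1 (x, p.2)) (fun x => S E (x, p.2)) _ _ _ E0
    (dx' E1 E11 cE1 cE11 _) (dx' E E1 cE cE1 _)) _.
  all: try by move=> v Wv; first [exact: dE | exact: dD].
  by rewrite -surjective_pairing.
- apply: is_derive_eq (dq (fun y => S E2 (p.1, y)) (fun y => S E (p.1, y)) _ _ _ E0
    (dy' E2 E22 cE2 cE22 _) (dy' E E2 cE cE2 _)) _.
  all: try by move=> v Wv; first [exact: dE | exact: dD].
  by rewrite -surjective_pairing.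
Qed.

End PotentialJet.

Lemma Rintegral_near_cst d (T : measurableType d) (R : realType) (mu : {measure set T -> \bar R})
  (D : set T) (f : T -> R) (k K m : R) :
  measurable D -> mu D = m%:E -> mu.-integrable D (EFin \o f) ->
  (forall t, D t -> `|f t - k| <= K) ->
  `|\int[mu]_(t in D) f t - k * m| <= K * m.
Proof.
move=> mD mDE intf fK.
have ic (a : R) : mu.-integrable D (EFin \o (fun=> a)).
  apply: measurable_bounded_integrable => //; first by rewrite mDE ltry.
  by exists `|a|; split; [exact: num_real|move=> b ab t _; exact: ltW].
have cE (a : R) : \int[mu]_(t in D) a = a * m by rewrite Rintegral_cst// mDE.
have intB : mu.-integrable D (EFin \o (fun t => f t - k)) by exact: (integrableB mD intf (ic k)).
rewrite -cE -RintegralB// -cE; apply: le_trans (le_normr_Rintegral _ _) _ => //.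
by apply: le_Rintegral => //; exact: integrable_norm.
Qed.

(** * The divergence theorem for pointwise differentiable fields *)

Section Goursat.
Variable R : realType.
Implicit Types (p q : R * R) (F G : R * R -> R).
Local Notation mu := (@lebesgue_measure R).
Local Notation mu2 := (mu \x mu)%E.

(* Differentiability at p in Caratheodory's form: products and compositions
   are then purely algebraic. *)
Definition pdiff F p (a b : R) := exists phi1 phi2 : R * R -> R,
  [/\ {for p, continuous phi1}, {for p, continuous phi2}, phi1 p = a, phi2 p = b &
      forall q, F q = F p + phi1 q * (q.1 - p.1) + phi2 q * (q.2 - p.2)].

Lemma pdiff_continuous F p a b : pdiff F p a b -> {for p, continuous F}.
Proof.
move=> [u [v [cu cv _ _ E]]]; change (continuous_at p F).
by rewrite (funext E); cont.
Qed.

Lemma pdiff_cst (k : R) p : pdiff (fun=> k) p 0 0.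
Proof.
exists (fun=> 0), (fun=> 0); split => //; try exact: cont_cst.
by move=> q; rewrite !mul0r !addr0.
Qed.

Lemma pdiff_fst p : pdiff (fun q => q.1) p 1 0.
Proof.
exists (fun=> 1), (fun=> 0); split => //; try exact: cont_cst.
by move=> q; ring.
Qed.

Lemma pdiff_snd p : pdiff (fun q => q.2) p 0 1.
Proof.
exists (fun=> 0), (fun=> 1); split => //; try exact: cont_cst.
by move=> q; ring.
Qed.

Lemma pdiffD F G p a b a' b' : pdiff F p a b -> pdiff G p a' b' ->
  pdiff (fun q => F q + G q) p (a + a') (b + b').
Proof.
move=> [u [v [cu cv <- <- E]]] [u' [v' [cu' cv' <- <- E']]].
exists (fun q => u q + u' q), (fun q => v q + v' q); split => //; try by cont.
by move=> q; rewrite E E'; ring.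
Qed.

Lemma pdiffM F G p a b a' b' : pdiff F p a b -> pdiff G p a' b' ->
  pdiff (fun q => F q * G q) p (a * G p + F p * a') (b * G p + F p * b').
Proof.
move=> dF dG; have cG := pdiff_continuous dG.
case: dF dG => [u [v [cu cv <- <- E]]] [u' [v' [cu' cv' <- <- E']]].
exists (fun q => u q * G q + F p * u' q), (fun q => v q * G q + F p * v' q).
split => //; try by cont.
move=> q; rewrite E; rewrite [in F p * G p](_ : G p = G q - u' q * (q.1 - p.1) - v' q * (q.2 - p.2)); first by ring.
by rewrite (E' q); ring.
Qed.

Lemma pdiffN F p a b : pdiff F p a b -> pdiff (fun q => - F q) p (- a) (- b).
Proof.
move=> [u [v [cu cv <- <- E]]]; exists (fun q => - u q), (fun q => - v q).
split => //; try by cont.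
by move=> q; rewrite E; ring.
Qed.

(** [H] is the difference quotient of [h] at [F p], completed by the derivative; composed with [F]
    it multiplies the slopes of [F]. *)
Lemma pdiff_comp (h : R -> R) F p a b k : pdiff F p a b -> is_derive (F p) 1 h k ->
  pdiff (fun q => h (F q)) p (k * a) (k * b).
Proof.
move=> dF dh; have cF := pdiff_continuous dF.
case: dF => [u [v [cu cv <- <- E]]].
pose H t := if t == F p then k else (h t - h (F p)) / (t - F p).
have HE t : h t = h (F p) + H t * (t - F p).
  rewrite /H; case: eqVneq => [->|tF]; first by rewrite subrr mulr0 addr0.
  by rewrite divfK ?subr_eq0// addrC subrK.
have cH : {for F p, continuous H}.
  apply/cvgrPdist_le => /= e e0.
  have /is_derive_epsP/(_ e e0)[t t0 tP] := dh.
  apply/nbhs_ballP; exists t => //= s; rewrite /ball/= distrC => st.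
  rewrite {1}/H eqxx /H; case: eqVneq => [_|sF]; first by rewrite subrr normr0 ltW.
  have sF0 : 0 < `|s - F p| by rewrite normr_gt0 subr_eq0.
  have := tP _ st; rewrite (addrC (F p)) subrK => h1.
  by rewrite distrC -(ler_pM2r sF0) -normrM mulrBl divfK ?subr_eq0.
have cHF : {for p, continuous (fun q => H (F q))} by exact: cont_comp.
exists (fun q => H (F q) * u q), (fun q => H (F q) * v q); split; try by cont.
- by rewrite /H eqxx.
- by rewrite /H eqxx.
- move=> q; rewrite [LHS]HE.
  have -> : F q - F p = u q * (q.1 - p.1) + v q * (q.2 - p.2) by rewrite (E q); ring.
  by rewrite mulrDr !mulrA addrA.
Qed.

Lemma pdiff_eps F p a b (e : R) : pdiff F p a b -> 0 < e -> exists2 d : R, 0 < d &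
  forall q, `|q.1 - p.1| < d -> `|q.2 - p.2| < d ->
    `|F q - F p - (a * (q.1 - p.1) + b * (q.2 - p.2))| <= e * (`|q.1 - p.1| + `|q.2 - p.2|).
Proof.
move=> [u [v [cu cv <- <- E]]] e0.
have /cvgrPdist_le/(_ _ e0) nu := cu; have /cvgrPdist_le/(_ _ e0) nv := cv.
have : \forall t \near p, `|u p - u t| <= e /\ `|v p - v t| <= e by exact: filterI nu nv.
move=> /nbhs_ballP[d /= d0 dP].
exists d => // q q1 q2.
have [|h1 h2] := dP q; first by split; rewrite /ball/= distrC.
have -> : F q - F p - (u p * (q.1 - p.1) + v p * (q.2 - p.2)) =
  (u q - u p) * (q.1 - p.1) + (v q - v p) * (q.2 - p.2) by rewrite E; ring.
rewrite (le_trans (ler_normD _ _))// !normrM mulrDr.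
by rewrite lerD// ler_wpM2r// distrC.
Qed.

Definition seg (a b : R) (f : R -> R) : R := \int[mu]_(t in `[a, b]) f t.

Lemma seg_integrable (a b : R) (f : R -> R) : continuous f -> mu.-integrable `[a, b] (EFin \o f).
Proof.
move=> cf; apply: continuous_compact_integrable; first exact: segment_compact.
exact: continuous_subspaceT.
Qed.

Lemma seg_split (a b c : R) (f : R -> R) : continuous f -> a <= b -> b <= c ->
  seg a c f = seg a b f + seg b c f.
Proof.
move=> cf ab bc; have := @Rintegral_itvB _ f (BLeft a) (BRight c) b (seg_integrable _ _ cf).
rewrite !bnd_simp => /(_ ab bc); rewrite Rintegral_itv_obnd_cbnd; last first.
  by apply: integrableS (seg_integrable b c cf) => //; exact: subset_itv_oc_cc.
by rewrite /seg => <-; rewrite addrC subrK.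
Qed.

Lemma length_seg (a h : R) : 0 < h -> mu `[a, a + h] = h%:E.
Proof. by move=> h0; rewrite lebesgue_measure_itv /= lte_fin ltrDl h0 -EFinB addrC addKr. Qed.

Lemma seg_diff_est (a h : R) (f f' : R -> R) (k K : R) : continuous f -> continuous f' -> 0 < h ->
  (forall t, a <= t <= a + h -> `|f t - f' t - k| <= K) ->
  `|seg a (a + h) f - seg a (a + h) f' - k * h| <= K * h.
Proof.
move=> cf cf' h0 fK; rewrite /seg -RintegralB//; try exact: seg_integrable.
apply: Rintegral_near_cst => //.
- exact: length_seg.
- by apply: seg_integrable => t; apply: cvgB; [exact: cf|exact: cf'].
Qed.

(** Half-open, so that cutting a rectangle yields a disjoint union. *)
Definition rect (x x' y y' : R) : set (measurableTypeR R * measurableTypeR R) :=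
  `[x, x'[%classic `*` `[y, y'[%classic.

Lemma measurable_rect x x' y y' : measurable (rect x x' y y').
Proof. exact: measurableX. Qed.

Lemma integrable_rect G x x' y y' : (forall p, {for p, continuous G}) ->
  mu2.-integrable (rect x x' y y') (EFin \o G).
Proof.
move=> cG; pose r := `|x| + `|x'| + `|y| + `|y'|.
apply: (@integrable2 _ (0, 0) r) => //; first exact: measurable_rect.
have ax := ler_norm x; have ay := ler_norm y; have ax' := ler_norm x'; have ay' := ler_norm y'.
have bx := ler_norm (- x); have by_ := ler_norm (- y).
have bx' := ler_norm (- x'); have by' := ler_norm (- y').
rewrite !normrN in bx by_ bx' by'.
have n1 := normr_ge0 x; have n2 := normr_ge0 x'; have n3 := normr_ge0 y; have n4 := normr_ge0 y'.
by move=> [s t] [/=]; rewrite !in_itv /= => /andP[h1 h2] /andP[h3 h4];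
  split; rewrite /= in_itv /= /r; apply/andP; split; lra.
Qed.

Lemma pint_rect_splitx G x m x' y y' : (forall p, {for p, continuous G}) -> x <= m -> m <= x' ->
  pint (rect x x' y y') G = pint (rect x m y y') G + pint (rect m x' y y') G.
Proof.
move=> cG xm mx.
have E : rect x x' y y' = rect x m y y' `|` rect m x' y y'.
  apply/seteqP; split => -[s t]; rewrite /rect /= !in_itv /=.
    by move=> [/andP[h1 h2] h3]; have [sm|ms] := ltP s m; [left|right]; rewrite ?h1 ?sm ?ms ?h2.
  by move=> [[/andP[h1 h2] h3]|[/andP[h1 h2] h3]]; split => //; apply/andP; split; lra.
rewrite /pint E Rintegral_setU//; try exact: measurable_rect.
- by rewrite -E; exact: integrable_rect.
- apply/disj_setPS => -[s t]; rewrite /rect /= !in_itv /= => -[[/andP[_ h1] _] [/andP[h2 _] _]].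
  by move: (lt_le_trans h1 h2); rewrite ltxx.
Qed.

Lemma pint_rect_splity G x x' y m y' : (forall p, {for p, continuous G}) -> y <= m -> m <= y' ->
  pint (rect x x' y y') G = pint (rect x x' y m) G + pint (rect x x' m y') G.
Proof.
move=> cG xm mx.
have E : rect x x' y y' = rect x x' y m `|` rect x x' m y'.
  apply/seteqP; split => -[s t]; rewrite /rect /= !in_itv /=.
    by move=> [h3 /andP[h1 h2]]; have [sm|ms] := ltP t m; [left|right]; rewrite ?h1 ?sm ?ms ?h2.
  by move=> [[h3 /andP[h1 h2]]|[h3 /andP[h1 h2]]]; split => //; apply/andP; split; lra.
rewrite /pint E Rintegral_setU//; try exact: measurable_rect.
- by rewrite -E; exact: integrable_rect.
- apply/disj_setPS => -[s t]; rewrite /rect /= !in_itv /= => -[[_ /andP[_ h1]] [_ /andP[h2 _]]].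
  by move: (lt_le_trans h1 h2); rewrite ltxx.
Qed.

Lemma area_rect x y h : 0 < h -> mu2 (rect x (x + h) y (y + h)) = (h * h)%:E.
Proof.
move=> h0; rewrite /rect product_measure1E//.
have len (a : R) : mu `[a, a + h[ = h%:E.
  by rewrite lebesgue_measure_itv /= lte_fin ltrDl h0 -EFinB addrC addKr.
by rewrite EFinM; congr mule; exact: len.
Qed.

Lemma pint_rect_est G x y h (k K : R) : (forall p, {for p, continuous G}) -> 0 < h ->
  (forall q, x <= q.1 <= x + h -> y <= q.2 <= y + h -> `|G q - k| <= K) ->
  `|pint (rect x (x + h) y (y + h)) G - k * (h * h)| <= K * (h * h).
Proof.
move=> cG h0 GK; apply: Rintegral_near_cst; first exact: measurable_rect.
- exact: area_rect.
- exact: integrable_rect.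
- move=> [s t] [/=]; rewrite !in_itv /= => /andP[h1 h2] /andP[h3 h4].
  by apply: GK => /=; apply/andP; split; lra.
Qed.

End Goursat.

(** * Fields whose divergence, but not each derivative, is known to be continuous *)

Section DivergenceTheorem.
Variable R : realType.
Variables A B Ax Ay Bx By : R * R -> R.
Hypothesis dA : forall p, pdiff A p (Ax p) (Ay p).
Hypothesis dB : forall p, pdiff B p (Bx p) (By p).
Let g p := Ax p + By p.
Hypothesis cg : forall p, {for p, continuous g}.

Let cA p : {for p, continuous A}. Proof. exact: pdiff_continuous (dA p). Qed.
Let cB p : {for p, continuous B}. Proof. exact: pdiff_continuous (dB p). Qed.

Definition flux x x' y y' : R :=
  seg y y' (fun t => A (x', t)) - seg y y' (fun t => A (x, t)) +
  (seg x x' (fun t => B (t, y')) - seg x x' (fun t => B (t, y))).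

Definition defect x x' y y' : R := pint (rect x x' y y') g - flux x x' y y'.

Let defect_splitx x m x' y y' : x <= m -> m <= x' ->
  defect x x' y y' = defect x m y y' + defect m x' y y'.
Proof.
move=> xm mx; rewrite /defect /flux (pint_rect_splitx y y' cg xm mx).
have sB z : seg x x' (fun t => B (t, z)) = seg x m (fun t => B (t, z)) + seg m x' (fun t => B (t, z)).
  by apply: seg_split => // t; apply: continuous_slice_x; exact: cB.
rewrite !sB; ring.
Qed.

Let defect_splity x x' y m y' : y <= m -> m <= y' ->
  defect x x' y y' = defect x x' y m + defect x x' m y'.
Proof.
move=> xm mx; rewrite /defect /flux (pint_rect_splity x x' cg xm mx).
have sA z : seg y y' (fun t => A (z, t)) = seg y m (fun t => A (z, t)) + seg m y' (fun t => A (z, t)).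
  by apply: seg_split => // t; apply: continuous_slice_y; exact: cA.
rewrite !sA; ring.
Qed.

Let sq x y h := defect x (x + h) y (y + h).

Let sq_quarter x y h : 0 < h -> sq x y h =
  sq x y (h / 2) + sq x (y + h / 2) (h / 2) +
  (sq (x + h / 2) y (h / 2) + sq (x + h / 2) (y + h / 2) (h / 2)).
Proof.
move=> h0; have hh z : z + h / 2 + h / 2 = z + h by field.
rewrite /sq !hh (@defect_splitx x (x + h / 2) (x + h)); [|lra..].
by rewrite !(@defect_splity _ _ y (y + h / 2) (y + h)); [|lra..].
Qed.

(** The affine parts of [A] and [B] at [p] produce exactly the flux [(Ax p + By p) h^2]. The
    remainders cost [4 e h^2] for each pair of opposite sides and [e h^2] for the integral of the
    divergence. *)
Let defect_local p e : 0 < e -> exists2 d, 0 < d & forall x y h, 0 < h -> h < d ->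
  x <= p.1 <= x + h -> y <= p.2 <= y + h -> `|sq x y h| <= 9 * e * (h * h).
Proof.
move=> e0.
have [a a0 aP] := pdiff_eps (dA p) e0; have [b b0 bP] := pdiff_eps (dB p) e0.
have nc : \forall q \near p, `|g p - g q| <= e by have /cvgrPdist_le/(_ _ e0) := cg (p := p).
have /nbhs_ballP[c /= c0 cP] := nc.
exists (Num.min a (Num.min b c)) => [|x y h h0]; first by rewrite !lt_min a0 b0.
rewrite !lt_min => /andP[ha /andP[hb hc]] /andP[x1 x2] /andP[y1 y2].
have near (u v : R) : u <= v <= u + h -> forall w, u <= w <= u + h -> `|w - v| <= h.
  by move=> /andP[? ?] w /andP[? ?]; rewrite ler_norml; apply/andP; split; lra.
have nx s : x <= s <= x + h -> `|s - p.1| <= h by apply: near; rewrite x1.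
have ny s : y <= s <= y + h -> `|s - p.2| <= h by apply: near; rewrite y1.
have xx : x <= x <= x + h by rewrite lexx/=; lra.
have xh : x <= x + h <= x + h by rewrite lexx andbT; lra.
have yy : y <= y <= y + h by rewrite lexx/=; lra.
have yh : y <= y + h <= y + h by rewrite lexx andbT; lra.
have eA s t : x <= s <= x + h -> y <= t <= y + h ->
    `|A (s, t) - A p - (Ax p * (s - p.1) + Ay p * (t - p.2))| <= 2 * e * h.
  move=> /nx hs /ny ht; have := aP (s, t) (le_lt_trans hs ha) (le_lt_trans ht ha).
  move=> /le_trans; apply; rewrite (mulrC 2) -mulrA ler_wpM2l ?(ltW e0)//=; lra.
have eB s t : x <= s <= x + h -> y <= t <= y + h ->
    `|B (s, t) - B p - (Bx p * (s - p.1) + By p * (t - p.2))| <= 2 * e * h.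
  move=> /nx hs /ny ht; have := bP (s, t) (le_lt_trans hs hb) (le_lt_trans ht hb).
  move=> /le_trans; apply; rewrite (mulrC 2) -mulrA ler_wpM2l ?(ltW e0)//=; lra.
have fA : `|seg y (y + h) (fun t => A (x + h, t)) - seg y (y + h) (fun t => A (x, t))
    - Ax p * h * h| <= 4 * e * h * h.
  apply: seg_diff_est => //; try by move=> t; apply: continuous_slice_y; exact: cA.
  move=> t yt; have := eA _ _ xx yt; have := eA _ _ xh yt.
  by rewrite !ler_norml => /andP[? ?] /andP[? ?]; apply/andP; split; lra.
have fB : `|seg x (x + h) (fun t => B (t, y + h)) - seg x (x + h) (fun t => B (t, y))
    - By p * h * h| <= 4 * e * h * h.
  apply: seg_diff_est => //; try by move=> t; apply: continuous_slice_x; exact: cB.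
  move=> t xt; have := eB _ _ xt yy; have := eB _ _ xt yh.
  by rewrite !ler_norml => /andP[? ?] /andP[? ?]; apply/andP; split; lra.
have fg : `|pint (rect x (x + h) y (y + h)) g - g p * (h * h)| <= e * (h * h).
  apply: pint_rect_est => // q /nx q1 /ny q2; rewrite distrC; apply: cP.
  by split; rewrite /ball/= distrC; [exact: le_lt_trans q1 hc|exact: le_lt_trans q2 hc].
have gE : g p = Ax p + By p by [].
rewrite gE in fg; move: fA fB fg; rewrite /sq /defect /flux.
by rewrite !ler_norml => /andP[? ?] /andP[? ?] /andP[? ?]; apply/andP; split; lra.
Qed.

(* Goursat's bisection: the defect is additive, and o(h^2) at every point. *)
Theorem divergence_square x y h : 0 < h -> pint (rect x (x + h) y (y + h)) g = flux x (x + h) y (y + h).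
Proof.
move=> h0; apply/eqP; rewrite -subr_eq0; apply/negPn/negP => s0.
have n0 : 0 < `|sq x y h| by rewrite normr_gt0.
(* The ratio of defect to area that bisection preserves: some quarter has a defect of at least [e]
   times its own area. *)
pose e := `|sq x y h| / (h * h).
have e0 : 0 < e by rewrite divr_gt0// mulr_gt0.
pose P (q : R * R * R) := 0 < q.2 /\ e * (q.2 * q.2) <= `|sq q.1.1 q.1.2 q.2|.
have step (q : R * R * R) : exists q' : R * R * R, P q ->
    [/\ P q', q'.2 = q.2 / 2, q.1.1 <= q'.1.1 <= q.1.1 + q.2 / 2 &
        q.1.2 <= q'.1.2 <= q.1.2 + q.2 / 2].
  case: (pselect (P q)) => [[q0 qe]|nP]; last by exists q => /nP.
  case: q q0 qe => -[a b] k /= k0 ke; have k20 : 0 < k / 2 by rewrite divr_gt0.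
  pose good_ q' := [/\ P q', q'.2 = k / 2, a <= q'.1.1 <= a + k / 2 & b <= q'.1.2 <= b + k / 2].
  have main a' b' : a <= a' <= a + k / 2 -> b <= b' <= b + k / 2 ->
      (exists q', (P (a, b, k) -> good_ q')) \/ `|sq a' b' (k / 2)| < e * (k / 2 * (k / 2)).
    move=> ha hb; have [h1|h1] := leP (e * (k / 2 * (k / 2))) `|sq a' b' (k / 2)|; last by right.
    by left; exists (a', b', k / 2) => _; split.
  have [aa bb] : a <= a <= a + k / 2 /\ b <= b <= b + k / 2 by rewrite !lexx /=; split; lra.
  have [ak bk] : a <= a + k / 2 <= a + k / 2 /\ b <= b + k / 2 <= b + k / 2.
    by rewrite !lexx !andbT; split; lra.
  have [//|h1] := main _ _ aa bb; have [//|h2] := main _ _ aa bk.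
  have [//|h3] := main _ _ ak bb; have [//|h4] := main _ _ ak bk.
  exfalso; move: ke; apply/negP; rewrite -ltNge sq_quarter//.
  apply: le_lt_trans (ler_normD _ _) _.
  apply: le_lt_trans (lerD (ler_normD _ _) (ler_normD _ _)) _.
  have -> : e * (k * k) = 4 * (e * (k / 2 * (k / 2))) by field.
  lra.
have [nxt nxtP] := choice step.
pose u k := iter k nxt (x, y, h).
have Pu k : P (u k).
  elim: k => [|k /nxtP[]//]; split => //=.
  by rewrite /e divfK// gt_eqF// mulr_gt0.
have uS k := nxtP (u k) (Pu k).
have hu k : (u k).2 = h / 2 ^+ k.
  elim: k => [|k IH]; first by rewrite expr0 divr1.
  by have [_ -> _ _] := uS k; rewrite IH exprS; field.
(* Lower corner coordinates increase and upper ones decrease, so the supremum of the lower ones lies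
   in every square; used for each coordinate. *)
have lim (f : R * R * R -> R) :
    (forall k, f (u k) <= f (u k.+1) <= f (u k) + (u k).2 / 2) ->
    exists l, forall k, f (u k) <= l <= f (u k) + (u k).2.
  move=> fu.
  have mono k m : f (u k) <= f (u (k + m)%N).
    elim: m => [|m IH]; first by rewrite addn0.
    by rewrite addnS (le_trans IH)//; case/andP: (fu (k + m)%N).
  have anti k m : f (u (k + m)%N) + (u (k + m)%N).2 <= f (u k) + (u k).2.
    elim: m => [|m IH]; first by rewrite addn0.
    rewrite addnS; apply: le_trans IH.
    have [_ -> _ _] := uS (k + m)%N; case/andP: (fu (k + m)%N) => _; lra.
  have upos k : 0 < (u k).2 by case: (Pu k).
  have ub k m : f (u m) <= f (u k) + (u k).2.
    apply: le_trans (mono m k) _; rewrite addnC.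
    by apply: le_trans (anti k m); have := upos (k + m)%N; lra.
  exists (sup (range (f \o u))) => k; apply/andP; split.
    apply: ub_le_sup; last by exists k.
    by exists (f (u 0%N) + (u 0%N).2) => _ [m _ <-] /=; exact: (ub 0%N).
  by apply: ge_sup; [exists (f (u 0%N)), 0%N|move=> _ [m _ <-] /=; exact: ub].
have [a aP] := lim (fun q => q.1.1) (fun k => let: And4 _ _ H _ := uS k in H).
have [b bP] := lim (fun q => q.1.2) (fun k => let: And4 _ _ _ H := uS k in H).
(* [9 * (e / 10) < e] contradicts the preserved ratio on a small square around the limit point. *)
have e10 : 0 < e / 10 by rewrite divr_gt0.
have [d d0 dP] := @defect_local (a, b) _ e10.
have [k hk] : exists k, (u k).2 < d.
  have := near_infty_natSinv_lt (PosNum (divr_gt0 d0 h0)) => /= -[k _ /(_ k (leqnn k)) /= kd].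
  exists k.+1; rewrite hu ltr_pdivrMr ?exprn_gt0//.
  move: kd; rewrite invf_plt ?posrE ?divr_gt0 ?ltr0n// invf_div ltr_pdivrMr// => kd.
  apply: lt_le_trans kd _; rewrite mulrC ler_wpM2l ?(ltW d0)//.
  by rewrite -natrX ler_nat ltnW// ltn_expl.
have [q0 qe] := Pu k.
have := le_trans qe (dP _ _ _ q0 hk (aP k) (bP k)).
have : 0 < e * ((u k).2 * (u k).2) by rewrite mulr_gt0// mulr_gt0.
lra.
Qed.

End DivergenceTheorem.

(** * The mean value property of holomorphic functions *)

Section RadialWeights.
Variable R : realType.
Implicit Types (p q c : R * R) (F G : R * R -> R).

Lemma cont_local F G p : (\forall q \near p, F q = G q) ->
  {for p, continuous G} -> {for p, continuous F}.
Proof.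
move=> FG cG; rewrite /prop_for /continuous_at (nbhs_singleton FG).
by apply: cvg_trans cG; apply: near_eq_cvg; apply: filterS FG => q ->.
Qed.

(** Caratheodory's identity is required at every point of the plane. Where [F] and [G] differ, hence
    away from [p], the increment of [F] is distributed over the two slopes in proportion to the
    displacement. *)
Lemma pdiff_local F G p (a b : R) : (\forall q \near p, F q = G q) ->
  pdiff G p a b -> pdiff F p a b.
Proof.
move=> FG [u [v [cu cv ua vb E]]]; have Fp : F p = G p := nbhs_singleton FG.
pose u' q := if F q == G q then u q else (F q - F p) * (q.1 - p.1) / dist2 p q.
pose v' q := if F q == G q then v q else (F q - F p) * (q.2 - p.2) / dist2 p q.
have cu' : {for p, continuous u'}.
  by apply: (cont_local _ cu); apply: filterS FG => q h; rewrite /u' h eqxx.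
have cv' : {for p, continuous v'}.
  by apply: (cont_local _ cv); apply: filterS FG => q h; rewrite /v' h eqxx.
exists u', v'; split=> //; rewrite ?/u' ?/v' ?Fp ?eqxx// => q.
case: eqVneq => [->|FGq]; first exact: E.
have d0 : dist2 p q != 0.
  rewrite /dist2 paddr_eq0 ?sqr_ge0// !sqrf_eq0 !subr_eq0; apply: contra_neqN FGq.
  by case: q p Fp {FG E cu cv cu' cv' u' v' ua vb} => q1 q2 [p1 p2] /= Fp /andP[/eqP-> /eqP->].
by rewrite /dist2 in d0 *; field.
Qed.

Definition mpos (k s : R) : R := Num.max (k - s) 0.

Lemma mpos_eq0 k s : k <= s -> mpos k s = 0.
Proof. by move=> ks; apply/max_idPr; lra. Qed.

Lemma mposE k s : s <= k -> mpos k s = k - s.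
Proof. by move=> ks; apply/max_idPl; lra. Qed.

Lemma sqr_mpos k s : mpos k s ^+ 2 = mpos k s * (k - s).
Proof. by rewrite /mpos; case: ltP => ks; ring. Qed.

(** The squared positive part is differentiable across its kink, with error at most [h^2]; hence the
    square in the regularized field. *)
Lemma is_derive_sqr_mpos (k s : R) : is_derive s 1 (fun t => mpos k t ^+ 2) (- 2 * mpos k s).
Proof.
apply/is_derive_epsP => e e0; exists e => // h /ltW he.
apply: (@le_trans _ _ (`|h| * `|h|)); last by rewrite ler_wpM2r.
rewrite -normrM -expr2 ger0_norm ?sqr_ge0// /mpos opprD addrA.
move: (k - s) => a {e he e0}; rewrite ler_norml.
have p1 : 0 <= (a - h) ^+ 2 by exact: sqr_ge0.
case: (ltP (a - h) 0) => h3; case: (ltP a 0) => h4.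
- by apply/andP; split; have := sqr_ge0 h; lra.
- by apply/andP; split; have := mulr_ge0 h4 (_ : 0 <= h - a); nra.
- by apply/andP; split; nra.
- by apply/andP; split; nra.
Qed.

Lemma cont_mpos c k p : {for p, continuous (fun q => mpos k (dist2 c q))}.
Proof.
apply: (cont_comp (h := mpos k)); last exact: dist2_continuous.
have : continuous (fun t : R => Num.max (k - t) 0).
  move=> t; apply: (@continuous_max _ _ (fun t => k - t) (fun=> 0)); last exact: cvg_cst.
  by apply: cvgB; [exact: cvg_cst|exact: cvg_id].
exact.
Qed.

(** Equal to [(k - dist2)^(n+1)] where that base is positive and to 0 elsewhere; the single positive
    part keeps it continuous on the plane even for [n = 0]. *)
Definition weight c k n p : R := mpos k (dist2 c p) * (k - dist2 c p) ^+ n.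

Lemma cont_weight c k n p : {for p, continuous (weight c k n)}.
Proof. by rewrite /weight; have h := @cont_mpos c k p; cont. Qed.

Lemma weight_eq0 c k n p : k <= dist2 c p -> weight c k n p = 0.
Proof. by move=> h; rewrite /weight mpos_eq0// mul0r. Qed.

Lemma pint_shrink (D D' : set (R * R)) F : D `<=` D' ->
  measurable (D : set (measurableTypeR R * measurableTypeR R)) ->
  measurable (D' : set (measurableTypeR R * measurableTypeR R)) ->
  (forall p, D' p -> ~ D p -> F p = 0) -> pint D' F = pint D F.
Proof.
move=> DD' mD mD' F0; rewrite /pint Rintegral_mkcond [RHS]Rintegral_mkcond.
congr Rintegral; apply/funext => p; rewrite !patchE.
case: (boolP (p \in D')) => [/set_mem D'p|/negP nD'p].
  case: (boolP (p \in D)) => // /negP nD; apply: F0 => // Dp; apply: nD; exact: mem_set.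
case: (boolP (p \in D)) => // /set_mem /DD' D'p; exfalso; apply: nD'p; exact: mem_set.
Qed.

Lemma pint_disc_shrink c (r T : R) F : 0 < r -> r <= T ->
  (forall p, r ^+ 2 <= dist2 c p -> F p = 0) -> pint (disc2 c T) F = pint (disc2 c r) F.
Proof.
move=> r0 rT F0; apply: pint_shrink; [|exact: measurable_disc2..|].
  move=> p; rewrite /disc2 /= => /lt_le_trans; apply.
  by rewrite ler_sqr ?nnegrE// ltW// (lt_le_trans r0).
by move=> p _ /negP; rewrite -leNgt; exact: F0.
Qed.

(** With [h = r^2 - dist2], the field [(p - c) h^(n+1)] vanishes on the circle and has divergence
    [2 (n+2) h^(n+1) - 2 (n+1) r^2 h^n]; this gives a recursion for the moments. *)
Lemma disc_moment c (r : R) n : 0 < r ->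
  pint (disc2 c r) (fun p => (r ^+ 2 - dist2 c p) ^+ n) = pi * r ^+ 2 ^+ n.+1 / n.+1%:R.
Proof.
move=> r0; pose I n := pint (disc2 c r) (fun p => (r ^+ 2 - dist2 c p) ^+ n).
have cI k : cont_on c r (fun p => (r ^+ 2 - dist2 c p) ^+ k) by move=> p _; cont.
have rec k : (k.+2)%:R * I k.+1 = (k.+1)%:R * r ^+ 2 * I k.
  pose h p := r ^+ 2 - dist2 c p.
  pose Wx p := h p ^+ k.+1 - 2 * k.+1%:R * (p.1 - c.1) ^+ 2 * h p ^+ k.
  pose Wy p := h p ^+ k.+1 - 2 * k.+1%:R * (p.2 - c.2) ^+ 2 * h p ^+ k.
  have cWx : cont_on c r Wx by move=> p _; rewrite /Wx /h; cont.
  have cWy : cont_on c r Wy by move=> p _; rewrite /Wy /h; cont.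
  have ix : pint (disc2 c r) Wx = 0.
    apply/eqP; rewrite -normr_le0.
    have := @disc_div_x _ c r 0 (fun p => (p.1 - c.1) * h p ^+ k.+1) Wx r0 _ cWx.
    rewrite mulr0; apply.
      by move=> p _; rewrite /h /dist2 /=; der; rewrite /Wx /h /dist2; ring.
    by move=> p pr; rewrite /h pr subrr expr0n /= mulr0 normr0.
  have iy : pint (disc2 c r) Wy = 0.
    apply/eqP; rewrite -normr_le0.
    have := @disc_div_y _ c r 0 (fun p => (p.2 - c.2) * h p ^+ k.+1) Wy r0 _ cWy.
    rewrite mulr0; apply.
      by move=> p _; rewrite /h /dist2 /=; der; rewrite /Wy /h /dist2; ring.
    by move=> p pr; rewrite /h pr subrr expr0n /= mulr0 normr0.
  have : pint (disc2 c r) (fun p => Wx p + Wy p) = 0 by rewrite pintD// ix iy addr0.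
  rewrite (_ : (fun p => _) = fun p => 2 * k.+2%:R * h p ^+ k.+1 - 2 * k.+1%:R * r ^+ 2 * h p ^+ k);
    last first.
    apply/funext => p; rewrite /Wx /Wy (_ : 2 * k.+2%:R = 2 + 2 * k.+1%:R); last first.
      by rewrite -[k.+2%:R]natr1; ring.
    have -> : (p.1 - c.1) ^+ 2 = r ^+ 2 - h p - (p.2 - c.2) ^+ 2 by rewrite /h /dist2; ring.
    by rewrite [h p ^+ k.+1]exprS; ring.
  rewrite pintB//; [|by move=> p _; rewrite /h; cont..].
  rewrite !pintZ//; [|exact: cI..] => /eqP; rewrite subr_eq0 => /eqP.
  rewrite -/(I k.+1) -/(I k) -!mulrA => /(mulfI _); apply.
  by rewrite pnatr_eq0.
elim: n => [|n IH].
  have := pint_cst c r0 1; rewrite !mul1r expr1 divr1 => <-.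
  by congr pint; apply/funext => p; rewrite expr0.
apply: (@mulfI _ n.+2%:R); first by rewrite pnatr_eq0.
rewrite -/(I n.+1) rec /I IH [in RHS]exprS.
have : n.+1%:R != 0 :> R by rewrite pnatr_eq0.
have : n.+2%:R != 0 :> R by rewrite pnatr_eq0.
move: (r ^+ 2 ^+ n.+1) => X; move: n.+1%:R n.+2%:R => a b b0 a0.
by field; rewrite b0.
Qed.

Lemma weight_moment c (r T : R) n : 0 < r -> r <= T ->
  pint (disc2 c T) (weight c (r ^+ 2) n) = pi * r ^+ 2 ^+ n.+2 / n.+2%:R.
Proof.
move=> r0 rT; rewrite (@pint_disc_shrink c r T)//; last by move=> p; exact: weight_eq0.
rewrite -(@disc_moment c)// /pint; apply: eq_Rintegral => p /set_mem.
by rewrite /disc2 /= => pr; rewrite /weight mposE ?(ltW pr)// [_ ^+ n.+1]exprS.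
Qed.

End RadialWeights.

(** * The mean value property against radial weights *)

Section WeightedMeanValue.
Variable R : realType.
Implicit Types (p q : R * R).
Variables (c : R * R) (r rho T : R) (u v : R * R -> R) (n : nat).
Hypotheses (rho0 : 0 < rho) (rr : rho < r) (rT : rho <= T).
Hypothesis cauchy_riemann : forall p, dist2 c p < r ^+ 2 ->
  exists a b, pdiff u p a (- b) /\ pdiff v p b a.
Hypothesis uc : u c = 0.

Let K := rho ^+ 2.
Let s := dist2 c.
Let w := weight c K n.
Let K0 : 0 < K. Proof. by rewrite exprn_gt0. Qed.
Let Kr : K < r ^+ 2. Proof. by rewrite ltr_sqr ?nnegrE// ltW// (lt_trans rho0). Qed.
Let KT : K <= T ^+ 2.
Proof. by rewrite ler_sqr ?nnegrE// ltW// (lt_le_trans rho0). Qed.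
Let s_ge0 p : 0 <= s p. Proof. exact: dist2_ge0. Qed.

Let far p : K < s p -> \forall q \near p, K <= s q.
Proof.
move=> Ks; have /cvgrPdist_lt/(_ (s p - K)) := @dist2_continuous _ c p.
rewrite subr_gt0 => /(_ Ks); apply: filterS => q; rewrite ltr_norml => /andP[_].
rewrite -/(s p) -/(s q); lra.
Qed.

Lemma cont_weightM (f : R * R -> R) p : (forall q, s q < r ^+ 2 -> {for q, continuous f}) ->
  {for p, continuous (fun q => f q * w q)}.
Proof.
move=> cf; have [sr|rs] := ltP (s p) (r ^+ 2).
  have cw := @cont_weight _ c K n p; have cfp := cf p sr; rewrite /w; cont.
apply: (@cont_local _ _ (fun=> 0)); last exact: cont_cst.
by apply: filterS (far (lt_le_trans Kr rs)) => q Kq; rewrite /w weight_eq0// mulr0.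
Qed.

Lemma cont_u p : s p < r ^+ 2 -> {for p, continuous u}.
Proof. by move=> /cauchy_riemann[a [b [+ _]]]; exact: pdiff_continuous. Qed.

Let pdiff_s p : pdiff s p (2 * (p.1 - c.1)) (2 * (p.2 - c.2)).
Proof.
have h1 : pdiff (fun q => q.1 - c.1) p 1 0.
  by have := pdiffD (pdiff_fst p) (pdiff_cst (- c.1) p); rewrite !addr0.
have h2 : pdiff (fun q => q.2 - c.2) p 0 1.
  by have := pdiffD (pdiff_snd p) (pdiff_cst (- c.2) p); rewrite !addr0.
have := pdiffD (pdiffM h1 h1) (pdiffM h2 h2).
rewrite (_ : (fun q => _) = s); last by apply/funext => q; rewrite /s /dist2; ring.
congr pdiff; ring.
Qed.

Section Regularized.
Variable d : R.
Hypothesis d0 : 0 < d.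

(** Regularization of [(K - t)^(n+2) / t]; for [d = 0] the derivative of [t k(t)] would be
    [- (n+2) (K - t)^(n+1)], a multiple of the weight. *)
Let k t : R := mpos K t ^+ 2 * (K - t) ^+ n / (t + d).
Let k1 t : R := - (n.+2)%:R * (mpos K t * (K - t) ^+ n) / (t + d)
  - mpos K t ^+ 2 * (K - t) ^+ n / (t + d) ^+ 2.

Let k_der (t : R) : 0 <= t -> is_derive t 1 k (k1 t).
Proof.
move=> t0; have td : t + d != 0 by rewrite gt_eqF// ltr_wpDl.
rewrite /k.
have dm := is_derive_sqr_mpos K t.
have dn : is_derive t 1 (fun t => (K - t) ^+ n) (- n%:R * (K - t) ^+ n.-1) by der; ring.
have dd : is_derive t 1 (fun t => (t + d)^-1) (- 1 / (t + d) ^+ 2).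
  by der; rewrite addr0.
have := derM (derM dm dn) dd.
move=> h; apply: (is_derive_eq h); rewrite /k1.
have -> : (n.+2)%:R = n%:R + 2 :> R by rewrite -natrD addn2.
have e : n%:R * (mpos K t * (K - t) ^+ n) = n%:R * (mpos K t ^+ 2 * (K - t) ^+ n.-1).
  by case: n => [|m]; rewrite ?mul0r// sqr_mpos exprS /=; ring.
have -> : - (n%:R + 2) * (mpos K t * (K - t) ^+ n) =
  - (n%:R * (mpos K t ^+ 2 * (K - t) ^+ n.-1)) - 2 * (mpos K t * (K - t) ^+ n) by rewrite -e; ring.
by field.
Qed.

Let kfar t : K <= t -> k t = 0.
Proof. by move=> Kt; rewrite /k mpos_eq0// expr0n /= !mul0r. Qed.

(** With [z = q - c], [A - i B = (u + i v) conj z k(|z|^2)]. The divergence of [(A, B)] is twice the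
    real part of its derivative in [conj z], so the Cauchy-Riemann equations remove the derivatives
    of [u] and [v], which are not known to be continuous; [G] is what remains. *)
Let A q := (u q * (q.1 - c.1) + v q * (q.2 - c.2)) * k (s q).
Let B q := - ((v q * (q.1 - c.1) - u q * (q.2 - c.2)) * k (s q)).
Let G p := 2 * u p * (k (s p) + s p * k1 (s p)).

(** Separates the weight, free of [d], from terms carrying the approximate identity, whose other
    factors vanish at [c] together with [u]. *)
Let GE p : G p = bump c d p * (2 * (u p * w p) * (K - s p + n.+2%:R * s p)) +
  d * (bump c d p * (2 * n.+2%:R * (u p * w p))) - 2 * n.+2%:R * (u p * w p).
Proof.
rewrite /G /k /k1 /bump /w /weight -/(s p) !sqr_mpos.
have sd : s p + d != 0 by rewrite gt_eqF// ltr_wpDl.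
by field.
Qed.

(** Outside the disc of radius [r] nothing is known about [u] and [v], but there the field is zero
    near [p], and [pdiff_local] applies. *)
Let field_diff p : exists q : R * R * (R * R),
  [/\ pdiff A p q.1.1 q.1.2, pdiff B p q.2.1 q.2.2 & q.1.1 + q.2.2 = G p].
Proof.
have [sr|rs] := ltP (s p) (r ^+ 2); last first.
  have Ks : K < s p := lt_le_trans Kr rs.
  exists ((0, 0), (0, 0)); split => /=.
  - apply: (@pdiff_local _ _ (fun=> 0)); last exact: pdiff_cst.
    by apply: filterS (far Ks) => q Kq; rewrite /A kfar// mulr0.
  - apply: (@pdiff_local _ _ (fun=> 0)); last exact: pdiff_cst.
    by apply: filterS (far Ks) => q Kq; rewrite /B kfar// mulr0 oppr0.
  - by rewrite GE /w weight_eq0 ?(ltW Ks)// !(mulr0, addr0, mul0r, subr0).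
have [a [b [du dv]]] := cauchy_riemann sr.
have h1 : pdiff (fun q => q.1 - c.1) p 1 0.
  by have := pdiffD (pdiff_fst p) (pdiff_cst (- c.1) p); rewrite !addr0.
have h2 : pdiff (fun q => q.2 - c.2) p 0 1.
  by have := pdiffD (pdiff_snd p) (pdiff_cst (- c.2) p); rewrite !addr0.
have dk := pdiff_comp (pdiff_s p) (k_der (s_ge0 p)).
have dA := pdiffM (pdiffD (pdiffM du h1) (pdiffM dv h2)) dk.
have dB := pdiffN (pdiffM (pdiffD (pdiffM dv h1) (pdiffN (pdiffM du h2))) dk).
refine (ex_intro _ ((_, _), (_, _)) (And3 dA dB _)).
rewrite /= /G; move: (k (s p)) (k1 (s p)) => kk kk1.
rewrite /s /dist2; ring.
Qed.

Let cG p : {for p, continuous G}.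
Proof.
rewrite (funext GE).
have cuw : {for p, continuous (fun q => u q * w q)} by apply: cont_weightM; exact: cont_u.
have cb : {for p, continuous (bump c d)} by exact: cont_bump.
have cs : {for p, continuous s} by exact: dist2_continuous.
by cont.
Qed.

(** The divergence theorem on the square circumscribed about the disc of radius [T]: on its edges
    the squared distance is at least [T^2 >= K], so the flux is zero. *)
Lemma pint_regularized : pint (disc2 c T) G = 0.
Proof.
have T0 : 0 < T := lt_le_trans rho0 rT.
have [D DP] := choice field_diff.
have dA p : pdiff A p (D p).1.1 (D p).1.2 by case: (DP p).
have dB p : pdiff B p (D p).2.1 (D p).2.2 by case: (DP p).
have DG : (fun p => (D p).1.1 + (D p).2.2) = G by apply/funext => p; case: (DP p).
have := @divergence_square _ A B _ _ _ _ dA dB _ (c.1 - T) (c.2 - T) (2 * T).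
rewrite DG => /(_ cG); rewrite (_ : 0 < 2 * T); last by rewrite mulr_gt0.
move=> /(_ isT) H.
have edge p : (p.1 - c.1) ^+ 2 = T ^+ 2 \/ (p.2 - c.2) ^+ 2 = T ^+ 2 -> K <= s p.
  by rewrite /s /dist2 => -[] ->; apply: (le_trans KT); rewrite ?lerDl ?lerDr sqr_ge0.
have TT z : (z - T + 2 * T - z) ^+ 2 = T ^+ 2 /\ (z - T - z) ^+ 2 = T ^+ 2 by split; ring.
have f0 : flux A B (c.1 - T) (c.1 - T + 2 * T) (c.2 - T) (c.2 - T + 2 * T) = 0.
  have s0 a b : seg a b (fun=> 0) = 0 by rewrite /seg /Rintegral integral0.
  rewrite /flux.
  rewrite (_ : (fun t => A (c.1 - T + 2 * T, t)) = (fun=> 0)); last first.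
    by apply/funext => t; rewrite /A kfar ?mulr0//; apply: edge; left; rewrite (TT _).1.
  rewrite (_ : (fun t => A (c.1 - T, t)) = (fun=> 0)); last first.
    by apply/funext => t; rewrite /A kfar ?mulr0//; apply: edge; left; rewrite (TT _).2.
  rewrite (_ : (fun t => B (t, c.2 - T + 2 * T)) = (fun=> 0)); last first.
    by apply/funext => t; rewrite /B kfar ?mulr0 ?oppr0//; apply: edge; right; rewrite (TT _).1.
  rewrite (_ : (fun t => B (t, c.2 - T)) = (fun=> 0)); last first.
    by apply/funext => t; rewrite /B kfar ?mulr0 ?oppr0//; apply: edge; right; rewrite (TT _).2.
  by rewrite !s0 !subr0 addr0.
transitivity (pint (rect (c.1 - T) (c.1 - T + 2 * T) (c.2 - T) (c.2 - T + 2 * T)) G); last by rewrite H.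
apply/esym; apply: pint_shrink.
- move=> p pT; have q1 := sqr_ge0 (p.1 - c.1); have q2 := sqr_ge0 (p.2 - c.2).
  have /(abs_lt_sqr T0) : (p.1 - c.1) ^+ 2 < T ^+ 2 by move: pT; rewrite /disc2 /dist2 /=; lra.
  have /(abs_lt_sqr T0) : (p.2 - c.2) ^+ 2 < T ^+ 2 by move: pT; rewrite /disc2 /dist2 /=; lra.
  rewrite !ltr_norml => /andP[? ?] /andP[? ?].
  by split; rewrite /= in_itv /=; apply/andP; split; lra.
- exact: measurable_disc2.
- exact: measurable_rect.
- move=> p _ /negP; rewrite -leNgt => Tp.
  by rewrite GE /w weight_eq0 ?(le_trans KT)// !(mulr0, addr0, mul0r, subr0).
Qed.

Lemma weighted_mean_defect : 2 * n.+2%:R * pint (disc2 c T) (fun p => u p * w p) =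
  pint (disc2 c T) (fun p => bump c d p * (2 * (u p * w p) * (K - s p + n.+2%:R * s p))) +
  d * pint (disc2 c T) (fun p => bump c d p * (2 * n.+2%:R * (u p * w p))).
Proof.
have T0 : 0 < T := lt_le_trans rho0 rT.
have cuw p : {for p, continuous (fun q => u q * w q)} by apply: cont_weightM; exact: cont_u.
have cb p : {for p, continuous (bump c d)} by exact: cont_bump.
have cs p : {for p, continuous s} by exact: dist2_continuous.
have := pint_regularized; rewrite (funext GE).
rewrite pintB//; last 2 first.
- by move=> p _; have := cuw p; have := cb p; have := cs p => ? ? ?; cont.
- by move=> p _; have := cuw p => ?; cont.
rewrite pintD//; last 2 first.
- by move=> p _; have := cuw p; have := cb p; have := cs p => ? ? ?; cont.
- by move=> p _; have := cuw p; have := cb p => ? ?; cont.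
rewrite !pintZ//; last by move=> p _; have := cuw p; have := cb p => ? ?; cont.
by move=> /eqP; rewrite subr_eq0 => /eqP <-.
Qed.

End Regularized.

(** In [weighted_mean_defect] both integrands beside [bump] vanish at [c], so the right side tends
    to 0 as [d = k^2 -> 0]; the left side does not involve [d]. *)
Theorem weighted_mean_value : pint (disc2 c T) (fun p => u p * w p) = 0.
Proof.
have T0 : 0 < T := lt_le_trans rho0 rT.
have cuw p : {for p, continuous (fun q => u q * w q)} by apply: cont_weightM; exact: cont_u.
have cs p : {for p, continuous s} by exact: dist2_continuous.
pose F1 p := 2 * (u p * w p) * (K - s p + n.+2%:R * s p).
pose F2 p := 2 * n.+2%:R * (u p * w p).
have c1 : cont_on c T F1 by move=> p _; rewrite /F1; have := cuw p; have := cs p => ? ?; cont.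
have c2 : cont_on c T F2 by move=> p _; rewrite /F2; have := cuw p => ?; cont.
apply/eqP; rewrite -normr_le0; apply/ler_addgt0Pr => e e0; rewrite add0r.
have [k1 k10 k1P] := bump_concentrates T0 c1 e0.
have [k2 k20 k2P] := bump_concentrates T0 c2 e0.
pose k := Num.min 1 (Num.min k1 k2).
have k0 : 0 < k by rewrite !lt_min ltr01 k10.
have [kl1 kl2 kl3] : [/\ k <= 1, k <= k1 & k <= k2].
  by rewrite /k !ge_min !lexx ?orbT; split => //; rewrite orbT.
have := k1P k; rewrite k0 kl2 => /(_ isT).
have := k2P k; rewrite k0 kl3 => /(_ isT).
have F1c : F1 c = 0 by rewrite /F1 uc !(mul0r, mulr0).
have F2c : F2 c = 0 by rewrite /F2 uc !(mul0r, mulr0).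
rewrite F1c F2c.
under [X in pint _ X]eq_fun do rewrite subr0.
under [X in _ -> `|pint _ X| <= _ -> _]eq_fun do rewrite subr0.
move=> h2 h1.
have dk : 0 < k ^+ 2 by rewrite exprn_gt0.
have := weighted_mean_defect dk; rewrite -/F1 -/F2.
set x := pint _ (fun p => u p * w p); set y1 := pint _ _ in h1 *; set y2 := pint _ _ in h2 *.
move=> E.
have d1 : k ^+ 2 <= 1 by rewrite expr_le1// ltW.
have : `|2 * n.+2%:R * x| <= e + e.
  rewrite E; apply: le_trans (ler_normD _ _) _; apply: lerD => //.
  by rewrite normrM ger0_norm ?(ltW dk)// (le_trans _ h2)// ler_piMl.
have n2 : 2 <= n.+2%:R :> R by rewrite ler_nat.
rewrite normrM ger0_norm; last by rewrite mulr_ge0// (le_trans _ n2).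
have := normr_ge0 x; nra.
Qed.

End WeightedMeanValue.

(** * Complex functions as pairs of real functions on the plane *)

Section PlaneComplex.
Variable R : realType.
Local Notation C := ((R[i])^o).
Local Notation mu := (@lebesgue_measure R).

Definition pl (t : C) : R * R := (complex.Re t, complex.Im t).
Definition cx (p : R * R) : C := (p.1 +i* p.2)%C.

Lemma cxK p : pl (cx p) = p. Proof. by case: p. Qed.
Lemma plK t : cx (pl t) = t. Proof. by case: t. Qed.

Lemma sqr_cabsB (a t : C) : cabs (t - a) ^+ 2 = dist2 (pl a) (pl t).
Proof. by rewrite sqr_cabs ReB ImB. Qed.

Lemma discE (a t : C) (r : R) : 0 < r -> disc a r t <-> disc2 (pl a) r (pl t).
Proof.
move=> r0; rewrite /disc /disc2 /= -sqr_cabsB.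
by split; rewrite ltr_sqr ?nnegrE ?cabs_ge0 ?(ltW r0).
Qed.

Lemma slsc_disc (a : C) (r : R) (F : R * R -> R) : 0 < r ->
  (forall p, disc2 (pl a) r p -> {for p, continuous F}) ->
  (forall p, disc2 (pl a) r p -> 0 <= F p) ->
  slsc (@ccv R) (fun t => (\1_(disc a r) t * F (pl t))%:E).
Proof.
move=> r0 cF F0 u l [u1 u2].
have G0 t : 0 <= \1_(disc a r) t * F (pl t).
  rewrite indicE; case: (boolP (t \in disc a r)) => [/set_mem/(discE _ _ r0)/F0|_];
  by rewrite ?mul1r ?mul0r.
case: (pselect (disc a r l)) => [al|nal]; last first.
  rewrite indicE memNset// mul0r; apply: limn_einf_ge.
  by near=> k; rewrite /= lee_fin.
have ul : (fun k => pl (u k)) @ \oo --> pl l by exact: (cvg_pair u1 u2).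
have Dl := (discE a l r0).1 al.
have nD : \forall k \near \oo, disc2 (pl a) r (pl (u k)).
  by apply: ul; apply: open_nbhs_nbhs; split => //; exact: open_disc2.
have Fu : (fun k => F (pl (u k))) @ \oo --> F (pl l) by exact: cvg_comp ul (cF _ Dl).
apply/lee_addgt0Pr => e e0; rewrite -leeBlDr//; apply: limn_einf_ge.
have /cvgrPdist_lt/(_ _ e0) nF := Fu.
apply: filterS2 nD nF => k Dk /=; rewrite -EFinB lee_fin !indicE mem_set// mem_set; last first.
  exact/discE.
rewrite !mul1r ltr_norml => /andP[_]; lra.
Unshelve. all: by end_near.
Qed.

Lemma cint_pint (a : C) (r : R) (F : R * R -> R) : 0 < r -> cont_on (pl a) r F ->
  cint (fun t => (\1_(disc a r) t * F (pl t))%:E) = (pint (disc2 (pl a) r) F)%:E.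
Proof.
move=> r0 cF; have iF := integrable_disc2 r0 cF.
have [_ _ -> _] := pint_fubini (@measurable_disc2 _ (pl a) r) iF.
rewrite /cint; apply: eq_integral => x _; rewrite [RHS]integral_mkcond.
apply: eq_integral => y _; rewrite patchE indicE.
case: (boolP (y \in _)) => [/set_mem|/negP] h.
  by rewrite mem_set ?mul1r//; apply/discE.
rewrite memNset ?mul0r// => /(discE _ _ r0) h'; apply: h; exact: mem_set.
Qed.

(** The complex difference quotient [Q] is continuous at [p]; its real and imaginary parts are
    Caratheodory slopes for [Re F] and [Im F], so differentiability and the Cauchy-Riemann equations
    arrive together. *)
Lemma holo_pdiff (F : C -> C) (p : R * R) : derivable F (cx p) 1 ->
  exists a b, pdiff (fun q => complex.Re (F (cx q))) p a (- b) /\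
              pdiff (fun q => complex.Im (F (cx q))) p b a.
Proof.
move=> dF; pose D : C := 'D_1 F (cx p).
pose Q q : C := if q == p then D else (cx q - cx p)^-1 * (F (cx q) - F (cx p)).
have QE q : F (cx q) - F (cx p) = Q q * (cx q - cx p).
  rewrite /Q; case: eqVneq => [->|qp]; first by rewrite !subrr mulr0.
  have d0 : cx q - cx p != 0 by rewrite subr_eq0; apply: contra_neq qp => /(congr1 pl); rewrite !cxK.
  by rewrite mulrAC mulVf// mul1r.
have cQ e : 0 < e -> \forall q \near p, cabs (D - Q q) < e.
  move=> e0; have := dF; rewrite /derivable => /cvgrPdist_lt/(_ (e%:C)%C).
  rewrite ltcR e0 => /(_ isT) /nbhs_ballP[d' /= d'0 dP].
  have [d d0 dE] := posC_real d'0; rewrite {}dE in dP d'0.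
  apply/nbhs_ballP; exists (d / 2); first by rewrite /= divr_gt0.
  move=> q [q1 q2]; rewrite /Q; case: eqVneq => [_|qp].
    by rewrite subrr cabsE /= expr0n /= addr0 sqrtr0.
  have := dP (cx q - cx p).
  have -> : ball (0 : C) (d%:C)%C (cx q - cx p) = True.
    apply/propext; split=> // _; rewrite ballC.
    by apply: cabs_lt; rewrite // !(ReB, ImB) /= sub0r normrN distrC.
  move=> /(_ I); rewrite subr_eq0.
  have -> : cx q != cx p by apply: contra_neq qp => /(congr1 pl); rewrite !cxK.
  move=> /(_ isT); rewrite normC_lt [(_ - _) *: 1]mulr1 subrK; exact.
have Qp : Q p = D by rewrite /Q eqxx.
have cRe : {for p, continuous (fun q => complex.Re (Q q))}.
  apply/cvgrPdist_lt => e e0; apply: filterS (cQ e e0) => q.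
  by rewrite Qp -ReB; apply: le_lt_trans; exact: Re_le_cabs.
have cIm : {for p, continuous (fun q => complex.Im (Q q))}.
  apply/cvgrPdist_lt => e e0; apply: filterS (cQ e e0) => q.
  by rewrite Qp -ImB; apply: le_lt_trans; exact: Im_le_cabs.
exists (complex.Re D), (complex.Im D); split.
  exists (fun q => complex.Re (Q q)), (fun q => - complex.Im (Q q)); split => //; rewrite ?Qp//.
    by cont.
  move=> q; have := congr1 (@complex.Re R) (QE q); rewrite ReB.
  have -> : complex.Re (Q q * (cx q - cx p)) = complex.Re (Q q) * (q.1 - p.1) -
    complex.Im (Q q) * (q.2 - p.2) := cReM _ _.
  by move=> /eqP; rewrite subr_eq => /eqP ->; ring.
exists (fun q => complex.Im (Q q)), (fun q => complex.Re (Q q)); split => //; rewrite ?Qp//.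
move=> q; have := congr1 (@complex.Im R) (QE q); rewrite ImB.
have -> : complex.Im (Q q * (cx q - cx p)) = complex.Re (Q q) * (q.2 - p.2) +
  complex.Im (Q q) * (q.1 - p.1) := cImM _ _.
by move=> /eqP; rewrite subr_eq => /eqP ->; ring.
Qed.

End PlaneComplex.

(** * A lower bound for holomorphic functions normalized at the centre *)

Section LowerBound.
Variable R : realType.
Local Notation C := ((R[i])^o).
Variables (a : C) (r rho T k : R) (F : C -> C).
Hypotheses (rho0 : 0 < rho) (rhoT : rho < T) (Tr : T < r) (kr : k * r ^+ 2 <= 1).
Hypotheses (hF : holomorphic_on (disc a r) F) (Fa : F a = 1).
Let c := pl a.
Let s := dist2 c.

(* A continuous cutoff of 1 - k s, spanned by the weights whose integrals
   against harmonic functions are known. *)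
Definition cutoff p := ((1 - k * T ^+ 2) * weight c (T ^+ 2) 0 p + k * weight c (T ^+ 2) 1 p
  - ((1 - k * rho ^+ 2) * weight c (rho ^+ 2) 0 p + k * weight c (rho ^+ 2) 1 p))
  / (T ^+ 2 - rho ^+ 2).

Let T0 : 0 < T. Proof. exact: lt_trans rhoT. Qed.
Let r0 : 0 < r. Proof. exact: lt_trans Tr. Qed.
Let rhoT2 : rho ^+ 2 < T ^+ 2. Proof. by rewrite ltr_sqr ?nnegrE// ltW. Qed.
Let Tr2 : T ^+ 2 < r ^+ 2. Proof. by rewrite ltr_sqr ?nnegrE// ltW. Qed.

(** The quotient is 1 on the disc of radius [rho] and decreases linearly in the squared distance to
    0 at radius [T]. *)
Let cutoffE p : cutoff p = (mpos (T ^+ 2) (s p) - mpos (rho ^+ 2) (s p)) / (T ^+ 2 - rho ^+ 2)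
  * (1 - k * s p).
Proof. by rewrite /cutoff /weight expr0 !expr1 -/(s p); ring. Qed.

Let ks p : disc2 c T p -> 0 <= 1 - k * s p.
Proof.
rewrite /disc2 /= -/(s p) => sT; have s0 : 0 <= s p by exact: dist2_ge0.
have [k0|k0] := ltP k 0; first by have := mulr_ge0 (ltW (_ : 0 < - k)) s0; nra.
rewrite subr_ge0; apply: le_trans kr; apply: ler_wpM2l => //.
exact: ltW (lt_trans sT Tr2).
Qed.

Lemma cutoff_bounds p : disc2 c T p -> 0 <= cutoff p <= 1 - k * s p.
Proof.
move=> pT; have h1 := ks pT; rewrite cutoffE; move: pT; rewrite /disc2 /= -/(s p) => sT.
have d0 : 0 < T ^+ 2 - rho ^+ 2 by rewrite subr_gt0.
have m0 : 0 <= mpos (T ^+ 2) (s p) - mpos (rho ^+ 2) (s p) <= T ^+ 2 - rho ^+ 2.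
  rewrite mposE ?(ltW sT)//; have [h|h] := leP (s p) (rho ^+ 2).
    by rewrite mposE//; apply/andP; split; lra.
  by rewrite mpos_eq0 ?(ltW h)//; apply/andP; split; lra.
case/andP: m0 => m0 m1; rewrite mulr_ge0 ?divr_ge0 ?(ltW d0)//=.
by rewrite ler_piMl// ler_pdivrMr// mul1r.
Qed.

Let u p := complex.Re (F (cx p)) - 1.
Let v p := complex.Im (F (cx p)).

Let cr p : dist2 c p < r ^+ 2 -> exists a b, pdiff u p a (- b) /\ pdiff v p b a.
Proof.
move=> pr; have [|x [y [du dv]]] := @holo_pdiff _ F p.
  by apply: hF; apply/discE => //; rewrite cxK.
exists x, y; split => //.
by have := pdiffD du (pdiff_cst (-1) p); rewrite !addr0.
Qed.

Let uc : u c = 0. Proof. by rewrite /u plK Fa /= subrr. Qed.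

Let cu p : dist2 c p < r ^+ 2 -> {for p, continuous u}.
Proof. by move=> /cr[x [y [/pdiff_continuous]]]. Qed.

Let cv p : dist2 c p < r ^+ 2 -> {for p, continuous v}.
Proof. by move=> /cr[x [y [_ /pdiff_continuous]]]. Qed.

Let normF p : cabs (F (cx p)) ^+ 2 = (u p + 1) ^+ 2 + v p ^+ 2.
Proof. by rewrite sqr_cabs /u subrK. Qed.

Section Pairing.
Variable f : R * R -> R.
Hypothesis cf : forall q, dist2 c q < r ^+ 2 -> {for q, continuous f}.

Let cw (x : R) n p : 0 < x -> x < r -> {for p, continuous (fun q => f q * weight c (x ^+ 2) n q)}.
Proof. by move=> x0 xr; exact: (@cont_weightM R c r x n x0 xr f p cf). Qed.

Let cutoffM_E : (fun p => f p * cutoff p) = (fun p =>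
  (1 - k * T ^+ 2) / (T ^+ 2 - rho ^+ 2) * (f p * weight c (T ^+ 2) 0 p) +
  k / (T ^+ 2 - rho ^+ 2) * (f p * weight c (T ^+ 2) 1 p) -
  ((1 - k * rho ^+ 2) / (T ^+ 2 - rho ^+ 2) * (f p * weight c (rho ^+ 2) 0 p) +
  k / (T ^+ 2 - rho ^+ 2) * (f p * weight c (rho ^+ 2) 1 p))).
Proof. by apply/funext => p; rewrite /cutoff; ring. Qed.

Let rhor : rho < r. Proof. exact: lt_trans Tr. Qed.

(** Holds on the whole plane although [f] is controlled only inside radius [r], because the weights
    vanish beyond [T < r]. *)
Lemma cont_cutoffM p : {for p, continuous (fun q => f q * cutoff q)}.
Proof.
have h1 := @cw T 0%N p T0 Tr; have h2 := @cw T 1%N p T0 Tr.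
have h3 := @cw rho 0%N p rho0 rhor; have h4 := @cw rho 1%N p rho0 rhor.
by rewrite cutoffM_E; cont.
Qed.

Lemma pint_cutoffM : pint (disc2 c T) (fun p => f p * cutoff p) =
  (1 - k * T ^+ 2) / (T ^+ 2 - rho ^+ 2) * pint (disc2 c T) (fun p => f p * weight c (T ^+ 2) 0 p) +
  k / (T ^+ 2 - rho ^+ 2) * pint (disc2 c T) (fun p => f p * weight c (T ^+ 2) 1 p) -
  ((1 - k * rho ^+ 2) / (T ^+ 2 - rho ^+ 2) * pint (disc2 c T) (fun p => f p * weight c (rho ^+ 2) 0 p) +
  k / (T ^+ 2 - rho ^+ 2) * pint (disc2 c T) (fun p => f p * weight c (rho ^+ 2) 1 p)).
Proof.
have h (x : R) n : 0 < x -> x < r -> cont_on c T (fun q => f q * weight c (x ^+ 2) n q).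
  by move=> x0 xr p _; exact: cw.
have hz (b x : R) n p : 0 < x -> x < r ->
    {for p, continuous (fun q => b * (f q * weight c (x ^+ 2) n q))}.
  by move=> x0 xr; have h0 := @cw x n p x0 xr; cont.
rewrite cutoffM_E pintB//; last 2 first.
- by move=> p _; apply: contD; exact: hz.
- by move=> p _; apply: contD; exact: hz.
by rewrite !pintD ?pintZ//; solve [exact: h|move=> p _; exact: hz].
Qed.

End Pairing.

Lemma pint_cutoff : pint (disc2 c T) cutoff =
  pi * ((T ^+ 2 + rho ^+ 2) / 2 - k * (T ^+ 4 + T ^+ 2 * rho ^+ 2 + rho ^+ 4) / 6).
Proof.
have := @pint_cutoffM (fun=> 1 : R) (fun q _ => @cont_cst R (R * R)%type 1 q).
have e g : (fun p => (fun=> 1) p * g p) = g :> (R * R -> R) by apply/funext => p; rewrite mul1r.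
rewrite !e => ->; rewrite !weight_moment ?(ltW rhoT)//.
have d0 : T ^+ 2 - rho ^+ 2 != 0 by rewrite gt_eqF// subr_gt0.
by field.
Qed.

Lemma pint_cutoff_harmonic : pint (disc2 c T) (fun p => u p * cutoff p) = 0.
Proof.
have rhor : rho < r := lt_trans rhoT Tr.
rewrite (pint_cutoffM cu) !(@weighted_mean_value _ c r _ T u v)// ?(ltW rhoT)//.
by rewrite !mulr0 !addr0 subr0.
Qed.

(** [|F|^2 >= 1 + 2 (Re F - 1)], and [Re F - 1] vanishes at the centre, so its integral against the
    cutoff is 0. The bound tends to [pi (r^2 - k r^4 / 2)] as both radii tend to [r]. *)
Lemma holo_lower_bound :
  (forall p, {for p, continuous (fun p => cabs (F (cx p)) ^+ 2 * cutoff p)}) /\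
  pi * ((T ^+ 2 + rho ^+ 2) / 2 - k * (T ^+ 4 + T ^+ 2 * rho ^+ 2 + rho ^+ 4) / 6)
  <= pint (disc2 c T) (fun p => cabs (F (cx p)) ^+ 2 * cutoff p).
Proof.
have c1 p : {for p, continuous (fun p => cabs (F (cx p)) ^+ 2 * cutoff p)}.
  apply: cont_cutoffM => q qr; rewrite (funext normF).
  by have := cu qr; have := cv qr => ? ?; cont.
split=> //; rewrite -pint_cutoff.
have c2 p : {for p, continuous (fun p => u p * cutoff p)} by apply: cont_cutoffM; exact: cu.
have c3 p : {for p, continuous cutoff}.
  have := @cont_cutoffM (fun=> 1 : R) (fun q _ => @cont_cst R (R * R)%type 1 q) p.
  by rewrite (_ : (fun q => 1 * cutoff q) = cutoff)//; apply/funext => q; rewrite mul1r.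
have -> : pint (disc2 c T) cutoff = pint (disc2 c T) (fun p => cutoff p + 2 * (u p * cutoff p)).
  rewrite pintD ?pintZ ?pint_cutoff_harmonic ?mulr0 ?addr0//.
  by move=> p _; have := c2 p => ?; cont.
apply: le_pint => //.
  by move=> p _; have := c2 p; have := c3 p => ? ?; cont.
move=> p /cutoff_bounds/andP[h0 _]; rewrite normF.
by have := sqr_ge0 (u p); have := sqr_ge0 (v p); nra.
Qed.

End LowerBound.

(** * Bounds on the extension constant *)

Section ComplexDerivatives.
Variable K : numFieldType.
Implicit Types (t : K^o).

Lemma derivable_cstC (k : K) t : derivable (fun _ : K^o => k : K^o) t 1.
Proof. exact: derivable_cst. Qed.

Lemma derivable_addC (f g : K^o -> K^o) t : derivable f t 1 -> derivable g t 1 ->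
  derivable (fun x => f x + g x : K^o) t 1.
Proof. by move=> df dg; exact: derivableD. Qed.

Lemma derivable_mulC (f g : K^o -> K^o) t : derivable f t 1 -> derivable g t 1 ->
  derivable (fun x => f x * g x : K^o) t 1.
Proof. by move=> df dg; exact: derivableM. Qed.

Lemma derivable_hornerC (H : {poly K}) (a : K) t : derivable (fun x : K^o => H.[x - a] : K^o) t 1.
Proof.
elim/poly_ind: H => [|H b IH].
  under eq_fun do rewrite horner0.
  exact: derivable_cstC.
under eq_fun do rewrite hornerMXaddC.
apply: derivable_addC; last exact: derivable_cstC.
by apply: derivable_mulC => //; exact: derivable_addC.
Qed.

Lemma derivable_expC (f : K^o -> K^o) n t : derivable f t 1 ->
  derivable (fun x => f x ^+ n : K^o) t 1.
Proof.
move=> df; elim: n => [|m IH]; first exact: derivable_cstC.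
under eq_fun do rewrite exprS.
exact: derivable_mulC.
Qed.

End ComplexDerivatives.

Section PowerPolynomials.
Variable R : realType.
Local Notation C := ((R[i])^o).
Implicit Types (a t : C) (H : {poly R[i]}).

(* Replaces exp(H(t - a) - H(0)), which it approaches as N tends to infinity. *)
Definition hpow (N : nat) a H t : C := (1 + (H.[t - a] - H.[0]) / N.+1%:R) ^+ N.+1.

Lemma derivable_hpow N a H t : derivable (hpow N a H) t 1.
Proof.
apply: derivable_expC; apply: derivable_addC; first exact: derivable_cstC.
apply: derivable_mulC; last exact: derivable_cstC.
by apply: derivable_addC; [exact: derivable_hornerC|exact: derivable_cstC].
Qed.

Lemma hpow_center N a H : hpow N a H a = 1.
Proof. by rewrite /hpow subrr subrr mul0r addr0 expr1n. Qed.

Lemma cabsM (z w : C) : cabs (z * w) = cabs z * cabs w.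
Proof. exact: ComplexField.Normc.normcM. Qed.

Lemma cabs1 : cabs (1 : C) = 1.
Proof. exact: ComplexField.Normc.normc1. Qed.

Lemma cabsX (z : C) n : cabs (z ^+ n) = cabs z ^+ n.
Proof. by elim: n => [|n IH]; rewrite ?expr0 ?cabs1// !exprS cabsM IH. Qed.

(** [|1 + w/n|^2 = 1 + 2 Re w / n + |w|^2 / n^2 <= exp (2 Re w / n + |w|^2 / n^2)] with [n = N + 1],
    raised to the power [n]. Both the upper and the lower estimate of [LPhi] use powers only through
    this one-sided bound. *)
Lemma sqr_cabs_pow (w : C) N : cabs ((1 + w / N.+1%:R) ^+ N.+1) ^+ 2 <=
  expR (2 * complex.Re w + cabs w ^+ 2 / N.+1%:R).
Proof.
have N0 : (0 : R) < N.+1%:R by rewrite ltr0n.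
have -> : (N.+1%:R : R[i])^-1 = ((N.+1%:R)^-1%:C)%C by rewrite -(rmorph_nat (real_complex R)) fmorphV.
rewrite cabsX -exprM mulnC exprM sqr_cabs.
have E : complex.Re (1 + w * ((N.+1%:R)^-1%:C)%C) ^+ 2 + complex.Im (1 + w * ((N.+1%:R)^-1%:C)%C) ^+ 2
  = 1 + (2 * complex.Re w / N.+1%:R + cabs w ^+ 2 / N.+1%:R ^+ 2).
  rewrite sqr_cabs; case: w => x y; rewrite /= !mulr0 subr0 add0r.
  by field; rewrite gt_eqF.
rewrite E; apply: (@le_trans _ _ (expR (2 * complex.Re w / N.+1%:R + cabs w ^+ 2 / N.+1%:R ^+ 2) ^+ N.+1)).
  apply: lerXn2r; rewrite ?nnegrE ?expR_ge0//; last exact: expR_ge1Dx.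
  by rewrite -E addr_ge0 ?sqr_ge0.
rewrite -expRM_natr ler_expR le_eqVlt; apply/orP; left; apply/eqP.
by field; rewrite gt_eqF.
Qed.

Lemma reval_center c H : reval c H c = complex.Re H.[0].
Proof. by rewrite /reval /zeta !subrr. Qed.

Lemma cx_sub a p : cx p - a = zeta (pl a) p.
Proof. by case: a p => x y [x' y']. Qed.

Lemma hpow_bound a H (r : R) : exists2 B : R, 0 <= B & forall N p, sqr2 (pl a) r p ->
  cabs (hpow N a H (cx p)) ^+ 2 <=
    expR (2 * (reval (pl a) H p - reval (pl a) H (pl a)) + B / N.+1%:R).
Proof.
pose w p : C := H.[cx p - a] - H.[0].
have zE p : cx p - a = zeta (pl a) p by exact: cx_sub.
have wE p : cabs (w p) ^+ 2 = (reval (pl a) H p - complex.Re H.[0]) ^+ 2 +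
    (imval (pl a) H p - complex.Im H.[0]) ^+ 2.
  by rewrite sqr_cabs /w zE ReB ImB.
have cw : cont_on (pl a) r (fun p => cabs (w p) ^+ 2).
  move=> p _; rewrite (funext wE); have [c1 c2] := cont_reim (pl a) H p.
  by cont.
have [B B0 BP] := bounded_sqr2 cw.
exists B; first exact: ltW.
move=> N p pS; apply: le_trans (sqr_cabs_pow _ _) _; rewrite ler_expR -/(w p).
rewrite reval_center; apply: lerD.
  by rewrite /w zE ReB.
rewrite ler_wpM2r// ?invr_ge0 ?ler0n//.
by apply: le_trans (BP p pS); exact: ler_norm.
Qed.

End PowerPolynomials.

(** The limit [N -> infinity] made explicit: [exp (- x) >= 1 - x], with [N] beyond [L B / e]. *)
Lemma le_exp_limit (R : realType) (L X B : R) : 0 <= B -> 0 <= X ->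
  (forall N, L <= expR (B / N.+1%:R) * X) -> L <= X.
Proof.
move=> B0 X0 H; have [L0|L0] := leP L 0; first exact: le_trans X0.
apply/ler_addgt0Pr => e e0.
have LB0 : 0 <= L * B / e by rewrite divr_ge0 ?(ltW e0)// mulr_ge0// ltW.
pose N := Num.bound (L * B / e).
have N0 : (0 : R) < N.+1%:R by rewrite ltr0n.
have BN : L * (B / N.+1%:R) <= e.
  rewrite mulrA ler_pdivrMr// -ler_pdivrMl// mulrC.
  by apply/ltW/(lt_trans (archi_boundP LB0)); rewrite ltr_nat.
have := H N; rewrite -ler_pdivrMl ?expR_gt0// -expRN.
have := @expR_ge1Dx _ (- (B / N.+1%:R)) => h1 h2.
have : (1 + - (B / N.+1%:R)) * L <= X by apply: le_trans h2; rewrite ler_wpM2r// ltW.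
by move: (B / N.+1%:R) BN {h1 h2} => b; lra.
Qed.

Lemma cReN (R : realType) (z : R[i]) : complex.Re (- z) = - complex.Re z.
Proof. by case: z. Qed.

Lemma revalN (R : realType) (c p : R * R) (H : {poly R[i]}) : reval c (- H) p = - reval c H p.
Proof. by rewrite /reval hornerN; exact: cReN. Qed.

(** * Two-sided estimates of the extension constant on one disc *)

Section DiscBounds.
Variable R : realType.
Local Notation C := ((R[i])^o).
Variables (a : C) (r : R) (Phi : C -> R) (phi : R * R -> R).
Hypothesis r0 : 0 < r.
Let c := pl a.
Hypothesis cphi : cont_on c r phi.
Hypothesis phiE : forall t, disc a r t -> phi (pl t) = Phi t.
Implicit Types (f : C -> C) (H : {poly R[i]}).

Let dens f p := cabs (f (cx p)) ^+ 2 * expR (- phi p).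

Let ca : disc a r a. Proof. by rewrite /disc /= subrr cabsE /= expr0n /= addr0 sqrtr0. Qed.

Let phic : phi c = Phi a. Proof. exact: phiE. Qed.

Lemma cint_dens f :
  cint (fun t => (\1_(disc a r) t * cabs (f t) ^+ 2 * expR (- Phi t))%:E) =
  cint (fun t => (\1_(disc a r) t * dens f (pl t))%:E).
Proof.
congr cint; apply/funext => t; rewrite indicE /dens plK.
case: (boolP (t \in disc a r)) => [/set_mem/phiE ->|_]; last by rewrite !mul0r.
by rewrite !mul1r.
Qed.

Lemma holo_cont f p : holomorphic_on (disc a r) f -> disc2 c r p ->
  {for p, continuous (fun q => cabs (f (cx q)) ^+ 2)}.
Proof.
move=> hf pD; have [|x [y [/pdiff_continuous c1 /pdiff_continuous c2]]] := @holo_pdiff _ f p.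
  by apply: hf; apply/discE => //; rewrite cxK.
rewrite (_ : (fun q => _) = fun q => complex.Re (f (cx q)) ^+ 2 + complex.Im (f (cx q)) ^+ 2).
  by cont.
by apply/funext => q; rewrite sqr_cabs.
Qed.

Let disc_sqr p : disc2 c r p -> {for p, continuous phi}.
Proof. by move=> /(disc2_sub r0); exact: cphi. Qed.

Lemma dens_cont f p : holomorphic_on (disc a r) f -> disc2 c r p -> {for p, continuous (dens f)}.
Proof.
move=> hf pD; have c1 := holo_cont hf pD; have c2 := disc_sqr pD.
by rewrite /dens; cont.
Qed.

Let cont_hpow N H : cont_on c r (dens (hpow N a H)).
Proof.
move=> p pS.
have [x [y [/pdiff_continuous c1 /pdiff_continuous c2]]] := holo_pdiff (@derivable_hpow R N a H (cx p)).
have c3 := cphi pS.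
rewrite /dens (_ : (fun q => _) = fun q => (complex.Re (hpow N a H (cx q)) ^+ 2 +
  complex.Im (hpow N a H (cx q)) ^+ 2) * expR (- phi q)); first by cont.
by apply/funext => q; rewrite sqr_cabs.
Qed.

Let nrm := pi * r ^+ 2 * expR (- Phi a).
Let nrm0 : 0 < nrm. Proof. by rewrite !mulr_gt0 ?pi_gt0 ?expR_gt0// exprn_gt0. Qed.

Let S := [set x : R | exists f : C -> C,
  [/\ holomorphic_on (disc a r) f, f a = 1,
      (cint (fun t => (\1_(disc a r) t * cabs (f t) ^+ 2 * expR (- Phi t))%:E) < +oo)%E &
      x = fine (cint (fun t => (\1_(disc a r) t * cabs (f t) ^+ 2 * expR (- Phi t))%:E)) / nrm]].

Let S_hpow N H : S (pint (disc2 c r) (dens (hpow N a H)) / nrm).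
Proof.
exists (hpow N a H); rewrite cint_dens cint_pint// ltry; split=> //.
- by move=> t _; exact: derivable_hpow.
- exact: hpow_center.
Qed.

Let S_ge0 : lbound S 0.
Proof.
move=> _ [f [_ _ _ ->]]; rewrite divr_ge0 ?(ltW nrm0)// fine_ge0//.
apply: integral_ge0 => x _; apply: integral_ge0 => y _.
by rewrite lee_fin mulr_ge0 ?expR_ge0// mulr_ge0 ?sqr_ge0// indicE ler0n.
Qed.

(** The competitors [hpow N a H] have weighted density at most [exp (B / (N+1))] times the limiting
    one; then [N -> infinity]. *)
Lemma LPhi_upper H V : (forall p, V p = 2 * reval c H p - phi p) ->
  LPhi Phi a r <= pint (disc2 c r) (fun p => expR (V p - V c)) / (pi * r ^+ 2).
Proof.
move=> /funext ->; pose V' p := 2 * reval c H p - phi p; rewrite -/V' {V}; rename V' into V.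
have [B B0 BP] := hpow_bound a H r.
have cV : cont_on c r (fun p => expR (V p - V c)).
  by move=> p pS; have [c1 _] := cont_reim c H p; have c2 := cphi pS; rewrite /V; cont.
have pr0 : 0 < pi * r ^+ 2 by rewrite mulr_gt0 ?pi_gt0 ?exprn_gt0.
have V0 : 0 <= pint (disc2 c r) (fun p => expR (V p - V c)).
  by apply: Rintegral_ge0 => p _; exact: expR_ge0.
apply: (le_exp_limit B0); first by rewrite divr_ge0// ltW.
move=> N; apply: (@le_trans _ _ (pint (disc2 c r) (dens (hpow N a H)) / nrm)).
  by apply: ge_inf; [exists 0; exact: S_ge0|exact: S_hpow].
rewrite mulrA /nrm invfM mulrA mulrAC ler_wpM2r ?invr_ge0 ?(ltW pr0)//.
rewrite ler_pdivrMr ?expR_gt0// mulrC mulrA -expRD -pintZ//.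
apply: le_pint => //; first by move=> p pS; have := cV p pS => ?; cont.
move=> p pD; apply: (@le_trans _ _ (expR (2 * (reval c H p - reval c H c) + B / N.+1%:R) * expR (- phi p))).
  by rewrite ler_wpM2r ?expR_ge0//; apply: BP; exact: (disc2_sub r0).
rewrite -!expRD ler_expR /V phic.
by move: (B / _) => b; lra.
Qed.

(** Multiplying [f] by the power approximating [exp (H(0) - H(t - a))] cancels the pluriharmonic
    part of the weight. What remains, [exp (- k s)], dominates [1 - k s] and hence the cutoff in
    [holo_lower_bound]. *)
Lemma LPhi_lower H (k : R) : k * r ^+ 2 <= 1 ->
  (forall p, disc2 c r p ->
     phi p <= phi c + 2 * (reval c H p - reval c H c) + k * dist2 c p) ->
  1 - k * r ^+ 2 / 2 <= LPhi Phi a r.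
Proof.
(* The infimum needs a nonempty set; [hpow 0 a 0] is the constant function 1. *)
move=> kr phik; apply: lb_le_inf; first by exists (pint (disc2 c r) (dens (hpow 0 a 0)) / nrm); exact: S_hpow.
move=> _ [f [hf fa fin ->]].
rewrite ler_pdivlMr// /nrm mulrA -ler_pdivlMr ?expR_gt0// -expRN opprK.
set I := cint _ in fin *; set X := fine I * _.
have I0 : (0 <= I)%E.
  apply: integral_ge0 => x _; apply: integral_ge0 => y _.
  by rewrite lee_fin mulr_ge0 ?expR_ge0// mulr_ge0 ?sqr_ge0// indicE ler0n.
have X0 : 0 <= X by rewrite mulr_ge0 ?expR_ge0// fine_ge0.
have [B B0 BP] := hpow_bound a (- H) r.
pose M rho T := pi * ((T ^+ 2 + rho ^+ 2) / 2 -
  k * (T ^+ 4 + T ^+ 2 * rho ^+ 2 + rho ^+ 4) / 6).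
have MX rho T : 0 < rho -> rho < T -> T < r -> M rho T <= X.
  move=> rho0 rhoT Tr; apply: (le_exp_limit B0 X0) => N.
  have T0 : 0 < T := lt_trans rho0 rhoT.
  pose F t : C := f t * hpow N a (- H) t.
  have hF : holomorphic_on (disc a r) F.
    move=> t /hf df; exact: (@derivable_mulC R[i] f (hpow N a (- H)) t df (@derivable_hpow R N a (- H) t)).
  have Fa : F a = 1 by rewrite /F fa hpow_center mulr1.
  have [cF] := holo_lower_bound rho0 rhoT Tr kr hF Fa.
  rewrite -/(M rho T) => /le_trans; apply.
  set G := fun p => cabs (F (cx p)) ^+ 2 * cutoff a rho T k p.
  have cG : cont_on c T G by move=> p _; exact: cF.
  (* Absorbs both the value of the weight at the centre and the error factor of the power, so that
     [b * G] lies below the density of [f]. *)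
  pose b := expR (- (B / N.+1%:R) - Phi a).
  have b0 : 0 < b by exact: expR_gt0.
  have TrD p : disc2 c T p -> disc2 c r p.
    rewrite /disc2 /= => /lt_trans; apply; rewrite ltr_sqr ?nnegrE ?(ltW r0)//.
    exact: ltW.
  have G0 p : disc2 c T p -> 0 <= G p.
    by move=> /(cutoff_bounds rho0 rhoT Tr kr)/andP[h _]; rewrite mulr_ge0 ?sqr_ge0.
  have Gd p : disc2 c T p -> b * G p <= dens f p.
    move=> pT; have /andP[h0 h1] := cutoff_bounds rho0 rhoT Tr kr pT.
    have pD := TrD p pT; have := phik p pD; rewrite phic => hp.
    have h2 : cutoff a rho T k p <= expR (- (k * dist2 c p)).
      by apply: le_trans h1 _; have := @expR_ge1Dx _ (- (k * dist2 c p)).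
    have := BP N p (disc2_sub r0 pD); rewrite !revalN.
    move=> h3; rewrite /G /dens /F cabsM exprMn -mulrA mulrCA ler_wpM2l ?sqr_ge0//.
    apply: (@le_trans _ _ (b * (expR (2 * (- reval c H p - - reval c H c) + B / N.+1%:R) *
      expR (- (k * dist2 c p))))).
      by rewrite ler_wpM2l ?(ltW b0)// ler_pM ?sqr_ge0.
    by rewrite /b -!expRD ler_expR; move: (B / _) => b'; lra.
  have : (cint (fun t => (\1_(disc a T) t * (b * G (pl t)))%:E) <= I)%E.
    rewrite /I cint_dens; apply: le_cint.
    - apply: (@slsc_disc R a T (fun p => b * G p) T0) => p pT; last by rewrite mulr_ge0 ?(ltW b0)// G0.
      by have := cF p => ?; cont.
    - apply: (@slsc_disc R a r (dens f) r0) => p pT; first exact: dens_cont.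
      by rewrite mulr_ge0 ?expR_ge0 ?sqr_ge0.
    - move=> t; rewrite lee_fin indicE; case: (boolP (t \in _)) => [/set_mem/(discE _ _ T0)|_].
        by move=> tT; rewrite mul1r mulr_ge0 ?(ltW b0)// G0.
      by rewrite mul0r.
    - move=> t; rewrite lee_fin !indicE; case: (boolP (t \in disc a T)) => [/set_mem/(discE _ _ T0) tT|_].
        by rewrite mem_set ?mul1r ?Gd//; apply/discE => //; exact: TrD.
      by rewrite mul0r mulr_ge0 ?ler0n// mulr_ge0 ?expR_ge0 ?sqr_ge0.
  rewrite (@cint_pint R a T (fun p => b * G p) T0); last by move=> p _; have := cF p => ?; cont.
  rewrite -[I]fineK ?ge0_fin_numE// lee_fin pintZ// => h.
  rewrite -(ler_pM2l b0); apply: le_trans h _.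
  rewrite le_eqVlt; apply/orP; left; apply/eqP; rewrite /X.
  rewrite (_ : b * _ = fine I * (b * expR (B / N.+1%:R) * expR (Phi a))); last by ring.
  by rewrite /b -!expRD (_ : _ + _ = 0) ?expR0 ?mulr1//; ring.
(* A one-parameter path of radii [rho < T < r] for [0 < t < 1]; continuity of [m] at 1 gives the
   limit. *)
pose m t := M (t ^+ 2 * r) (t * r).
have m1 : m 1 = pi * (r ^+ 2 - k * r ^+ 4 / 2) by rewrite /m /M; field.
have cm : {for 1, continuous m}.
  have [d md] : exists d, is_derive (1 : R) 1 m d.
    by eexists; rewrite /m /M; der; reflexivity.
  exact: is_derive_continuous md.
have : m 1 <= X.
  apply/ler_addgt0Pr => e e0; have /cvgrPdist_lt/(_ _ e0)/nbhs_ballP[d /= d0 dP] := cm.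
  pose t : R := 1 - Num.min (d / 2) (1 / 2).
  have d20 : 0 < d / 2 by rewrite divr_gt0.
  have t1 : 0 < Num.min (d / 2) (1 / 2) by rewrite lt_min d20 divr_gt0.
  have t2 : Num.min (d / 2) (1 / 2) <= 1 / 2 by rewrite ge_min lexx orbT.
  have t3 : Num.min (d / 2) (1 / 2) <= d / 2 by rewrite ge_min lexx.
  have t0 : 0 < t by rewrite /t; lra.
  have tl1 : t < 1 by rewrite /t; lra.
  have tr0 : 0 < t * r by rewrite mulr_gt0.
  have : m t <= X.
    apply: MX; rewrite ?expr2 -?mulrA ?gtr_pMl//.
    by rewrite mulr_gt0.
  have : `|m 1 - m t| < e.
    by apply: dP; rewrite /ball/= opprB addrC subrK gtr0_norm//; lra.
  by rewrite ltr_norml => /andP[? ?]; lra.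
rewrite m1 (_ : pi * _ = (1 - k * r ^+ 2 / 2) * (pi * r ^+ 2)) //; by field.
Qed.

End DiscBounds.

(** * Second-order Taylor expansion with a harmonic part *)

Section Taylor.
Variable R : realType.

(** Two uses of the mean value theorem, on the remainder and then on [f1]; no factor 1/2 is sought
    in the error. *)
Lemma taylor_line (f f1 f2 : R -> R) (x h k eta : R) :
  (forall t : R, 0 <= t <= 1 -> is_derive (x + t * h) 1 f (f1 (x + t * h))) ->
  (forall t : R, 0 <= t <= 1 -> is_derive (x + t * h) 1 f1 (f2 (x + t * h))) ->
  (forall t : R, 0 <= t <= 1 -> `|f2 (x + t * h) - k| <= eta) ->
  `|f (x + h) - f x - f1 x * h - k * h ^+ 2 / 2| <= eta * h ^+ 2.
Proof.
move=> d1 d2 fk.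
have dl (t : R) : is_derive t 1 (fun t => x + t * h) h by der; ring.
have dphi (t : R) : 0 <= t <= 1 -> is_derive t 1
    (fun t => f (x + t * h) - f1 x * (t * h) - k * (t * h) ^+ 2 / 2)
    (h * (f1 (x + t * h) - f1 x - k * (t * h))).
  move=> t01; have d := der_comp (f := fun t => x + t * h) (d1 t t01) (dl t).
  by der; field.
have [t t01] := mvt ler01 dphi.
rewrite mul1r mul0r addr0 mulr0 expr0n /= mulr0 mul0r !subr0 mulr1 => E.
have /andP[t0 t1] := t01.
have dpsi (s : R) : 0 <= s <= t -> is_derive s 1 (fun t => f1 (x + t * h)) (f2 (x + s * h) * h).
  move=> /andP[s0 st]; have s01 : 0 <= s <= 1 by rewrite s0 (le_trans st).
  exact: (der_comp (f := fun t => x + t * h) (d2 s s01) (dl s)).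
have [s /andP[s0 st]] := mvt t0 dpsi.
rewrite mul0r addr0 subr0 => E1.
have fs : `|f2 (x + s * h) - k| <= eta by apply: fk; rewrite s0 (le_trans st).
have -> : f (x + h) - f x - f1 x * h - k * h ^+ 2 / 2 = t * h ^+ 2 * (f2 (x + s * h) - k).
  move: E; rewrite E1 => E; lra.
have th0 : 0 <= t * h ^+ 2 by rewrite mulr_ge0 ?sqr_ge0.
rewrite normrM (ger0_norm th0) mulrC; apply: ler_pM => //.
by rewrite ler_piMl ?sqr_ge0.
Qed.

Definition quadratic_poly (x1 x2 y1 y2 : R) : {poly R[i]} :=
  ((y1 +i* y2)%C%:P * 'X + (x1 +i* x2)%C%:P) * 'X.

Lemma reval_quadratic c x1 x2 y1 y2 p : reval c (quadratic_poly x1 x2 y1 y2) p =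
  y1 * ((p.1 - c.1) ^+ 2 - (p.2 - c.2) ^+ 2) - 2 * y2 * ((p.1 - c.1) * (p.2 - c.2)) +
  x1 * (p.1 - c.1) - x2 * (p.2 - c.2).
Proof.
rewrite /quadratic_poly reval_mulX reval_step imval_step /reval /imval !hornerC /=; ring.
Qed.

(** The increment runs along the horizontal and then the vertical side from [c] to [p]. The cross
    term appears only as the change of [jy] along the first side, so the mixed derivative is needed
    at [c] alone. *)
Lemma jet_taylor (S : set (R * R)) (J : jet R) (Jyx : R) (c : R * R) :
  is_jet S J -> (\forall p \near c, S p) ->
  is_derive c.1 1 (fun x => jy J (x, c.2)) Jyx ->
  exists H : {poly R[i]}, forall eta, 0 < eta -> exists2 t, 0 < t & forall p, dist2 c p < t ^+ 2 ->
    `|j0 J p - j0 J c - 2 * (reval c H p - reval c H c) - lap J c / 4 * dist2 c p|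
      <= eta * dist2 c p.
Proof.
move=> hJ nS dyx.
(* With these coefficients [2 Re H] plus [lap J c / 4] times the squared distance is the
   second-order Taylor polynomial of [J], up to its constant term. *)
exists (quadratic_poly (jx J c / 2) (- (jy J c) / 2) ((jxx J c - jyy J c) / 8) (- Jyx / 4)) => eta eta0.
have e0 : 0 < eta / 2 by rewrite divr_gt0.
have Sc : S c := nbhs_singleton nS.
have [[_ _ _ cxx cyy] _] := hJ c Sc.
have [t1 t10 t1P] := near_disc2 cxx e0; have [t2 t20 t2P] := near_disc2 cyy e0.
have [t3 t30 t3P] := nbhs_disc2 nS.
have /is_derive_epsP/(_ _ e0)[t4 t40 t4P] := dyx.
exists (Num.min (Num.min t1 t2) (Num.min t3 t4)); first by rewrite !lt_min t10 t20 t30.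
move=> p pt.
have lt_t t : 0 < t -> Num.min (Num.min t1 t2) (Num.min t3 t4) <= t -> dist2 c p < t ^+ 2.
  move=> t0 tl; apply: lt_le_trans pt _; rewrite ler_sqr ?nnegrE ?(ltW t0)//.
  by rewrite !le_min !ltW.
have l1 : dist2 c p < t1 ^+ 2 by apply: lt_t; rewrite // !ge_min lexx.
have l2 : dist2 c p < t2 ^+ 2 by apply: lt_t; rewrite // !ge_min lexx !orbT.
have l3 : dist2 c p < t3 ^+ 2 by apply: lt_t; rewrite // !ge_min lexx !orbT.
have l4 : dist2 c p < t4 ^+ 2 by apply: lt_t; rewrite // !ge_min lexx !orbT.
pose x := p.1 - c.1; pose y := p.2 - c.2.
have sE : dist2 c p = x ^+ 2 + y ^+ 2 by [].
have dx (t : R) : 0 <= t <= 1 -> dist2 c (c.1 + t * x, c.2) <= dist2 c p.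
  move=> /andP[t0 t1']; rewrite sE /dist2 /= subrr expr0n /= addr0 addrC addKr exprMn.
  have := sqr_ge0 x; have := sqr_ge0 y; move: (x ^+ 2) (y ^+ 2) => X Y Y0 X0.
  have : t ^+ 2 <= 1 by rewrite expr_le1.
  nra.
have dy (t : R) : 0 <= t <= 1 -> dist2 c (p.1, c.2 + t * y) <= dist2 c p.
  move=> /andP[t0 t1']; rewrite sE /dist2 /= -/x [c.2 + _]addrC addrK exprMn.
  have := sqr_ge0 x; have := sqr_ge0 y; move: (x ^+ 2) (y ^+ 2) => X Y Y0 X0.
  have : t ^+ 2 <= 1 by rewrite expr_le1.
  nra.
have jetS q : dist2 c q <= dist2 c p -> [/\ S q, `|jxx J q - jxx J c| <= eta / 2 & `|jyy J q - jyy J c| <= eta / 2].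
  move=> h; split; first by apply: t3P; exact: le_lt_trans h l3.
    by apply/ltW/t1P; exact: le_lt_trans h l1.
  by apply/ltW/t2P; exact: le_lt_trans h l2.
have E1 := @taylor_line (fun s => j0 J (s, c.2)) (fun s => jx J (s, c.2)) (fun s => jxx J (s, c.2))
  c.1 x (jxx J c) (eta / 2).
have {}E1 : `|j0 J (c.1 + x, c.2) - j0 J (c.1, c.2) - jx J (c.1, c.2) * x - jxx J c * x ^+ 2 / 2|
    <= eta / 2 * x ^+ 2.
  apply: E1 => t t01; have [Sq h1 h2] := jetS _ (dx t t01).
  - by have [_ [h _ _ _]] := hJ _ Sq.
  - by have [_ [_ _ h _]] := hJ _ Sq.
  - by [].
have E2 := @taylor_line (fun s => j0 J (p.1, s)) (fun s => jy J (p.1, s)) (fun s => jyy J (p.1, s))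
  c.2 y (jyy J c) (eta / 2).
have {}E2 : `|j0 J (p.1, c.2 + y) - j0 J (p.1, c.2) - jy J (p.1, c.2) * y - jyy J c * y ^+ 2 / 2|
    <= eta / 2 * y ^+ 2.
  apply: E2 => t t01; have [Sq h1 h2] := jetS _ (dy t t01).
  - by have [_ [_ h _ _]] := hJ _ Sq.
  - by have [_ [_ _ _ h]] := hJ _ Sq.
  - by [].
have xt : `|x| < t4.
  by apply: abs_lt_sqr => //; apply: le_lt_trans l4; rewrite sE lerDl sqr_ge0.
have E3 := t4P x xt.
have px : c.1 + x = p.1 by rewrite /x addrC subrK.
have py : c.2 + y = p.2 by rewrite /y addrC subrK.
rewrite !px in E1 E3; rewrite py -!surjective_pairing in E2; rewrite -!surjective_pairing in E1 E3.
have {}E3 : `|(jy J (p.1, c.2) - jy J c - Jyx * x) * y| <= eta / 2 * ((x ^+ 2 + y ^+ 2) / 2).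
  rewrite normrM; apply: le_trans (ler_wpM2r (normr_ge0 y) E3) _.
  rewrite -[leLHS]mulrA; apply: ler_wpM2l; first exact: ltW.
  have := sqr_ge0 (`|x| - `|y|); rewrite sqrrB !real_normK ?num_real//; lra.
rewrite !reval_quadratic !subrr -/x -/y sE /lap.
have := sqr_ge0 x; have := sqr_ge0 y => y0 x0.
move: E1 E2 E3; rewrite !ler_norml => /andP[a1 b1] /andP[a2 b2] /andP[a3 b3].
by apply/andP; split; lra.
Qed.

End Taylor.

Section Lipschitz.
Variable R : realType.

Lemma lipschitz_line (f df : R -> R) (l u B x y : R) :
  (forall t : R, l <= t <= u -> is_derive t 1 f (df t)) ->
  (forall t : R, l <= t <= u -> `|df t| <= B) ->
  l <= x <= u -> l <= y <= u -> `|f x - f y| <= B * `|x - y|.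
Proof.
move=> fd fB; wlog xy : x y / y <= x.
  move=> wl xl yl; have [yx|/ltW xy] := leP y x; first exact: wl.
  by rewrite distrC [`|x - y|]distrC; exact: wl.
move=> /andP[x0 x1] /andP[y0 y1].
have [t /andP[t0 t1] ->] := @mvt R f df y x xy (fun t h => fd t ltac:(
  by case/andP: h => h1 h2; rewrite (le_trans y0 h1) (le_trans h2 x1))).
by rewrite normrM ler_wpM2r// fB// (le_trans y0 t0) (le_trans t1 x1).
Qed.

Lemma jet_lipschitz (J : jet R) c (r Bx By : R) : is_jet (sqr2 c r) J ->
  (forall p, sqr2 c r p -> `|jx J p| <= Bx) -> (forall p, sqr2 c r p -> `|jy J p| <= By) ->
  forall p q, sqr2 c r p -> sqr2 c r q ->
  `|j0 J p - j0 J q| <= Bx * `|p.1 - q.1| + By * `|p.2 - q.2|.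
Proof.
move=> hJ hx hy [p1 p2] [q1 q2] [/= p1S p2S] [/= q1S q2S].
rewrite -(subrK (j0 J (q1, p2)) (j0 J (p1, p2))) -addrA.
apply: le_trans (ler_normD _ _) _; apply: lerD.
  apply: (@lipschitz_line (fun x => j0 J (x, p2)) (fun x => jx J (x, p2)) (c.1 - r) (c.1 + r)).
  - by move=> t tS; have [] := hJ (t, p2) => //; move=> _ [].
  - by move=> t tS; apply: hx.
  - by move: p1S; rewrite in_itv.
  - by move: q1S; rewrite in_itv.
apply: (@lipschitz_line (fun y => j0 J (q1, y)) (fun y => jy J (q1, y)) (c.2 - r) (c.2 + r)).
- by move=> t tS; have [] := hJ (q1, t) => //; move=> _ [].
- by move=> t tS; apply: hy.
- by move: p2S; rewrite in_itv.
- by move: q2S; rewrite in_itv.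
Qed.

End Lipschitz.

(** * Local estimates of the extension constant by curvature *)

Section Criterion.
Variable R : realType.
Local Notation C := ((R[i])^o).

Lemma der_local (f g : R -> R) (x d : R) : (\forall y \near x, f y = g y) ->
  is_derive x 1 g d -> is_derive x 1 f d.
Proof.
move=> /[dup] /nbhs_singleton fgx /nbhs_ballP[b /= b0 bP] /is_derive_epsP dg.
apply/is_derive_epsP => e /dg[t t0 tP]; exists (Num.min t b); first by rewrite lt_min t0.
move=> h; rewrite lt_min => /andP[ht hb]; rewrite fgx bP; first exact: tP.
by rewrite /ball/= opprD addrA subrr sub0r normrN.
Qed.

Lemma derive1_val (f : R -> R) (x d : R) : is_derive x 1 f d -> derive1 f x = d.
Proof. by move=> df; rewrite derive1E derive_val. Qed.

Variables (U : set C) (Phi : C -> R) (J : jet R).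
Hypothesis openU : open U.
Let U2 : set (R * R) := [set p | U (cx p)].
Hypothesis hJ : is_jet U2 J.
Hypothesis JE : forall p, U2 p -> j0 J p = Phi (cx p).

Let nearU p : U2 p -> \forall q \near p, U2 q. Proof. exact: open_plane. Qed.

Let near_x p : U2 p -> \forall x \near p.1, U2 (x, p.2).
Proof.
move=> /nearU/nbhs_ballP[d /= d0 dP]; apply/nbhs_ballP; exists d => // x xd.
by apply: dP; split => //=; exact: ballxx.
Qed.

Let near_y p : U2 p -> \forall y \near p.2, U2 (p.1, y).
Proof.
move=> /nearU/nbhs_ballP[d /= d0 dP]; apply/nbhs_ballP; exists d => // y yd.
by apply: dP; split => //=; exact: ballxx.
Qed.

Lemma ddbar_lap a : U a -> ddbar_coef Phi a = lap J (pl a) / 4.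
Proof.
rewrite -[a in U a]plK => Ua.
have dx p : U2 p -> derive1 (fun x => Phi (x +i* p.2)%C) p.1 = jx J p.
  move=> Up; apply: derive1_val; have [_ [d _ _ _]] := hJ Up.
  by apply: der_local d; apply: filterS (near_x Up) => x /JE ->.
have dy p : U2 p -> derive1 (fun y => Phi (p.1 +i* y)%C) p.2 = jy J p.
  move=> Up; apply: derive1_val; have [_ [_ d _ _]] := hJ Up.
  by apply: der_local d; apply: filterS (near_y Up) => y /JE ->.
have [_ [_ _ dxx dyy]] := hJ Ua.
rewrite /ddbar_coef /lap; congr ((_ + _) / 4); apply: derive1_val.
  by apply: der_local dxx; apply: filterS (near_x Ua) => x Ux; exact: (dx (x, _) Ux).
by apply: der_local dyy; apply: filterS (near_y Ua) => y Uy; exact: (dy (_, y) Uy).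
Qed.

Lemma small_square a : U a -> exists2 t, 0 < t & forall r, 0 < r -> r < t ->
  sqr2 (pl a) r `<=` U2 /\ disc a r `<=` U.
Proof.
rewrite -[a in U a]plK => Ua; have /nbhs_ballP[t /= t0 tP] := nearU Ua.
exists t => // r r0 rt.
have sU : sqr2 (pl a) r `<=` U2.
  move=> p [/=]; rewrite !in_itv /= => /andP[h1 h2] /andP[h3 h4].
  by apply: tP; split; rewrite /ball/= ltr_norml; apply/andP; split; rewrite /=; lra.
split=> // s /(discE _ _ r0)/(disc2_sub r0)/sU.
by rewrite /U2 /= plK.
Qed.

(** [delta] is a real supremum, so a bound on the admissible radii is needed: a disc of radius [s]
    contains [a] and [a + s/2], and both have modulus at most [B]. *)
Lemma disc_le_delta a r : bounded_set U -> 0 < r -> disc a r `<=` U -> r <= delta U a.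
Proof.
move=> /boundedC[B B0 UB] r0 rU; apply: ub_le_sup; last by split.
exists (4 * B + 1) => s [s0 sU].
rewrite leNgt; apply/negP => Bs.
have aU : U a by apply: sU; rewrite /disc /= subrr cabsE /= expr0n /= addr0 sqrtr0.
have bU : U (a + ((s / 2)%:C)%C).
  apply: sU; rewrite /disc /= addrC addKr cabsE /= expr0n /= addr0 sqrtr_sqr ger0_norm; lra.
have h1 := le_trans (Re_le_cabs _) (UB _ aU).
have := le_trans (Re_le_cabs _) (UB _ bU).
have -> : complex.Re (a + ((s / 2)%:C)%C) = complex.Re a + s / 2 by case: (a) => x y.
by move: h1; rewrite !ler_norml => /andP[? ?] /andP[? ?]; lra.
Qed.

Variable Jyx : R * R -> R.
Hypothesis dyx : forall p, U2 p -> is_derive p.1 1 (fun x => jy J (x, p.2)) (Jyx p).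

Let phiE a r : 0 < r -> disc a r `<=` U -> forall t, disc a r t -> j0 J (pl t) = Phi t.
Proof. by move=> r0 rU t /rU; rewrite -{1}[t]plK => /JE; rewrite plK. Qed.

Let cphi a r : sqr2 (pl a) r `<=` U2 -> cont_on (pl a) r (j0 J).
Proof. by move=> sU p /sU/hJ[[]]. Qed.

Let taylor a : U a -> exists H : {poly R[i]}, forall eta, 0 < eta -> exists2 t, 0 < t &
  forall p, dist2 (pl a) p < t ^+ 2 ->
    `|j0 J p - j0 J (pl a) - 2 * (reval (pl a) H p - reval (pl a) H (pl a))
      - ddbar_coef Phi a * dist2 (pl a) p| <= eta * dist2 (pl a) p.
Proof.
move=> Ua; rewrite (ddbar_lap Ua); rewrite -[a in U a]plK in Ua.
exact: (jet_taylor hJ (nearU Ua) (dyx Ua)).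
Qed.

Let sqr_lt (r t : R) : 0 < r -> r < t -> r ^+ 2 < t ^+ 2.
Proof. by move=> r0 rt; rewrite ltr_sqr ?nnegrE// ltW// (lt_trans r0). Qed.

(** With [k = m + eps/2] the Taylor polynomial gives [V - V(c) <= - k s], and [exp (- k s) <= 1 - k
    s + 2 k^2 s^2 <= 1 - kap s]. The mean of the last expression is [1 - kap r^2 / 2], and
    [kap >= m]. *)
Lemma LPhi_positive_curvature a (m eps : R) : U a -> 0 < eps -> 0 < m ->
  m + eps <= ddbar_coef Phi a ->
  exists2 t, 0 < t & forall r, 0 < r -> r < t -> LPhi Phi a r <= expR (- (m / 2 * r ^+ 2)).
Proof.
move=> Ua eps0 m0 mc; have [H HP] := taylor Ua.
have e20 : 0 < eps / 2 by rewrite divr_gt0.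
have [t1 t10 t1P] := HP _ e20; have [t2 t20 t2P] := small_square Ua.
pose k := m + eps / 2; have k0 : 0 < k by rewrite addr_gt0.
(* Below this radius, and below 1, the loss [2 k^2 r^2] in [kap] is at most [eps / 2]. *)
have d0 : 0 < eps / (4 * k ^+ 2) by rewrite divr_gt0// mulr_gt0// exprn_gt0.
exists (Num.min (Num.min t1 t2) (Num.min 1 (eps / (4 * k ^+ 2)))).
  by rewrite !lt_min t10 t20 ltr01.
move=> r r0; rewrite !lt_min => /andP[/andP[r1 r2] /andP[r3 r4]].
have [sU dU] := t2P r r0 r2.
apply: le_trans (LPhi_upper r0 (cphi sU) (phiE r0 dU) (H := H) (fun p => erefl)) _.
set c := pl a; have r20 : 0 < r ^+ 2 by rewrite exprn_gt0.
have pr0 : 0 < pi * r ^+ 2 by rewrite mulr_gt0 ?pi_gt0.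
have rr : r ^+ 2 <= r by rewrite expr2 ger_pMl// ltW.
have kr : 2 * k ^+ 2 * r ^+ 2 <= eps / 2.
  have : r ^+ 2 <= eps / (4 * k ^+ 2) by lra.
  rewrite ler_pdivlMr ?mulr_gt0 ?exprn_gt0//; lra.
pose kap := k - 2 * k ^+ 2 * r ^+ 2.
have cV : cont_on c r (fun p => expR (2 * reval c H p - j0 J p - (2 * reval c H c - j0 J c))).
  by move=> p pS; have [c1 _] := cont_reim c H p; have c2 := cphi sU pS; cont.
have bound : pint (disc2 c r) (fun p => expR (2 * reval c H p - j0 J p - (2 * reval c H c - j0 J c)))
    <= pint (disc2 c r) (fun p => (1 - kap * r ^+ 2) + kap * (r ^+ 2 - dist2 c p) ^+ 1).
  apply: le_pint => // p; first by move=> _; cont.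
  rewrite /disc2 /= => pr; have s0 := dist2_ge0 c p; rewrite expr1.
  have := t1P p (lt_trans pr (sqr_lt r0 r1)); rewrite -/c ler_norml => /andP[h1 _].
  have h2 : ddbar_coef Phi a * dist2 c p >= (m + eps) * dist2 c p by rewrite ler_wpM2r.
  have h3 : 2 * reval c H p - j0 J p - (2 * reval c H c - j0 J c) <= - (k * dist2 c p).
    by rewrite /k; lra.
  apply: (@le_trans _ _ (expR (- (k * dist2 c p)))); first by rewrite ler_expR.
  have ks : 0 <= k * dist2 c p by rewrite mulr_ge0// ltW.
  apply: le_trans (expR_le_quadratic _) _; first by lra.
  rewrite sqrrN /kap; have : dist2 c p ^+ 2 <= dist2 c p * r ^+ 2.
    by rewrite expr2 ler_wpM2l// ltW.
  have := sqr_ge0 k; rewrite exprMn; move: (k ^+ 2) (dist2 c p ^+ 2) => K D K0 Ds.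
  have := ler_wpM2l K0 Ds; lra.
have cs : cont_on c r (fun p => (r ^+ 2 - dist2 c p) ^+ 1) by move=> p _; cont.
have E : pint (disc2 c r) (fun p => (1 - kap * r ^+ 2) + kap * (r ^+ 2 - dist2 c p) ^+ 1)
    = pi * r ^+ 2 * (1 - kap * r ^+ 2 / 2).
  rewrite pintD//; last 2 first.
  - by move=> p _; exact: cont_cst.
  - by move=> p _; cont.
  by rewrite pint_cst// pintZ// disc_moment//; field.
rewrite ler_pdivrMr//; apply: le_trans bound _; rewrite E mulrC ler_wpM2r ?(ltW pr0)//.
apply: le_trans (expR_ge1Dx _); rewrite lerD2l lerN2 [leRHS]mulrAC ler_wpM2r ?(ltW r20)//.
have kE : k = m + eps / 2 by [].
rewrite /kap; lra.
Qed.

Lemma LPhi_lower_curvature a (k : R) : U a -> ddbar_coef Phi a < k ->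
  exists2 t, 0 < t & forall r, 0 < r -> r < t -> 1 - k * r ^+ 2 / 2 <= LPhi Phi a r.
Proof.
move=> Ua ck; have [H HP] := taylor Ua.
have e0 : 0 < k - ddbar_coef Phi a by rewrite subr_gt0.
have [t1 t10 t1P] := HP _ e0; have [t2 t20 t2P] := small_square Ua.
have k10 : 0 < `|k| + 1 by rewrite ltr_wpDl.
exists (Num.min (Num.min t1 t2) (Num.min 1 (`|k| + 1)^-1)).
  by rewrite !lt_min t10 t20 ltr01 invr_gt0.
move=> r r0; rewrite !lt_min => /andP[/andP[r1 r2] /andP[r3 r4]].
have [sU dU] := t2P r r0 r2.
apply: (LPhi_lower r0 (cphi sU) (phiE r0 dU) (H := H)).
  have rr : r ^+ 2 <= r by rewrite expr2 ger_pMl// ltW.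
  apply: (@le_trans _ _ ((`|k| + 1) * r)).
    apply: (@le_trans _ _ ((`|k| + 1) * r ^+ 2)).
      by rewrite ler_wpM2r ?sqr_ge0//; have := ler_norm k; lra.
    by rewrite ler_wpM2l// ltW.
  by rewrite -ler_pdivlMl// mulr1 ltW.
move=> p; rewrite /disc2 /= => pr; have := t1P p (lt_trans pr (sqr_lt r0 r1)).
by rewrite ler_norml => /andP[_]; lra.
Qed.

(** The threshold on [r] depends only on the bound [M] of the Laplacian on a fixed square. For each
    such [r] the error [e] is arbitrary: [eta], and with it the polynomial [H], is chosen after
    [r]. *)
Lemma LPhi_subharmonic a : U a -> (forall t, U t -> 0 <= ddbar_coef Phi t) ->
  exists2 t, 0 < t & forall r, 0 < r -> r < t -> LPhi Phi a r <= 1.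
Proof.
move=> Ua sub; have [t1 t10 t1P] := small_square Ua.
pose r0 := t1 / 2; have r00 : 0 < r0 by rewrite divr_gt0.
have r0t : r0 < t1 by rewrite /r0; lra.
have [sU0 _] := t1P r0 r00 r0t; set c := pl a in sU0 *.
have cj p : sqr2 c r0 p -> [/\ {for p, continuous (jx J)}, {for p, continuous (jy J)},
    {for p, continuous (jxx J)} & {for p, continuous (jyy J)}].
  by move=> /sU0/hJ[[]].
have [M M0 MP] : exists2 B, 0 < B & forall p, sqr2 c r0 p -> `|lap J p| <= B.
  by apply: bounded_sqr2 => p /cj[? ? ? ?]; rewrite /lap; cont.
have [Bx Bx0 BxP] : exists2 B, 0 < B & forall p, sqr2 c r0 p -> `|jx J p| <= B.
  by apply: bounded_sqr2 => p /cj[].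
have [By By0 ByP] : exists2 B, 0 < B & forall p, sqr2 c r0 p -> `|jy J p| <= B.
  by apply: bounded_sqr2 => p /cj[].
have M10 : 0 < 6 * (M + 1) by lra.
(* Ensures [3 M r^2 <= 1/2]; [eta <= 1/16] supplies the other half of the smallness condition. *)
exists (Num.min r0 (Num.min 1 (6 * (M + 1))^-1)); first by rewrite !lt_min r00 ltr01 invr_gt0.
move=> r rp; rewrite !lt_min => /andP[rr0 /andP[rl1 rM]].
have [sU dU] := t1P r rp (lt_trans rr0 r0t); rewrite -/c in sU.
have sub_sqr p : sqr2 c r p -> sqr2 c r0 p.
  by move=> [/=]; rewrite !in_itv /= => /andP[? ?] /andP[? ?];
    split; rewrite /= in_itv /=; apply/andP; split; lra.
have Mr : 3 * M * r ^+ 2 <= 1 / 2.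
  have : 6 * (M + 1) * r <= 1 by rewrite -ler_pdivlMl// mulr1 ltW.
  have : r ^+ 2 <= r by rewrite expr2 ger_pMl// ltW.
  have := M0; nra.
have hJr : is_jet (sqr2 c r) J by move=> p /sU/hJ.
have lip p q : sqr2 c r p -> sqr2 c r q ->
    `|j0 J p / 2 - j0 J q / 2| <= (Bx + By) / 2 * (`|p.1 - q.1| + `|p.2 - q.2|).
  move=> pS qS; rewrite -mulrBl normrM [`|2^-1|]ger0_norm ?invr_ge0//.
  have := jet_lipschitz hJr (fun p h => BxP p (sub_sqr p h)) (fun p h => ByP p (sub_sqr p h)) pS qS.
  have := mulr_ge0 (ltW Bx0) (normr_ge0 (p.2 - q.2)).
  have := mulr_ge0 (ltW By0) (normr_ge0 (p.1 - q.1)); lra.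
have r2 : 0 < r ^+ 2 by rewrite exprn_gt0.
have pr0 : 0 < pi * r ^+ 2 by rewrite mulr_gt0 ?pi_gt0.
(* Since [eta <= 1], the error in [exp_mean_bound] is at most [eta * K]. *)
pose K := 2 * (pi * M * r ^+ 4 + 16 * r ^+ 2).
have K0 : 0 <= K.
  rewrite mulr_ge0// addr_ge0// mulr_ge0 ?(ltW r2)// ?exprn_ge0 ?(ltW rp)// mulr_ge0 ?pi_ge0//.
  exact: ltW.
apply/ler_addgt0Pr => e e0.
have K1 : 0 < K + 1 by rewrite ltr_wpDl.
have eK0 : 0 < e * (pi * r ^+ 2) / (K + 1) by rewrite divr_gt0// mulr_gt0.
pose eta := Num.min (1 / 16) (e * (pi * r ^+ 2) / (K + 1)).
have eta0 : 0 < eta by rewrite lt_min eK0 divr_gt0.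
have eta1 : eta <= 1 / 16 by rewrite ge_min lexx.
have etaK : eta * K <= e * (pi * r ^+ 2).
  have : eta <= e * (pi * r ^+ 2) / (K + 1) by rewrite ge_min lexx orbT.
  rewrite ler_pdivlMr//; lra.
have eta2 : 0 < eta / 2 by rewrite divr_gt0.
have BB : 0 <= (Bx + By) / 2 by lra.
have [H HP] := circle_approximation rp BB eta2 lip.
(* [H] approximates half of the weight within [eta / 2]; the added constant [eta] moves the boundary
   values into [[0, 2 eta]] and cancels in [V - V(c)]. *)
pose V := jet_add (jet_add (hjet c (H + H)) (jet_opp J))
  (Jet (fun=> eta) (fun=> 0) (fun=> 0) (fun=> 0) (fun=> 0)).
have hV : is_jet (sqr2 c r) V.
  apply: is_jet_add; last by move=> p _; split; split => /=; try (by cont); der.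
  by apply: is_jet_add; [exact: is_jet_hjet|exact: is_jet_opp].
have VE p : j0 V p = 2 * reval c H p - j0 J p + eta by rewrite /= revalD; ring.
have lapV p : disc2 c r p -> 0 <= - lap V p <= M.
  move=> /(disc2_sub rp) pS.
  have -> : - lap V p = lap J p.
    have := lap_hjet c (H + H) p; rewrite /lap /=; lra.
  have := sub (cx p) (sU _ pS); rewrite ddbar_lap ?cxK; last exact: sU.
  have := MP p (sub_sqr p pS); rewrite ler_norml => /andP[_ ? ?].
  by apply/andP; split; lra.
have bV p : dist2 c p = r ^+ 2 -> 0 <= j0 V p <= 2 * eta.
  move=> /HP; rewrite VE ler_norml => /andP[? ?]; apply/andP; split; lra.
have small : 3 * M * r ^+ 2 + 8 * eta <= 1 by lra.
have main := exp_mean_bound rp (ltW M0) (ltW eta0) hV lapV bV small.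
apply: le_trans (LPhi_upper rp (cphi sU) (phiE rp dU) (H := H) (fun p => erefl)) _.
rewrite ler_pdivrMr//.
rewrite (_ : (fun p => _) = (fun p => expR (j0 V p - j0 V c))); last first.
  by apply/funext => p; rewrite !VE; congr expR; ring.
apply: le_trans main _.
have -> : (1 + e) * (pi * r ^+ 2) = pi * r ^+ 2 + e * (pi * r ^+ 2) by ring.
rewrite lerD2l; apply: le_trans etaK.
have -> : 2 * (eta * pi * M * r ^+ 4 + 16 * r ^+ 2 * eta ^+ 2) =
  eta * (2 * (pi * M * r ^+ 4 + 16 * r ^+ 2 * eta)) by ring.
rewrite ler_wpM2l ?(ltW eta0)// /K ler_pM2l// lerD2l ger_pMr ?mulr_gt0//; lra.
Qed.

End Criterion.

Theorem theorem3p4 (R : realType) (n : nat)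
  (U : set (R[i])^o) (Om : set 'rV[(R[i])^o]_n)
  (phi : (R[i])^o -> 'rV[(R[i])^o]_n -> R)
  (Phi : (R[i])^o -> R) (g : (R[i])^o -> R) :
  bounded_domain U -> bounded_domain Om ->
  smooth_on_closure U Om phi ->
  (forall t, U t ->
     (expR (- Phi t))%:E = cnint (fun z => (\1_Om z * expR (- phi t z))%:E)) ->
  (forall t, U t -> 0 <= g t) ->
  ((forall t, U t -> g t <= ddbar_coef Phi t) <->
   (forall a, U a -> forall eps : R, 0 < eps ->
      exists reps : R, 0 < reps < delta U a /\
        forall r : R, 0 < r < reps ->
          LPhi Phi a r <= expR (- (Num.max ((g a - eps) / 2) 0 * r ^+ 2)))).
Proof.
move=> hU hOm hphi PhiE g0.
have [J [Jyx [hJ JE dyx]]] := potential_jet hU hOm hphi PhiE.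
have [_ [oU [_ bU]]] := hU.
split=> [gc a Ua eps eps0|H t Ut].
  have [t t0 tP] : exists2 t, 0 < t & forall r, 0 < r -> r < t ->
      LPhi Phi a r <= expR (- (Num.max ((g a - eps) / 2) 0 * r ^+ 2)).
    have [m0|m0] := ltP 0 (g a - eps).
      rewrite (_ : Num.max _ _ = (g a - eps) / 2); last by apply/max_idPl; lra.
      apply: (LPhi_positive_curvature oU hJ JE dyx Ua eps0 m0).
      by rewrite subrK gc.
    rewrite (_ : Num.max _ _ = 0); last by apply/max_idPr; lra.
    have [t t0 tP] := LPhi_subharmonic oU hJ JE Ua (fun t Ut => le_trans (g0 t Ut) (gc t Ut)).
    by exists t => // r r0 rt; rewrite mul0r oppr0 expR0; exact: tP.
  have [s s0 sP] := small_square oU Ua.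
  pose r := Num.min t s / 2; have ts0 : 0 < Num.min t s by rewrite lt_min t0.
  have rs : 2 * r <= s by rewrite /r mulrC divfK// ge_min lexx orbT.
  have rt : 2 * r <= t by rewrite /r mulrC divfK// ge_min lexx.
  have r0 : 0 < r by rewrite divr_gt0.
  exists r; rewrite r0 /=; split.
    (* A slightly larger disc still lies in [U], which makes the inequality with [delta U a]
       strict. *)
    have r32 : 0 < 3 / 2 * r by rewrite mulr_gt0.
    have [|_ dU] := sP _ r32; first by lra.
    by have := disc_le_delta bU r32 dU; lra.
  by move=> r' /andP[r'0 r'r]; apply: tP => //; lra.
rewrite leNgt; apply/negP => cg.
(* One third serves as [eps] in the hypothesis, one third separates [k] from the curvature; the last
   leaves a gap of [d / 2] between the two rates. *)
pose d := (g t - ddbar_coef Phi t) / 3; have d0 : 0 < d by rewrite divr_gt0// subr_gt0.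
pose k := ddbar_coef Phi t + d; have ck : ddbar_coef Phi t < k by rewrite ltrDl.
have [s s0 sP] := LPhi_lower_curvature oU hJ JE dyx Ut ck.
have [reps [/andP[reps0 _] repsP]] := H t Ut d d0.
pose m := Num.max ((g t - d) / 2) 0.
have m0 : 0 <= m by rewrite le_max lexx orbT.
have mk : d / 2 <= m - k / 2.
  have : (g t - d) / 2 <= m by rewrite le_max lexx.
  rewrite /k /d; lra.
(* Makes the second-order term [2 m^2 r^2] of the exponential smaller than the gap [d / 2]. *)
have q0 : 0 < d / (8 * (m ^+ 2 + 1)) by rewrite divr_gt0// mulr_gt0// ltr_wpDl ?sqr_ge0.
pose r := Num.min (Num.min s reps) (Num.min 1 (d / (8 * (m ^+ 2 + 1)))) / 2.
have rr0 : 0 < Num.min (Num.min s reps) (Num.min 1 (d / (8 * (m ^+ 2 + 1)))).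
  by rewrite !lt_min s0 reps0 ltr01.
have r0 : 0 < r by rewrite divr_gt0.
have r2 : 2 * r = Num.min (Num.min s reps) (Num.min 1 (d / (8 * (m ^+ 2 + 1)))).
  by rewrite /r mulrC divfK.
have rs : 2 * r <= s by rewrite r2 !ge_min lexx.
have rreps : 2 * r <= reps by rewrite r2 !ge_min lexx !orbT.
have r1 : 2 * r <= 1 by rewrite r2 !ge_min lexx !orbT.
have rd : 2 * r <= d / (8 * (m ^+ 2 + 1)) by rewrite r2 !ge_min lexx !orbT.
have lo := sP r r0 ltac:(lra).
have up : LPhi Phi t r <= expR (- (m * r ^+ 2)) by apply: repsP; rewrite r0 /=; lra.
have rsq : 0 < r ^+ 2 by rewrite exprn_gt0.
have mr0 : 0 <= m * r ^+ 2 by rewrite mulr_ge0// ltW.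
have ex : expR (- (m * r ^+ 2)) <= 1 + - (m * r ^+ 2) + 2 * (- (m * r ^+ 2)) ^+ 2.
  by apply: expR_le_quadratic; lra.
have h : (m - k / 2) * r ^+ 2 <= 2 * m ^+ 2 * r ^+ 2 * r ^+ 2.
  have := le_trans lo (le_trans up ex); rewrite sqrrN exprMn; lra.
have {}h : m - k / 2 <= 2 * m ^+ 2 * r ^+ 2 by rewrite -(ler_pM2r rsq).
have : r ^+ 2 <= r by rewrite expr2 ger_pMl//; lra.
have mm := sqr_ge0 m; move: rd; rewrite ler_pdivlMr ?mulr_gt0 ?ltr_wpDl// => rd rrr.
have := ler_wpM2l mm rrr; lra.
Qed.
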